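(* Let $K,N,\tau\ge1$ be integers, let $\pi_1,\dots,\pi_K>0$ with $\sum_{c=1}^K\pi_c=1$, and let $\mathbf R_1,\dots,\mathbf R_K\in\mathbb C^{N\times N}$ be covariance matrices (Hermitian positive semidefinite). Consider the Gaussian-mixture source of vectors $\mathbf h_t\in\mathbb C^N$ with latent state $C\in\{1,\dots,K\}$, $\Pr(C=c)=\pi_c$, and $\mathbf h\mid(C=c)\sim\mathcal{CN}(\mathbf 0,\mathbf R_c)$. Assume that the latent state remains constant over $\tau$ consecutive feedback intervals (i.e. over $\tau$ consecutive source vectors) and that its label is fed back losslessly once per state-coherence interval, the label being perfectly shared between the encoder and the decoder. Then the following rate is achievable (at distortion $D$): $$R_{\rm GMTC}(D)=R_{\rm cond}(D)+\frac{H(C)}{\tau N},\qquad H(C)=-\sum_{c=1}^K\pi_c\log_2\pi_c,$$ where $R_{\rm cond}(D)$ is the conditional rate--distortion benchmark defined in the context.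
   Context: $\mathcal{CN}(\mathbf 0,\mathbf R)$ is the zero-mean proper complex Gaussian law on $\mathbb C^N$ with covariance $\mathbf R$. The marginal density of a source vector is $p(\mathbf h)=\sum_{c=1}^K\pi_c\,\mathcal{CN}(\mathbf h;\mathbf 0,\mathbf R_c)$. Achievability. A rate-$R$ feedback code of blocklength $n$ consists of an encoder $f_n:(\mathbb C^N)^n\to\{1,\dots,2^{nNR}\}$ and a decoder $g_n:\{1,\dots,2^{nNR}\}\to(\mathbb C^N)^n$; the reconstruction of $\mathbf h^n=(\mathbf h_1,\dots,\mathbf h_n)$ is $\hat{\mathbf h}^n=g_n(f_n(\mathbf h^n))$. The rate $R$ is in bits per complex dimension, and the feedback here comprises both the losslessly coded state label and the description of the vectors. The distortion is $\mathbb E\big[\frac1{nN}\sum_{t=1}^n\|\mathbf h_t-\hat{\mathbf h}_t\|_2^2\big]$. A pair $(R,D)$ is achievable if there is a sequence of rate-$R$ codes of blocklength $n$ whose expected distortion is at most $D$ as $n\to\infty$. Conditional benchmark: $$R_{\rm cond}(D)=\min_{\{D_c\ge0\}:\ \sum_c\pi_cD_c\le D}\ \sum_{c=1}^K\pi_cR_c(D_c),$$ where $R_c$ is the rate--distortion function of $\mathcal{CN}(\mathbf 0,\mathbf R_c)$ in bits per complex dimension: $R_c(D_c)=\frac1N\inf I(\mathbf h;\hat{\mathbf h})$ over conditional laws $p(\hat{\mathbf h}|\mathbf h)$ with $\frac1N\mathbb E\|\mathbf h-\hat{\mathbf h}\|_2^2\le D_c$, where $\mathbf h\sim\mathcal{CN}(\mathbf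 0,\mathbf R_c)$. Classically, with $\lambda_{c,1},\dots,\lambda_{c,N}$ the eigenvalues of $\mathbf R_c$ and $[x]_+=\max\{x,0\}$, it has the parametric form $R_c(D_c)=\frac1N\sum_{m=1}^N[\log_2(\lambda_{c,m}/\mu_c)]_+$, $D_c=\frac1N\sum_{m=1}^N\min\{\lambda_{c,m},\mu_c\}$, for some water level $\mu_c\ge0$. *)

(* Defs.v *)
From HB Require Import structures.
From mathcomp Require Import all_boot all_order all_algebra.
From mathcomp Require Import complex spectral.
From mathcomp Require Import all_classical all_reals all_analysis.

Set Implicit Arguments.
Unset Strict Implicit.
Unset Printing Implicit Defensive.

Import Order.TTheory GRing.Theory Num.Theory.
Import numFieldNormedType.Exports.

Local Open Scope classical_set_scope.
Local Open Scope ring_scope.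
Local Open Scope complex_scope.
Local Open Scope sesquilinear_scope.

(* C^N as a type of its own, so that it can carry the Borel sigma-algebra of
   R^(2N), generated by the real and imaginary parts of the coordinates. *)
Definition cvec (R : realType) (N : nat) : Type := 'cV[R[i]]_N.

HB.instance Definition _ (R : realType) (N : nat) :=
  GRing.Zmodule.on (cvec R N).
HB.instance Definition _ (R : realType) (N : nat) :=
  isPointed.Build (cvec R N) 0.

Definition cvec_display : measure_display. Proof. exact. Qed.

Section cvec_measurable.
Context {R : realType} {N : nat}.

Definition cvec_coord (i : 'I_N) (v : cvec R N) : R * R :=
  (complex.Re (v i ord0), complex.Im (v i ord0)).

Let cvec_set0 : g_sigma_preimage cvec_coord set0.
Proof. exact: sigma_algebra0. Qed.

Let cvec_setC A : g_sigma_preimage cvec_coord A ->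
  g_sigma_preimage cvec_coord (~` A).
Proof. exact: sigma_algebraC. Qed.

Let cvec_bigcup (F : (set (cvec R N))^nat) :
  (forall i, g_sigma_preimage cvec_coord (F i)) ->
  g_sigma_preimage cvec_coord (\bigcup_i F i).
Proof. exact: sigma_algebra_bigcup. Qed.

HB.instance Definition _ := @isMeasurable.Build cvec_display (cvec R N)
  (g_sigma_preimage cvec_coord) cvec_set0 cvec_setC cvec_bigcup.

End cvec_measurable.

Definition sqnorm (R : realType) (N : nat) (v : cvec R N) : R :=
  \sum_(i < N) (complex.Re (v i ord0) ^+ 2 + complex.Im (v i ord0) ^+ 2).

Definition log2 (R : realType) (x : R) : R := ln x / ln 2.

Definition covariance_matrix (R : realType) (N : nat) (S : 'M[R[i]]_N) : Prop :=
  S \is hermsymmx /\ forall a : 'cV[R[i]]_N, 0 <= (a ^t* *m S *m a) ord0 ord0.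

(* The library's [normal_prob m 0] is not a point mass, so the degenerate
   case, needed for singular covariances, is treated separately. *)
Definition normal_law (R : realType) (m s : R) : set (measurableTypeR R) -> \bar R :=
  if s == 0 then \d_ (m : measurableTypeR R) else normal_prob m s.

(* Only meaningful when the real and imaginary parts of f are integrable. *)
Definition cexpectation (R : realType) (N : nat)
    (mu : probability (cvec R N) R) (f : cvec R N -> R[i]) : R[i] :=
  (\int[mu]_x complex.Re (f x)) +i* (\int[mu]_x complex.Im (f x)).

(* mu = CN(0, S): every real linear functional is (possibly degenerate) normal,
   the mean is 0, E[h h^H] = S, and E[h h^T] = 0 (properness). The first
   conjunct ensures the integrability required by the other three. *)
Definition proper_gaussian (R : realType) (N : nat) (S : 'M[R[i]]_N)
    (mu : probability (cvec R N) R) : Prop :=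
  [/\ forall a : 'cV[R[i]]_N, exists m s : R,
        forall A : set (measurableTypeR R), measurable A ->
          mu [set h : cvec R N |
                A (complex.Re ((a ^t* *m (h : 'cV[R[i]]_N)) ord0 ord0))]
          = normal_law m s A,
      forall i, cexpectation mu (fun h => h i ord0) = 0,
      forall i j, cexpectation mu (fun h => h i ord0 * (h j ord0)^*%R) = S i j &
      forall i j, cexpectation mu (fun h => h i ord0 * h j ord0) = 0].

HB.instance Definition _ d d' (T : measurableType d) (T' : measurableType d') :=
  isMeasurableFun.Build _ _ (T * T')%type T fst measurable_fst.
HB.instance Definition _ d d' (T : measurableType d) (T' : measurableType d') :=
  isMeasurableFun.Build _ _ (T * T')%type T' snd measurable_snd.

Section information.
Context {R : realType}.

(* Relative entropy D(nu || mu) in bits. The integral is always defined, since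
   the negative part of the integrand is integrable. *)
Definition relative_entropy d (T : measurableType d)
    (nu mu : probability T R) : \bar R :=
  if `[< nu `<< mu >] then
    (\int[nu]_x
      (log2 (fine (Radon_Nikodym (charge_of_finite_measure nu) mu x)))%:E)%E
  else +oo%E.

Definition mutual_information d d' (T : measurableType d)
    (T' : measurableType d') (Q : probability (T * T')%type R) : \bar R :=
  relative_entropy Q (distribution Q fst \x distribution Q snd)%E.

Definition joint_law d d' (T : measurableType d) (T' : measurableType d')
    (mu : probability T R) (k : R.-pker T ~> T')
    (Q : probability (T * T')%type R) : Prop :=
  forall A, measurable A -> Q A = (\int[mu]_x k x (xsection A x))%E.

(* Bits per complex dimension; +oo when no conditional law of finite mutual
   information meets the distortion constraint. *)
Definition rate_distortion (N : nat) (mu : probability (cvec R N) R) (D : R) :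
    \bar R :=
  ((N%:R^-1)%:E * ereal_inf [set mutual_information Q |
     Q in [set Q : probability (cvec R N * cvec R N)%type R |
       (exists k : R.-pker (cvec R N) ~> (cvec R N), joint_law mu k Q) /\
       ((N%:R^-1)%:E * \int[Q]_z (sqnorm (z.1 - z.2))%:E <= D%:E)%E]])%E.

Definition rate_cond (K N : nat) (p : 'I_K -> R)
    (mu : 'I_K -> probability (cvec R N) R) (D : R) : \bar R :=
  ereal_inf [set (\sum_(c < K) (p c)%:E * rate_distortion (mu c) (Dc c))%E |
    Dc in [set Dc : 'I_K -> R |
      (forall c, 0 <= Dc c) /\ \sum_(c < K) p c * Dc c <= D]].

Definition entropy2 (K : nat) (p : 'I_K -> R) : R :=
  - \sum_(c < K) p c * log2 (p c).

Definition rate_gmtc (K N tau : nat) (p : 'I_K -> R)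
    (mu : 'I_K -> probability (cvec R N) R) (D : R) : \bar R :=
  (rate_cond p mu D + (entropy2 p / (tau%:R * N%:R))%:E)%E.

End information.

(* Number of state-coherence intervals met by the times 0, ..., n - 1, i.e. the
   ceiling of n / tau. *)
Definition intervals (tau n : nat) : nat := ((n + tau.-1) %/ tau)%N.

Section source.
Context {R : realType} {K N : nat} {d : measure_display}
  {Omega : measurableType d}.
Variables (tau : nat) (P : probability Omega R).

(* C j is the state during the j-th coherence interval, which consists of the
   times t with t %/ tau = j. The states are i.i.d. with law p and, given the
   states, the vectors h t are independent with respective laws
   mu (C (t %/ tau)). *)
Definition mixture_source (p : 'I_K -> R) (mu : 'I_K -> probability (cvec R N) R)
    (C : nat -> Omega -> 'I_K) (h : nat -> Omega -> cvec R N) : Prop :=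
  [/\ forall j c, measurable [set w | C j w = c],
      forall t, measurable_fun [set: Omega] (h t) &
      forall (n : nat) (c : nat -> 'I_K) (A : nat -> set (cvec R N)),
        (forall t, measurable (A t)) ->
        P [set w | (forall j, (j < intervals tau n)%N -> C j w = c j) /\
                   (forall t, (t < n)%N -> A t (h t w))]
        = ((\prod_(j < intervals tau n) p (c j))%:E *
           \prod_(t < n) mu (c (t %/ tau)%N) (A t))%E].

Definition source_block (h : nat -> Omega -> cvec R N) (n : nat) (w : Omega) :
    n.-tuple (cvec R N) := [tuple h t w | t < n].

Definition label_block (C : nat -> Omega -> 'I_K) (n : nat) (w : Omega) :
    (intervals tau n).-tuple 'I_K := [tuple C j w | j < intervals tau n].

Definition block_distortion (n : nat) (x y : n.-tuple (cvec R N)) : R :=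
  (n%:R * N%:R)^-1 * \sum_(t < n) sqnorm (tnth x t - tnth y t).

(* The integer part of 2^(nNr), the size of the index set of a rate-r code. *)
Definition index_count (r : R) (n : nat) : nat :=
  Num.truncn (2 `^ (n%:R * N%:R * r)).

Record code (n M : nat) := Code {
  encode : n.-tuple (cvec R N) -> 'I_M ;
  decode : 'I_M -> n.-tuple (cvec R N) ;
  encode_measurable : forall m, measurable (encode @^-1` [set m]) }.

Definition achievable (h : nat -> Omega -> cvec R N) (r D : R) : Prop :=
  exists f : forall n, code n (index_count r n),
    (limn_esup (fun n => 'E_P[fun w =>
       block_distortion (source_block h n w)
         (decode (f n) (encode (f n) (source_block h n w)))]) <= D%:E)%E.

(* A code whose encoder knows the state labels, and whose index conveys them to
   the decoder together with the description of the vectors. *)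
Record label_code (n M : nat) := LabelCode {
  lencode : (intervals tau n).-tuple 'I_K -> n.-tuple (cvec R N) -> 'I_M ;
  ldecode : 'I_M -> n.-tuple (cvec R N) ;
  ldecode_label : 'I_M -> (intervals tau n).-tuple 'I_K ;
  lencode_measurable : forall c m, measurable (lencode c @^-1` [set m]) }.

(* Losslessness is meant in the sense of fixed-length source coding: the
   probability that the decoded label sequence differs from the true one tends
   to 0 (zero error would cost log2 K bits per label, not the entropy). *)
Definition achievable_with_labels (C : nat -> Omega -> 'I_K)
    (h : nat -> Omega -> cvec R N) (r D : R) : Prop :=
  exists f : forall n, label_code n (index_count r n),
    let index n w := lencode (f n) (label_block C n w) (source_block h n w) in
    (P [set w | ldecode_label (f n) (index n w) <> label_block C n w]
       @[n --> \oo] --> 0%E) /\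
    (limn_esup (fun n => 'E_P[fun w =>
       block_distortion (source_block h n w) (ldecode (f n) (index n w))])
       <= D%:E)%E.

End source.

(* Main.v *)
(* The benchmark is compared with codes directly through its definition by mutual informations, so
   neither water-filling nor the existence of optimal test channels is needed. Near-optimal test
   channels are quantized to finite alphabets: mutual information does not increase (data
   processing), and the distortion hardly changes because the Gaussian tails contribute a negligible
   second moment. For the finite problem a random codebook of pairs (label sequence, reproduction)
   is drawn i.i.d. from the product output law. By Chernoff bounds for the distortion and for the
   information density, in which the label costs H(C) per coherence interval, the codebook covers
   the source at every rate above R_GMTC(D). An encoder that does not see the labels simply picks
   the best codeword.
   Achieving the exact rate r > 0 takes time sharing: a vanishing fraction of the block is left
   undescribed. If r = 0, the Donsker-Varadhan inequality with the test function - s * dist shows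
   that vanishing mutual information forces E |h|^2 <= N D, so the zero reconstruction suffices. *)

Require Import Defs.
From HB Require Import structures.
From mathcomp Require Import all_boot all_order all_algebra.
From mathcomp Require Import complex spectral.
From mathcomp Require Import all_classical all_reals all_analysis.
From mathcomp Require Import measurable_realfun.
From mathcomp Require Import ring lra zify.

Set Implicit Arguments.
Unset Strict Implicit.
Unset Printing Implicit Defensive.

Import Order.TTheory GRing.Theory Num.Theory.
Import numFieldNormedType.Exports.

Local Open Scope classical_set_scope.
Local Open Scope ring_scope.

(** * Random coding for finite sources *)

(** Over finite alphabets the distortion and the information density are bounded, so that
    exponential moments exist whatever the test channel; this is what quantization buys. Labels and
    vectors share one index rather than being coded in two stages, and one covering statement then
    serves both conclusions: covering demands exact equality of the label sequence, and a codeword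
    covering a pair also meets the distortion bound for an encoder that sees the vectors alone. The
    finite part counts in nats; [ln 2] enters where it meets the definitions. The obstacle is the
    rate itself: random coding needs a strict excess, whereas [achievable] fixes the index set at
    the exact rate r. Describing only n' < n vectors with the indices meant for n raises the rate
    per described vector to r n / n', a strict gain only if r > 0. Hence the separate treatment of r
    = 0, where mutual informations tending to 0 must be handled without a minimizing channel. *)

Section finite_probability.
Context {R : realType}.

(** From [expR (- x) >= 1 - x] and [(1 + x + 2 x^2) (1 - x) = 1 + x^2 (1 - 2 x)]. The absence of a
    lower bound on [x] permits its use for arbitrary negative exponents. *)
Lemma expR_le_quadratic (x : R) : x <= 2^-1 -> expR x <= 1 + x + 2 * x ^+ 2.
Proof.
move=> x2; have := expR_ge1Dx (- x); rewrite expRN => h.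
have x1 : 0 < 1 - x by lra.
have : expR x <= (1 - x)^-1.
  by rewrite -[leLHS]invrK lef_pV2// posrE invr_gt0 expR_gt0.
move/le_trans; apply; rewrite -[leLHS]mul1r ler_pdivrMr//.
have : 0 <= x ^+ 2 * (1 - 2 * x) by rewrite mulr_ge0 ?sqr_ge0//; lra.
by rewrite !expr2 => ?; lra.
Qed.

(** Centring at the mean [m] removes the first-order term; [4 s B <= 1] keeps [s (X - m)] below 1/2,
    and [2 (2 s B)^2] gives the constant 8. *)
Lemma mgf_le (T : finType) (w X : T -> R) (B s : R) :
  (forall x, 0 <= w x) -> \sum_x w x = 1 -> (forall x, `|X x| <= B) ->
  0 <= s -> 4 * (s * B) <= 1 ->
  \sum_x w x * expR (s * X x)
    <= expR (s * (\sum_x w x * X x) + 8 * (s * B) ^+ 2).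
Proof.
move=> w0 w1 XB s0 sB; set m := \sum_x w x * X x.
have mB : `|m| <= B.
  apply: (le_trans (ler_norm_sum _ _ _)).
  rewrite -[leRHS]mul1r -w1 mulr_suml ler_sum// => x _.
  by rewrite normrM ger0_norm// ler_wpM2l.
have YB x : `|s * (X x - m)| <= 2 * (s * B).
  rewrite normrM ger0_norm// mulrCA ler_wpM2l//.
  by rewrite (le_trans (ler_normB _ _))//; have := XB x; lra.
have -> : \sum_x w x * expR (s * X x) =
    expR (s * m) * \sum_x w x * expR (s * (X x - m)).
  rewrite mulr_sumr; apply: eq_bigr => x _; rewrite mulrCA -expRD.
  by congr (_ * expR _); ring.
rewrite expRD ler_wpM2l ?expR_ge0//.
apply: le_trans (expR_ge1Dx _).
have -> : 1 + 8 * (s * B) ^+ 2 =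
    \sum_x w x * (1 + s * (X x - m) + 8 * (s * B) ^+ 2).
  rewrite (eq_bigr (fun x => w x + s * (w x * X x) - w x * (s * m)
      + w x * (8 * (s * B) ^+ 2))); last by move=> x _; ring.
  rewrite !big_split/= sumrN -mulr_sumr -!mulr_suml w1 -/m.
  by ring.
apply: ler_sum => x _; rewrite ler_wpM2l//.
have hY := YB x.
apply: le_trans (expR_le_quadratic _) _.
  by rewrite (le_trans (ler_norm _))// (le_trans hY)//; lra.
rewrite lerD2l.
have : (s * (X x - m)) ^+ 2 <= (2 * (s * B)) ^+ 2.
  rewrite -real_normK ?num_real// ler_sqr ?nnegrE ?normr_ge0//.
  exact: le_trans (normr_ge0 _) hY.
by rewrite exprMn; lra.
Qed.

(* Random coding: average over codebooks with i.i.d. codewords of law q. *)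
Lemma random_covering (X Y : finType) (W : X -> Y -> R) (q : Y -> R)
    (E : X -> Y -> bool) (s : R) (M : nat) :
  (forall x y, 0 <= W x y) -> \sum_x \sum_y W x y = 1 ->
  (forall y, 0 <= q y) -> \sum_y q y = 1 ->
  (forall x y, E x y -> W x y <= expR s * (\sum_y' W x y') * q y) ->
  exists f : 'I_M -> Y,
    \sum_x (\sum_y W x y) * (~~ [exists j, E x (f j)])%:R
      <= \sum_x \sum_y W x y * (~~ E x y)%:R + expR (- (M%:R * expR (- s))).
Proof.
move=> W0 W1 q0 q1 WE.
pose rhs := \sum_x \sum_y W x y * (~~ E x y)%:R + expR (- (M%:R * expR (- s))).
pose px x := \sum_y W x y.
have px0 x : 0 <= px x by apply: sumr_ge0 => y _.
pose prob (f : {ffun 'I_M -> Y}) := \prod_j q (f j).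
have prob1 : \sum_f prob f = 1.
  by rewrite /prob -(bigA_distr_bigA (fun _ y => q y)) big1.
pose fail (f : {ffun 'I_M -> Y}) :=
  \sum_x px x * (~~ [exists j, E x (f j)])%:R.
suff avg : \sum_f prob f * fail f <= rhs.
  have [f hf] : exists f, fail f <= rhs.
    apply: contrapT => h.
    have h' f : rhs < fail f by rewrite ltNge; apply/negP => ?; apply: h; exists f.
    have prob0 f : 0 <= prob f by apply: prodr_ge0.
    have nn f : true -> 0 <= prob f * (fail f - rhs).
      by move=> _; rewrite mulr_ge0 // subr_ge0 ltW.
    have : \sum_f prob f * (fail f - rhs) == 0.
      rewrite eq_le (sumr_ge0 _ nn) andbT.
      under eq_bigr do rewrite mulrBr.
      by rewrite sumrB -mulr_suml prob1 mul1r subr_le0.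
    rewrite psumr_eq0// => /allP z.
    have : \sum_f prob f = 0.
      apply: big1 => f _; have := z f (mem_index_enum _).
      by rewrite mulf_eq0 subr_eq0 [fail f == _]gt_eqF ?orbF// => /eqP.
    by move/eqP; rewrite prob1 oner_eq0.
  by exists f.
(* Probability that one random codeword covers [x]; independence of the [M] codewords gives the
   power in [failE]. *)
pose pi x := \sum_y q y * (E x y)%:R.
have failE : \sum_f prob f * fail f = \sum_x px x * (1 - pi x) ^+ M.
  under eq_bigr do rewrite mulr_sumr.
  rewrite exchange_big/=; apply: eq_bigr => x _.
  under eq_bigr do rewrite mulrCA.
  rewrite -mulr_sumr; congr (_ * _).
  have -> : 1 - pi x = \sum_y q y * (~~ E x y)%:R.
    rewrite -(congr1 (fun z => z - pi x) q1) -sumrB; apply: eq_bigr => y _.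
    by case: (E x y); rewrite /= ?mulr1 ?mulr0 ?subrr ?subr0.
  rewrite -[in RHS](card_ord M) -prodr_const.
  rewrite (bigA_distr_bigA (fun _ y => q y * (~~ E x y)%:R)).
  apply: eq_bigr => f _; rewrite big_split/=; congr (_ * _).
  rewrite negb_exists; case: (boolP [forall _, _]) => [/forallP h|].
    by rewrite big1// => j _; rewrite h.
  by rewrite negb_forall => /existsP[j h]; rewrite (bigD1 j)//= (negbTE h) mul0r.
rewrite failE /rhs.
set e := expR (- _).
have -> : \sum_x \sum_y W x y * (~~ E x y)%:R + e =
    \sum_x (\sum_y W x y * (~~ E x y)%:R + px x * e).
  by rewrite big_split/= -mulr_suml W1 mul1r.
apply: ler_sum => x _.
have := px0 x; rewrite le_eqVlt => /orP[/eqP px_0|px_gt0].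
  rewrite -px_0 !mul0r addr0 sumr_ge0// => y _.
  by rewrite mulr_ge0.
(* Conditional probability, given [x], that the coupled codeword covers it. *)
pose g := (\sum_y W x y * (E x y)%:R) / px x.
have g0 : 0 <= g by rewrite divr_ge0// sumr_ge0// => y _; rewrite mulr_ge0.
have gE : \sum_y W x y * (~~ E x y)%:R = px x * (1 - g).
  rewrite mulrBr mulr1 /g mulrCA divff ?gt_eqF// mulr1 -sumrB.
  apply: eq_bigr => y _.
  by case: (E x y); rewrite /= ?mulr1 ?mulr0 ?subrr ?subr0.
have g1 : g <= 1.
  rewrite -subr_ge0 -(pmulr_rge0 _ px_gt0) -gE sumr_ge0// => y _.
  by rewrite mulr_ge0.
(* Change of measure: on [E] the joint weight exceeds the product weight by a factor of at most
   [expR s]. *)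
have pig : expR (- s) * g <= pi x.
  rewrite expRN mulrC ler_pdivrMr ?expR_gt0// /g ler_pdivrMr//.
  rewrite /pi !mulr_suml; apply: ler_sum => y _.
  have [/WE|_] := boolP (E x y); last by rewrite !(mulr0, mul0r).
  by rewrite !mulr1 /px; set z := \sum_y' _; lra.
rewrite gE -mulrDr ler_wpM2l//.
have pi1 : pi x <= 1.
  rewrite -[leRHS]q1; apply: ler_sum => y _.
  by case: (E x y); rewrite ?mulr1// mulr0.
have : (1 - pi x) ^+ M <= expR (- (M%:R * expR (- s)) * g).
  rewrite mulNr -mulrA -mulrN expRM_natl lerXn2r ?nnegrE ?expR_ge0 ?subr_ge0//.
  apply: le_trans (expR_ge1Dx _).
  by rewrite lerD2l lerN2.
move/le_trans; apply.
(* Convexity of the exponential between the exponents [- a = - M expR (- s)] and 0: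
   [expR (- a g) <= g expR (- a) + 1 - g], and [g <= 1]. *)
pose t : {i01 R} := Itv01 g0 g1.
have := convex_expR t (- (M%:R * expR (- s)) : R^o) (0 : R^o).
rewrite !convRE expR0 mulr0 addr0 mulr1 /= /unstable.onem => h.
by rewrite mulrC (le_trans h)// -/e addrC lerD2l ler_piMl ?expR_ge0.
Qed.

End finite_probability.

(** * Large deviations for labels with block memory *)

Section memory.
Context {R : realType} {K S : finType} (p : K -> R) (W : K -> S -> R).
Hypothesis p0 : forall k, 0 <= p k.
Hypothesis p1 : \sum_k p k = 1.
Hypothesis W0 : forall k x, 0 <= W k x.
Hypothesis W1 : forall k, \sum_x W k x = 1.

(** [blk] sends a time to its coherence interval. It is an arbitrary map, so an incomplete last
    interval needs no special treatment. *)
Definition block_prob (n m : nat) (blk : 'I_n -> 'I_m)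
    (c : {ffun 'I_m -> K}) (x : {ffun 'I_n -> S}) : R :=
  (\prod_j p (c j)) * \prod_t W (c (blk t)) (x t).

Lemma block_prob_ge0 n m (blk : 'I_n -> 'I_m) c x : 0 <= block_prob blk c x.
Proof. by rewrite mulr_ge0// prodr_ge0. Qed.

(** Letters of one interval share a label, so expectations of products factor over intervals rather
    than letters; within an interval the letters are conditionally i.i.d., whence the power. *)
Lemma block_expectation n m (blk : 'I_n -> 'I_m) (g : K -> R) (f : K -> S -> R) :
  \sum_c \sum_x block_prob blk c x *
     ((\prod_j g (c j)) * \prod_t f (c (blk t)) (x t)) =
  \prod_j \sum_k p k * g k *
     (\sum_x W k x * f k x) ^+ #|[pred t | blk t == j]|.
Proof.
rewrite (bigA_distr_bigA (fun j k => p k * g k *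
     (\sum_x W k x * f k x) ^+ #|[pred t | blk t == j]|)).
apply: eq_bigr => c _.
under [LHS]eq_bigr do rewrite /block_prob mulrACA -!big_split/=.
rewrite -mulr_sumr.
rewrite -(bigA_distr_bigA (fun t y => W (c (blk t)) y * f (c (blk t)) y)).
rewrite [RHS]big_split/=; congr (_ * _).
rewrite (partition_big blk xpredT)//=; apply: eq_bigr => j _.
rewrite -prodr_const; apply: eq_big => [t|t /eqP -> //].
by rewrite inE.
Qed.

Lemma block_prob1 n m (blk : 'I_n -> 'I_m) :
  \sum_c \sum_x block_prob blk c x = 1.
Proof.
transitivity (\sum_c \sum_x block_prob blk c x *
     ((\prod_(j < m) (fun=> 1) (c j)) * \prod_(t < n) (fun _ _ => 1) (c (blk t)) (x t))).
  by apply: eq_bigr => c _; apply: eq_bigr => x _; rewrite !big1_eq !mulr1.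
rewrite (block_expectation blk (fun=> 1) (fun _ _ => 1)); apply: big1 => j _.
rewrite -[RHS]p1; apply: eq_bigr => k _.
by under eq_bigr do rewrite mulr1; rewrite W1 expr1n !mulr1.
Qed.

Lemma finite_bound (T : finType) (f : T -> R) : exists2 B, 0 <= B &
  forall x, `|f x| <= B.
Proof.
exists (\sum_x `|f x|); first exact: sumr_ge0.
by move=> x; rewrite (bigD1 x)//= lerDl sumr_ge0.
Qed.

(** Exponential Markov inequality, with the expectation factored over intervals. The bound [tau] on
    the length of an interval keeps its total contribution bounded, so that [theta] depends neither
    on [n] nor on [blk]. *)
Lemma chernoff (g : K -> R) (f : K -> S -> R) (tau : nat) (e : R) : 0 < e ->
  exists2 theta : R, 0 < theta &
  forall n m (blk : 'I_n -> 'I_m), (m <= n)%N ->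
    (forall j, #|[pred t | blk t == j]| <= tau)%N ->
  \sum_c \sum_x block_prob blk c x *
    (m%:R * (\sum_k p k * g k) + n%:R * (\sum_k p k * (\sum_x W k x * f k x))
      + n%:R * e < (\sum_j g (c j)) + \sum_t f (c (blk t)) (x t))%R%:R
   <= expR (- (n%:R * theta)).
Proof.
move=> e0.
have [Bg Bg0 hBg] := finite_bound g.
have [B B0 hB] := finite_bound (fun kx : K * S => f kx.1 kx.2).
have hBf k x : `|f k x| <= B by have := hB (k, x).
pose L := Bg + tau%:R * B.
have L0 : 0 <= L by rewrite addr_ge0// mulr_ge0.
pose Q := 8 * B ^+ 2 + 8 * L ^+ 2.
have Q0 : 0 <= Q by rewrite addr_ge0// mulr_ge0// sqr_ge0.
(* The first entry keeps the second-order terms below half of the linear gain [s e]; the other two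
   are the conditions of [mgf_le] for single letters and for whole intervals. *)
pose s := Num.min (e / (2 * (Q + 1))) (Num.min (4 * (B + 1))^-1 (4 * (L + 1))^-1).
have s0 : 0 < s by rewrite !lt_min !(divr_gt0, invr_gt0)//; lra.
have sle x : 0 < x -> s <= x^-1 -> s * x <= 1.
  by move=> x0; rewrite -[X in _ <= X -> _]mul1r ler_pdivlMr.
have sQ : s * Q <= e / 2.
  have : s <= e / (2 * (Q + 1)) by rewrite ge_min lexx.
  by rewrite ler_pdivlMr; [clearbody s Q; lra|lra].
have sB : 4 * (s * B) <= 1.
  have := @sle (4 * (B + 1)) _ _; rewrite !ge_min lexx orbT.
  by move=> /(_ _ isT) h; have := h ltac:(lra); clearbody s; lra.
have sL : 4 * (s * L) <= 1.
  have := @sle (4 * (L + 1)) _ _; rewrite !ge_min lexx !orbT.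
  by move=> /(_ _ isT) h; have := h ltac:(lra); clearbody s L; lra.
exists (s * e / 2); first by rewrite divr_gt0// mulr_gt0.
move=> n m blk mn fib.
pose fb k := \sum_x W k x * f k x.
have fbB k : `|fb k| <= B.
  apply: (le_trans (ler_norm_sum _ _ _)).
  rewrite -[leRHS]mul1r -(W1 k) mulr_suml ler_sum// => x _.
  by rewrite normrM ger0_norm// ler_wpM2l.
set G := \sum_k p k * g k; set F := \sum_k p k * _.
set bnd := m%:R * G + n%:R * F + _.
pose Z c x := (\sum_j g (c j)) + \sum_t f (c (blk t)) (x t).
apply: (@le_trans _ _ (\sum_c \sum_x block_prob blk c x *
   expR (s * (Z c x - bnd)))).
  apply: ler_sum => c _; apply: ler_sum => x _.
  rewrite ler_wpM2l ?block_prob_ge0// -/(Z c x).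
  case: ltP => /= h; last exact: expR_ge0.
  apply: le_trans (expR_ge1Dx _).
  by rewrite lerDl mulr_ge0 ?ltW// subr_gt0.
have -> : \sum_c \sum_x block_prob blk c x * expR (s * (Z c x - bnd)) =
   expR (- (s * bnd)) * \prod_j \sum_k p k * expR (s * g k) *
     (\sum_x W k x * expR (s * f k x)) ^+ #|[pred t | blk t == j]|.
  rewrite -(block_expectation _ (fun k => expR (s * g k))
    (fun k x => expR (s * f k x))) mulr_sumr; apply: eq_bigr => c _.
  rewrite mulr_sumr; apply: eq_bigr => x _.
  rewrite mulrCA; congr (_ * _).
  by rewrite -!expR_sum -!expRD -!mulr_sumr; congr expR; rewrite /Z; ring.
(* [mgf_le] is applied twice: to the letters given the label, then to the label with the conditional
   mean [g c + k fb c] of the interval. *)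
have step j (k := #|[pred t | blk t == j]|) :
   \sum_c p c * expR (s * g c) * (\sum_x W c x * expR (s * f c x)) ^+ k
   <= expR (s * (G + k%:R * F) + 8 * (s * L) ^+ 2 + k%:R * (8 * (s * B) ^+ 2)).
  apply: (@le_trans _ _ (\sum_c p c * expR (s * (g c + k%:R * fb c)) *
      expR (k%:R * (8 * (s * B) ^+ 2)))).
    apply: ler_sum => c _; rewrite -!mulrA ler_wpM2l//.
    rewrite mulrDr expRD -mulrA ler_wpM2l ?expR_ge0//.
    rewrite -expRD (mulrCA s) -mulrDr expRM_natl lerXn2r ?nnegrE ?expR_ge0//.
      by rewrite sumr_ge0// => x _; rewrite mulr_ge0 ?expR_ge0.
    by apply: mgf_le => //; exact: ltW.
  rewrite -mulr_suml [leRHS]expRD ler_wpM2r ?expR_ge0//.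
  have -> : G + k%:R * F = \sum_c p c * (g c + k%:R * fb c).
    rewrite mulr_sumr -big_split/=; apply: eq_bigr => c _.
    by rewrite mulrDr; congr (_ + _); rewrite mulrCA.
  apply: mgf_le => //; last exact: ltW.
  move=> c; apply: (le_trans (ler_normD _ _)); rewrite lerD//.
  by rewrite normrM ger0_norm// ler_pM// ler_nat; exact: fib.
have {}step : \prod_j \sum_k p k * expR (s * g k) *
     (\sum_x W k x * expR (s * f k x)) ^+ #|[pred t | blk t == j]| <=
   expR (s * (m%:R * G + n%:R * F) + m%:R * (8 * (s * L) ^+ 2) +
     n%:R * (8 * (s * B) ^+ 2)).
  have -> : s * (m%:R * G + n%:R * F) + m%:R * (8 * (s * L) ^+ 2) +
     n%:R * (8 * (s * B) ^+ 2) = \sum_(j < m) (s * (G + #|[pred t | blk t == j]|%:R * F)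
     + 8 * (s * L) ^+ 2 + #|[pred t | blk t == j]|%:R * (8 * (s * B) ^+ 2)).
    have -> : n%:R = \sum_(j < m) #|[pred t | blk t == j]|%:R :> R.
      rewrite -natr_sum; congr (_%:R).
      rewrite -[LHS]card_ord -sum1_card (partition_big blk xpredT)//=.
      apply: eq_bigr => j _; rewrite sum1dep_card.
      by apply: eq_card => t; rewrite !inE.
    rewrite !big_split/= -mulr_sumr big_split/= -!mulr_suml.
    by rewrite !sumr_const !card_ord -[G *+ m]mulr_natl -[8 *+ m]mulr_natl; ring.
  rewrite expR_sum; apply: ler_prod => j _; rewrite step andbT.
  rewrite sumr_ge0// => k _; rewrite !mulr_ge0 ?expR_ge0// exprn_ge0//.
  by rewrite sumr_ge0// => x _; rewrite mulr_ge0 ?expR_ge0.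
apply: (le_trans (ler_wpM2l (expR_ge0 _) step)).
rewrite -expRD ler_expR.
(* [m <= n] turns the terms per interval into terms per letter. *)
have : m%:R * (8 * (s * L) ^+ 2) <= n%:R * (8 * (s * L) ^+ 2).
  by rewrite ler_wpM2r ?ler_nat// mulr_ge0// sqr_ge0.
have : n%:R * (s * (s * Q)) <= n%:R * (s * (e / 2)).
  by rewrite !ler_wpM2l// ltW.
rewrite /bnd /Q !exprMn; lra.
Qed.

End memory.

(** * Covering for a finite source with labels *)

Section finite_coding.
Context {R : realType} {K A B : finType} (p : K -> R) (W : K -> A * B -> R).
Hypothesis p_gt0 : forall k, 0 < p k.
Hypothesis p1 : \sum_k p k = 1.
Hypothesis W0 : forall k x, 0 <= W k x.
Hypothesis W1 : forall k, \sum_x W k x = 1.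

Definition marginal1 k a : R := \sum_b W k (a, b).
Definition marginal2 k b : R := \sum_a W k (a, b).
(** Information density in nats. Where [W k x] vanishes it takes the default value [ln 0 = 0], which
    has weight 0 in every average. *)
Definition information k (x : A * B) : R :=
  ln (W k x / (marginal1 k x.1 * marginal2 k x.2)).

Lemma marginal1_ge0 k a : 0 <= marginal1 k a. Proof. exact: sumr_ge0. Qed.
Lemma marginal2_ge0 k b : 0 <= marginal2 k b. Proof. exact: sumr_ge0. Qed.

Lemma sum_marginal2 k : \sum_b marginal2 k b = 1.
Proof.
rewrite -(W1 k) exchange_big/= pair_big/=.
by apply: eq_bigr => -[].
Qed.

Lemma sum_pair (X Y : finType) (F : X * Y -> R) :
  \sum_z F z = \sum_x \sum_y F (x, y).
Proof. by rewrite pair_bigA; apply: eq_bigr => -[]. Qed.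

Lemma sum_ffun_pair (T : finType) (F : {ffun T -> A * B} -> R) :
  \sum_(a : {ffun T -> A}) \sum_(b : {ffun T -> B}) F [ffun t => (a t, b t)] =
  \sum_x F x.
Proof.
rewrite pair_big/=.
rewrite [RHS](reindex (fun ab : {ffun T -> A} * {ffun T -> B} =>
  [ffun t => (ab.1 t, ab.2 t)])) //=.
exists (fun x => ([ffun t => (x t).1], [ffun t => (x t).2])) => [[a b]|x] _ /=.
  by congr pair; apply/ffunP => t; rewrite !ffunE.
by apply/ffunP => t; rewrite !ffunE/=; case: (x t).
Qed.

Lemma sum_block_prob n m (blk : 'I_n -> 'I_m) c (a : {ffun 'I_n -> A}) :
  \sum_(b : {ffun 'I_n -> B}) block_prob p W blk c [ffun t => (a t, b t)] =
  block_prob p marginal1 blk c a.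
Proof.
rewrite -mulr_sumr; congr (_ * _).
rewrite (bigA_distr_bigA (fun t b => W (c (blk t)) (a t, b))).
by apply: eq_bigr => b _; apply: eq_bigr => t _; rewrite ffunE.
Qed.

(** The product law on the right draws the label sequence twice, for the source and for the
    codeword; the factor with [- ln p] cancels the second draw. This is how the label entropy enters
    the rate. On blocks where every [W] is positive there is equality. *)
Lemma block_prob_information n m (blk : 'I_n -> 'I_m) c
    (a : {ffun 'I_n -> A}) (b : {ffun 'I_n -> B}) :
  block_prob p W blk c [ffun t => (a t, b t)] <=
  expR ((\sum_j - ln (p (c j))) +
        \sum_t information (c (blk t)) (a t, b t)) *
    block_prob p marginal1 blk c a * block_prob p marginal2 blk c b.
Proof.
have p0 k : 0 <= p k by exact: ltW.
have [/existsP[t /eqP Wt0]|] := boolP [exists t, W (c (blk t)) (a t, b t) == 0].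
  rewrite {1}/block_prob [X in _ * X <= _](bigD1 t)//= ffunE Wt0 mul0r mulr0.
  rewrite !mulr_ge0 ?expR_ge0 ?prodr_ge0// => *;
    [exact: marginal1_ge0|exact: marginal2_ge0].
rewrite negb_exists => /forallP Wn0.
have Wgt0 t : 0 < W (c (blk t)) (a t, b t) by rewrite lt_def Wn0 W0.
have m1 t : 0 < marginal1 (c (blk t)) (a t).
  by rewrite /marginal1 (bigD1 (b t))//= ltr_pwDl// sumr_ge0.
have m2 t : 0 < marginal2 (c (blk t)) (b t).
  by rewrite /marginal2 (bigD1 (a t))//= ltr_pwDl// sumr_ge0.
rewrite expRD !expR_sum /block_prob.
under [X in _ <= X * _ * _ * _]eq_bigr do rewrite expRN lnK ?posrE//.
under [X in _ <= _ * X * _ * _]eq_bigr do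
  rewrite lnK ?posrE ?divr_gt0 ?mulr_gt0//=.
under [X in _ * X <= _]eq_bigr do rewrite ffunE.
set P := \prod_j p _; set P' := \prod_j _^-1.
have PP' : P' * P = 1.
  by rewrite -big_split/= big1// => j _; rewrite mulVf// gt_eqF.
set V := \prod_t (_ / _); set M1 := \prod_t marginal1 _ _.
set M2 := \prod_t marginal2 _ _.
have -> : \prod_t W (c (blk t)) (a t, b t) = V * M1 * M2.
  rewrite -!big_split/=; apply: eq_bigr => t _.
  by rewrite -mulrA divfK// gt_eqF// mulr_gt0.
have -> : P' * V * (P * M1) * (P * M2) = (P' * P) * (P * (V * M1 * M2)) by ring.
by rewrite PP' mul1r.
Qed.

Let H : R := \sum_k p k * - ln (p k).
Let I : R := \sum_k p k * \sum_x W k x * information k x.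

Lemma finite_coding (dist : A -> B -> R) (tau : nat) (e : R) :
  (0 < tau)%N -> 0 < e ->
  exists N0 : nat, forall n m (blk : 'I_n -> 'I_m) M,
    (N0 <= n)%N -> (m <= n)%N -> (m * tau <= n + tau)%N ->
    (forall j, #|[pred t | blk t == j]| <= tau)%N ->
    expR (n%:R * (I + H / tau%:R + e)) <= M%:R ->
  exists f : 'I_M -> {ffun 'I_m -> K} * {ffun 'I_n -> B},
    \sum_c \sum_a block_prob p marginal1 blk c a *
      (~~ [exists j, ((f j).1 == c) &&
         (\sum_t dist (a t) ((f j).2 t) <=
          n%:R * (\sum_k p k * (\sum_x W k x * dist x.1 x.2) + e))])%:R <= e.
Proof.
move=> tau0 e0; have p0 k : 0 <= p k by exact: ltW.
have e20 : 0 < e / 2 by lra.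
have [th1 th10 ch1] := chernoff p0 p1 W0 W1 (fun=> 0)
  (fun _ x => dist x.1 x.2) tau e0.
have [th2 th20 ch2] := chernoff p0 p1 W0 W1 (fun k => - ln (p k))
  information tau e20.
have H0 : 0 <= H.
  apply: sumr_ge0 => k _; rewrite mulr_ge0// oppr_ge0 ln_le0//.
  by rewrite -p1 (bigD1 k)//= lerDl sumr_ge0.
(* Three error terms of at most [e / 3] each; since [expR (- x) <= 1 / x], an exponent of [3 / e]
   suffices for each. *)
pose N1 (x : R) := Num.truncn (3 / e / x).
have N1P x n : 0 < x -> (N1 x < n)%N -> 3 / e <= n%:R * x.
  move=> x0 nn; rewrite -ler_pdivrMr//.
  rewrite (le_trans (ltW (truncnS_gt _)))// ler_nat.
  exact: leq_trans nn.
exists ((N1 th1).+1 + (N1 th2).+1 + (Num.truncn ((3 / e + H) / (e / 2))).+1)%N.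
move=> n m blk M nN mn mtau fib eM.
have n1 : 3 / e <= n%:R * th1 by apply: N1P => //; lia.
have n2 : 3 / e <= n%:R * th2 by apply: N1P => //; lia.
have n3 : 3 / e <= n%:R * (e / 2) - H.
  rewrite lerBrDr -ler_pdivrMr// (le_trans (ltW (truncnS_gt _)))// ler_nat.
  exact: leq_trans (leq_addl _ _) nN.
have small x : 3 / e <= x -> expR (- x) <= e / 3.
  move=> ex; have x0 : 0 < x by apply: lt_le_trans ex; rewrite divr_gt0.
  apply: (@le_trans _ _ x^-1); last first.
    by rewrite -[leRHS]invrK lef_pV2 ?posrE ?invr_gt0 ?divr_gt0// invf_div.
  rewrite expRN lef_pV2 ?posrE ?expR_gt0//.
  by apply: le_trans (expR_ge1Dx _); lra.
set Dl := \sum_k p k * (\sum_x W k x * dist x.1 x.2).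
(* Threshold for the information density of a block: its mean plus half of the slack [n e]. The
   other half is left for the size of the codebook. *)
pose s := m%:R * H + n%:R * I + n%:R * (e / 2).
pose X := ({ffun 'I_m -> K} * {ffun 'I_n -> A})%type.
pose Y := ({ffun 'I_m -> K} * {ffun 'I_n -> B})%type.
pose Wb (c : {ffun 'I_m -> K}) (a : {ffun 'I_n -> A}) (b : {ffun 'I_n -> B}) :=
  block_prob p W blk c [ffun t => (a t, b t)].
(* Under this coupling the codeword repeats the true labels, whereas a random codeword of law [q]
   draws labels of its own. *)
pose Wx (x : X) (y : Y) : R := Wb x.1 x.2 y.2 * (y.1 == x.1)%:R.
have sumWx (x : X) (F : Y -> R) :
    \sum_y Wx x y * F y = \sum_b Wb x.1 x.2 b * F (x.1, b).
  rewrite sum_pair.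
  rewrite (bigD1 x.1)//= addrC big1 ?add0r => [|c cx].
    by apply: eq_bigr => b _; rewrite /Wx/= eqxx mulr1.
  by apply: big1 => b _; rewrite /Wx/= (negbTE cx) mulr0 mul0r.
have pxE (x : X) : \sum_y Wx x y = block_prob p marginal1 blk x.1 x.2.
  rewrite -sum_block_prob.
  transitivity (\sum_y Wx x y * 1); first by apply: eq_bigr => y _; rewrite mulr1.
  by rewrite (sumWx x (fun=> 1)); apply: eq_bigr => b _; rewrite mulr1.
have sumXY (F : {ffun 'I_m -> K} -> {ffun 'I_n -> A} -> {ffun 'I_n -> B} -> R) :
    \sum_(x : X) \sum_y Wx x y * F x.1 x.2 y.2 = \sum_c \sum_(x : {ffun 'I_n -> A * B})
      block_prob p W blk c x * F c [ffun t => (x t).1] [ffun t => (x t).2].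
  rewrite sum_pair.
  apply: eq_bigr => c _; rewrite -sum_ffun_pair; apply: eq_bigr => a _.
  rewrite (sumWx (c, a) (fun y => F c a y.2))/=; apply: eq_bigr => b _.
  by rewrite /Wb; congr (_ * F _ _ _); apply/ffunP => t; rewrite !ffunE.
pose E (x : X) (y : Y) := [&& y.1 == x.1,
  \sum_t dist (x.2 t) (y.2 t) <= n%:R * (Dl + e) &
  (\sum_j - ln (p (x.1 j))) + \sum_t information (x.1 (blk t)) (x.2 t, y.2 t)
    <= s].
have Wx0 x y : 0 <= Wx x y by rewrite mulr_ge0// block_prob_ge0.
have [f hf] : exists f : 'I_M -> Y,
    \sum_x (\sum_y Wx x y) * (~~ [exists j, E x (f j)])%:R <=
    \sum_x \sum_y Wx x y * (~~ E x y)%:R + expR (- (M%:R * expR (- s))).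
  apply: (random_covering (q := fun y => block_prob p marginal2 blk y.1 y.2)) => //.
  - transitivity (\sum_x \sum_y Wx x y * 1).
      by apply: eq_bigr => x _; apply: eq_bigr => y _; rewrite mulr1.
    rewrite (sumXY (fun _ _ _ => 1)).
    rewrite -[RHS](block_prob1 p1 W1 blk).
    by apply: eq_bigr => c _; apply: eq_bigr => x _; rewrite mulr1.
  - by move=> y; apply: block_prob_ge0 => //; exact: marginal2_ge0.
  - rewrite -[RHS](block_prob1 p1 sum_marginal2 blk).
    by rewrite sum_pair.
  - move=> x y /and3P[/eqP yx _ si]; rewrite pxE /Wx yx eqxx mulr1.
    apply: (le_trans (block_prob_information _ _ _ _)).
    rewrite -!(mulrA (expR _)) ler_wpM2r//; last by rewrite ler_expR.
    by apply: mulr_ge0; apply: block_prob_ge0 => //;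
      [exact: marginal1_ge0|exact: marginal2_ge0].
exists f.
apply: (@le_trans _ _ (\sum_x (\sum_y Wx x y) * (~~ [exists j, E x (f j)])%:R)).
  rewrite sum_pair.
  apply: ler_sum => c _; apply: ler_sum => a _; rewrite pxE/=.
  rewrite ler_wpM2l ?block_prob_ge0//; first exact: marginal1_ge0.
  rewrite ler_nat; case: (boolP [exists j, E _ _]) => [/existsP[j]|_]; last first.
    by case: (~~ _).
  move=> /and3P[/= h1 h2 _]; rewrite (_ : [exists j, _])//.
  by apply/existsP; exists j; rewrite h1.
apply: (le_trans hf).
suff union : \sum_x \sum_y Wx x y * (~~ E x y)%:R <=
    expR (- (n%:R * th1)) + expR (- (n%:R * th2)).
  have -> : e = e / 3 + e / 3 + e / 3 by field.
  apply: lerD; first by rewrite (le_trans union)// lerD// small.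
  apply: le_trans (small _ n3); rewrite ler_expR lerN2.
  (* [M expR (- s)] is at least [expR (n e / 2 - H)]: rounding up the number of intervals costs at
     most one extra [H]. *)
  apply: (@le_trans _ _ (expR (n%:R * (e / 2) - H))).
    by apply: le_trans (expR_ge1Dx _); lra.
  apply: (@le_trans _ _ (expR (n%:R * (I + H / tau%:R + e)) * expR (- s))).
    rewrite -expRD ler_expR /s.
    have : m%:R * H <= (n%:R / tau%:R + 1) * H.
      rewrite ler_wpM2r// -(@ler_pM2r _ tau%:R) ?ltr0n//.
      rewrite mulrDl mul1r divfK ?gt_eqF ?ltr0n//.
      by rewrite -natrM -natrD ler_nat.
    have -> : n%:R * (I + H / tau%:R + e) =
      n%:R * I + n%:R / tau%:R * H + n%:R * e by ring.
    lra.
  by rewrite ler_wpM2r ?expR_ge0.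
pose F1 (c : {ffun 'I_m -> K}) (a : {ffun 'I_n -> A}) (b : {ffun 'I_n -> B}) : R :=
  (n%:R * (Dl + e) < \sum_t dist (a t) (b t))%R%:R.
pose F2 (c : {ffun 'I_m -> K}) (a : {ffun 'I_n -> A}) (b : {ffun 'I_n -> B}) : R :=
  (s < (\sum_j - ln (p (c j))) + \sum_t information (c (blk t)) (a t, b t))%R%:R.
(* [Wx] vanishes unless the labels agree, so the true labels may replace those of the codeword, and
   two failure events remain. *)
have -> : \sum_x \sum_y Wx x y * (~~ E x y)%:R =
    \sum_x \sum_y Wx x y * (~~ E x (x.1, y.2))%:R.
  apply: eq_bigr => x _; apply: eq_bigr => -[c b] _; rewrite /Wx/=.
  by case: eqP => [->//|_]; rewrite mulr0 !mul0r.
apply: (@le_trans _ _ (\sum_x \sum_y Wx x y * (F1 x.1 x.2 y.2 + F2 x.1 x.2 y.2))).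
  apply: ler_sum => x _; apply: ler_sum => y _; rewrite ler_wpM2l//.
  rewrite /F1 /F2 /E/= eqxx/= negb_and -!ltNge -natrD ler_nat.
  by case: ltP; case: ltP.
rewrite (sumXY (fun c a b => F1 c a b + F2 c a b)).
under eq_bigr do under eq_bigr do rewrite mulrDr.
under eq_bigr do rewrite big_split/=.
rewrite big_split/=; apply: lerD.
  apply: le_trans (ch1 _ _ _ mn fib); apply: ler_sum => c _; apply: ler_sum => x _.
  rewrite ler_wpM2l ?block_prob_ge0// /F1 big1_eq add0r ler_nat.
  rewrite [X in m%:R * X]big1 => [|k _]; last by rewrite mulr0.
  rewrite mulr0 add0r -mulrDr -/Dl.
  by under eq_bigr do rewrite !ffunE.
apply: le_trans (ch2 _ _ _ mn fib); apply: ler_sum => c _; apply: ler_sum => x _.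
rewrite ler_wpM2l ?block_prob_ge0// /F2 ler_nat -/H -/I -/s.
rewrite (_ : \sum_t information _ ([ffun _ => _] t, _) =
  \sum_t information (c (blk t)) (x t))//.
by apply: eq_bigr => t _; rewrite !ffunE -surjective_pairing.
Qed.

End finite_coding.

(** * Mutual information of quantizations *)

Section integral_monotone.
Context d (T : measurableType d) (R : realType) (mu : {measure set T -> \bar R}).
Local Open Scope ereal_scope.

(** The integral of a nonnegative function is a supremum over simple functions below it, so no
    measurability is involved. Expected distortions can thus be bounded without measurability of the
    integrand. *)
Lemma ge0_le_integralT (f g : T -> \bar R) :
  (forall x, 0 <= f x) -> (forall x, f x <= g x) ->
  \int[mu]_x f x <= \int[mu]_x g x.
Proof.
move=> f0 fg; have g0 x : 0 <= g x by exact: le_trans (fg x).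
rewrite !ge0_integralTE//; apply: ereal_sup_le => _ [h hf <-].
by exists h => // x; exact: le_trans (hf x) (fg x).
Qed.

Lemma le_integralT (f g : T -> \bar R) :
  (forall x, f x <= g x) -> \int[mu]_x f x <= \int[mu]_x g x.
Proof.
move=> fg; rewrite integralE [leRHS]integralE; apply: leeB;
  apply: ge0_le_integralT => // x.
  by rewrite !funeposE ge_max !le_max fg lexx orbT.
by rewrite !funenegE ge_max !le_max leeN2 fg lexx orbT.
Qed.

End integral_monotone.

Section finite_maps.
Context d (T : measurableType d).

(** Measurability of a map into a finite type, stated without a sigma-algebra on the target. *)
Definition measurable_fibers (I : Type) (k : T -> I) :=
  forall i, measurable (k @^-1` [set i]).

Lemma measurable_fibers_preimage (I : finType) (k : T -> I) (D : set I) :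
  measurable_fibers k -> measurable (k @^-1` D).
Proof.
move=> mk; rewrite (_ : _ @^-1` _ = \bigcup_(i in D) k @^-1` [set i]).
  by apply: fin_bigcup_measurable => //; exact: finite_finset.
by apply/seteqP; split => x; [move=> ?; exists (k x)|move=> [i Di /= ->]].
Qed.

Lemma measurable_fibers_comp (I : finType) (J : Type) (k : T -> I) (F : I -> J) :
  measurable_fibers k -> measurable_fibers (F \o k).
Proof. by move=> mk j; exact: (measurable_fibers_preimage [set i | F i = j] mk). Qed.

Lemma measurable_fibers_ffun (I J : finType) (k : I -> T -> J) :
  (forall i, measurable_fibers (k i)) ->
  measurable_fibers (fun x => [ffun i => k i x]).
Proof.
move=> mk f.
rewrite (_ : _ @^-1` _ = \bigcap_(i in [set: I]) (k i @^-1` [set f i])).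
  by apply: fin_bigcap_measurable => [|i _]; [exact: finite_finset|exact: mk].
apply/seteqP; split => x /=; first by move=> <- i _ /=; rewrite ffunE.
by move=> h; apply/ffunP => i; rewrite ffunE; exact: h.
Qed.

Lemma measurable_fibers_cst (I : Type) (i : I) : measurable_fibers (fun _ : T => i).
Proof. by move=> j; rewrite preimage_cst; case: ifP. Qed.

End finite_maps.

Section partition.
Context d (T : measurableType d) (R : realType) (I : finType) (k : T -> I).
Hypothesis mk : measurable_fibers k.

Lemma measure_partition (mu : {measure set T -> \bar R}) (A : set T) :
  measurable A -> mu A = (\sum_i mu (A `&` k @^-1` [set i]))%E.
Proof.
move=> mA.
suff H (s : seq I) : uniq s ->
    measurable (A `&` [set x | k x \in s]) /\
    mu (A `&` [set x | k x \in s]) =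
    (\sum_(i <- s) mu (A `&` k @^-1` [set i]))%E.
  have [_ <-] := H _ (index_enum_uniq I).
  congr (mu _); apply/seteqP; split => [x Ax|x []//].
  by split => //=; rewrite mem_index_enum.
elim: s => [_|i s IH /= /andP[si us]].
  rewrite big_nil (_ : _ `&` _ = set0) ?measure0//.
  by apply/seteqP; split => [x []|].
have [ms es] := IH us.
have -> : A `&` [set x | k x \in i :: s] =
    (A `&` k @^-1` [set i]) `|` (A `&` [set x | k x \in s]).
  rewrite -setIUr; congr (_ `&` _); apply/seteqP; split => x /=; rewrite inE.
    by move=> /orP[/eqP|]; [left|right].
  by case=> ->; rewrite ?eqxx ?orbT.
have mi : measurable (A `&` k @^-1` [set i]) by exact: measurableI.
split; first exact: measurableU.
rewrite big_cons -es measureU//.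
apply/seteqP; split => // x [[_ /= kx] [_ /=]].
by rewrite kx (negbTE si).
Qed.

Lemma fine_partition (mu : {finite_measure set T -> \bar R}) (A : set T) :
  measurable A -> fine (mu A) = \sum_i fine (mu (A `&` k @^-1` [set i])).
Proof.
move=> mA; rewrite (measure_partition mu mA) -sum_fine// => i _.
by rewrite fin_num_measure//; exact: measurableI.
Qed.

End partition.

(** * Donsker-Varadhan bounds and data processing *)

Section relative_entropy_bound.
Context d (T : measurableType d) (R : realType) (nu mu : probability T R).

Let f x := fine (Radon_Nikodym (charge_of_finite_measure nu) mu x).

Let mf : nu `<< mu -> measurable_fun setT f.
Proof.
move=> numu; have h : measurable_fun setT (Radon_Nikodym (charge_of_finite_measure nu) mu).
  by apply: (@measurable_int _ _ _ mu); exact: Radon_Nikodym_integrable.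
exact: measurableT_comp (fine_measurable measurableT) h.
Qed.

Let F := [set x | (0 < f x)%R].

Let mF : nu `<< mu -> measurable F.
Proof.
move=> numu; rewrite -[X in measurable X]setTI.
rewrite (_ : F = f @^-1` `]0, +oo[%classic); last first.
  by apply/seteqP; split => x /=; rewrite in_itv/= andbT.
by apply: mf.
Qed.

Let nuF0 : nu `<< mu -> nu (~` F) = 0%E.
Proof.
move=> numu; have mCF : measurable (~` F) by exact/measurableC/mF.
apply/eqP; rewrite eq_le measure_ge0 andbT.
have -> : nu (~` F) = charge_of_finite_measure nu (~` F) by [].
rewrite (@Radon_Nikodym_integral _ _ _ (charge_of_finite_measure nu) mu _ numu mCF).
have intRN := @Radon_Nikodym_integrable _ _ _ (charge_of_finite_measure nu) mu numu.
rewrite -[leRHS](integral0 mu (~` F)); apply: le_integral => //.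
- exact: integrableS intRN.
- exact: integrable0.
move=> x; rewrite inE => Fx.
rewrite -[leLHS]fineK; last exact: Radon_Nikodym_fin_num.
by rewrite lee_fin leNgt; apply/negP.
Qed.

(* The integrand is the indicator of A divided by the density, with [expR (- ln _)] in place of
   the inverse. *)
Let integral_density_inv (A : set T) : nu `<< mu -> measurable A ->
  (\int[nu]_x (\1_(A `&` F) x * expR (- ln (f x)))%:E = mu (A `&` F))%E.
Proof.
move=> numu mA; have mB : measurable (A `&` F) by apply: measurableI => //; exact: mF.
have mg : measurable_fun setT (fun x => (\1_(A `&` F) x * expR (- ln (f x)))%:E).
  apply/measurable_EFinP; apply: measurable_funM => //.
  apply: measurableT_comp => //; apply: measurableT_comp => //.
  by apply: measurableT_comp => //; exact: mf.
have g0 x : (0 <= (\1_(A `&` F) x * expR (- ln (f x)))%:E)%E.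
  by rewrite lee_fin mulr_ge0 ?expR_ge0.
rewrite -(Radon_Nikodym_SigmaFinite.change_of_variables numu g0 measurableT mg).
rewrite -[in RHS](setIT (A `&` F)) -integral_indic//.
apply: ae_eq_integral => //.
- apply: emeasurable_funM => //.
  exact: measurable_int (Radon_Nikodym_SigmaFinite.f_integrable numu).
- exact/measurable_EFinP.
have := ae_eq_Radon_Nikodym_SigmaFinite numu measurableT.
apply: filterS => x /= /(_ I) -> _.
rewrite -[X in (_ * X)%E]fineK; last exact: Radon_Nikodym_fin_num.
rewrite -EFinM -/(f x) indicE; case: (boolP (x \in _)) => [|_]; last first.
  by rewrite !mul0r.
by rewrite inE => -[_ /= fx]; rewrite mul1r expRN lnK ?posrE// mulVf ?gt_eqF.
Qed.

(* The Donsker-Varadhan bound for simple functions, written with [w = expR phi]. *)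
Lemma relative_entropy_ge (I : finType) (k : T -> I) (w : I -> R) :
  measurable_fibers k -> (forall i, 0 < w i) ->
  (((ln 2)^-1 * (\sum_i fine (nu (k @^-1` [set i])) * ln (w i) + 1 -
     \sum_i fine (mu (k @^-1` [set i])) * w i))%:E <= relative_entropy nu mu)%E.
Proof.
move=> mk w0; rewrite /relative_entropy; case: asboolP => [numu|_]; last exact: leey.
have ln2 : 0 < ln 2 :> R by rewrite ln_gt0// ltr1n.
pose A i := k @^-1` [set i] `&` F.
have mA i : measurable (A i) by apply: measurableI => //; exact: mF.
have nuA i : fine (nu (k @^-1` [set i])) = fine (nu (A i)).
  rewrite -[X in nu X]setIT -(setUv F) setIUr measureU; last 3 first.
  - exact: mA.
  - exact/measurableI/measurableC/mF.
  - by apply/seteqP; split => // x [[_ ?] [_]].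
  rewrite [X in (_ + X)%E](_ : _ = 0%E) ?adde0//.
  apply/eqP; rewrite eq_le measure_ge0 andbT -(nuF0 numu).
  by apply: le_measure; rewrite ?inE; [exact/measurableI/measurableC/mF|
    exact/measurableC/mF|exact: subIsetr].
pose g i x := \1_(A i) x * expR (- ln (f x)).
have g0 i x : 0 <= g i x by rewrite mulr_ge0 ?expR_ge0.
have mg i : measurable_fun setT (g i).
  apply: measurable_funM => //.
  apply: measurableT_comp => //; apply: measurableT_comp => //.
  by apply: measurableT_comp => //; exact: mf.
have ig i : nu.-integrable setT (EFin \o g i).
  apply/integrableP; split; first exact/measurable_EFinP.
  under eq_integral do rewrite /= ger0_norm//.
  rewrite (integral_density_inv numu (mk i)).
  by rewrite (le_lt_trans (probability_le1 mu (mA i)))// ltry.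
have iA i : nu.-integrable setT (EFin \o \1_(A i)) by exact: integrable_indic.
(* Pointwise lower bound for the logarithm of the density on cell [i]: [ln f >= ln w + 1 - w / f],
   that is [ln y <= y - 1] at [y = w / f]. Under [nu] the last term integrates to [w] times a
   [mu]-measure. *)
pose phi i x := (ln 2)^-1 * ((ln (w i) + 1) * \1_(A i) x - w i * g i x).
have iA' i : nu.-integrable setT (EFin \o (fun x => (ln (w i) + 1) * \1_(A i) x)).
  exact: (integrableZl measurableT _ (iA i)).
have ig' i : nu.-integrable setT (EFin \o (fun x => w i * g i x)).
  exact: (integrableZl measurableT _ (ig i)).
have iB i : nu.-integrable setT
    (EFin \o (fun x => (ln (w i) + 1) * \1_(A i) x - w i * g i x)).
  exact: (integrableB measurableT (iA' i) (ig' i)).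
have iphi i : nu.-integrable setT (EFin \o phi i).
  exact: (integrableZl measurableT _ (iB i)).
have phiE i : (\int[nu]_x (phi i x)%:E = ((ln 2)^-1 * ((ln (w i) + 1) *
     fine (nu (A i)) - w i * fine (mu (A i))))%:E)%E.
  under eq_integral do rewrite EFinM.
  rewrite (integralZl measurableT (iB i)) EFinM; congr (_ * _)%E.
  under eq_integral do rewrite /= EFinB.
  rewrite (integralB_EFin measurableT (iA' i) (ig' i)).
  under eq_integral do rewrite EFinM.
  rewrite (integralZl measurableT (iA i)) integral_indic// setIT.
  under [X in (_ - X)%E]eq_integral do rewrite EFinM.
  rewrite (integralZl measurableT (ig i)) (integral_density_inv numu (mk i)).
  by rewrite EFinB !EFinM !fineK// fin_num_measure.
apply: (@le_trans _ _ (\int[nu]_x (\sum_i (phi i x)%:E))%E).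
  rewrite integral_sum//.
  under [leRHS]eq_bigr do rewrite phiE.
  rewrite sumEFin lee_fin -mulr_sumr ler_wpM2l ?invr_ge0 ?(ltW ln2)//.
  rewrite sumrB lerB//; last first.
    apply: ler_sum => i _; rewrite mulrC ler_wpM2r ?(ltW (w0 i))// fine_le ?fin_num_measure//.
    by apply: le_measure; rewrite ?inE//; exact: subIsetl.
  under [leRHS]eq_bigr do rewrite mulrDl mul1r mulrC -nuA.
  rewrite big_split/= lerD2l -[leLHS](congr1 fine (probability_setT nu)).
  rewrite (fine_partition mk nu measurableT).
  by under [leLHS]eq_bigr do rewrite setTI.
apply: le_integralT => x.
rewrite sumEFin lee_fin -/(f x) -mulr_sumr mulrC ler_wpM2r ?invr_ge0 ?(ltW ln2)//.
(* Outside [F] the logarithm defaults to 0 and every [phi i] vanishes, so the bound persists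
   there. *)
have [fx|fx] := ltP 0 (f x); last first.
  rewrite ln0// big1// => i _; rewrite /g indicE memNset ?mul0r ?mulr0 ?subrr//.
  by move=> [_]; rewrite /F/= ltNge fx.
rewrite (bigD1 (k x))//= big1 => [|i ki]; last first.
  rewrite /g indicE memNset ?mul0r ?mulr0 ?subrr//.
  by case=> /= kx _; move: ki; rewrite kx eqxx.
rewrite addr0 /g indicE mem_set ?mul1r ?mulr1//.
rewrite expRN lnK ?posrE//.
have := @le_ln1Dx R (w (k x) / f x - 1).
rewrite addrCA subrr addr0 ln_div ?posrE// => h.
by have := h _; rewrite ltrBrDl subrr divr_gt0// => /(_ isT); lra.
Qed.

End relative_entropy_bound.

Section mutual_information_bound.
Context d d' (T1 : measurableType d) (T2 : measurableType d') (R : realType).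
Variable Q : probability (T1 * T2)%type R.
Context {A B : finType} (k1 : T1 -> A) (k2 : T2 -> B).
Hypothesis mk1 : measurable_fibers k1.
Hypothesis mk2 : measurable_fibers k2.

Definition cell_prob (x : A * B) : R :=
  fine (Q ((k1 @^-1` [set x.1]) `*` (k2 @^-1` [set x.2]))).

Definition cell_marginal1 a : R := \sum_b cell_prob (a, b).
Definition cell_marginal2 b : R := \sum_a cell_prob (a, b).

Lemma cell_prob_ge0 x : 0 <= cell_prob x.
Proof. exact: fine_ge0. Qed.

Lemma cell_marginal1E a :
  cell_marginal1 a = fine (Q ((k1 @^-1` [set a]) `*` setT)).
Proof.
have mk : measurable_fibers (k2 \o snd : T1 * T2 -> B).
  move=> b; rewrite (_ : _ @^-1` _ = setT `*` (k2 @^-1` [set b])).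
    exact: measurableX.
  by apply/seteqP; split => -[x y] //= [].
rewrite (fine_partition mk Q (measurableX (mk1 a) measurableT)).
apply: eq_bigr => b _; congr (fine (Q _)).
by apply/seteqP; split => -[x y] /=; [move=> [? ?]|move=> [[? ?] ?]].
Qed.

Lemma cell_marginal2E b :
  cell_marginal2 b = fine (Q (setT `*` (k2 @^-1` [set b]))).
Proof.
have mk : measurable_fibers (k1 \o fst : T1 * T2 -> A).
  move=> a; rewrite (_ : _ @^-1` _ = (k1 @^-1` [set a]) `*` setT).
    exact: measurableX.
  by apply/seteqP; split => -[x y] //= [].
rewrite (fine_partition mk Q (measurableX measurableT (mk2 b))).
apply: eq_bigr => a _; congr (fine (Q _)).
by apply/seteqP; split => -[x y] /=; [move=> [? ?]|move=> [[? ?] ?]].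
Qed.

Lemma sum_cell_marginal1 : \sum_a cell_marginal1 a = 1.
Proof.
rewrite -[RHS](congr1 fine (probability_setT Q)).
have mk : measurable_fibers (k1 \o fst : T1 * T2 -> A).
  move=> a; rewrite (_ : _ @^-1` _ = (k1 @^-1` [set a]) `*` setT).
    exact: measurableX.
  by apply/seteqP; split => -[x y] //= [].
rewrite (fine_partition mk Q measurableT).
apply: eq_bigr => a _; rewrite cell_marginal1E setTI; congr (fine (Q _)).
by apply/seteqP; split => -[x y] //= [].
Qed.

Lemma sum_cell_prob : \sum_x cell_prob x = 1.
Proof.
by rewrite -sum_cell_marginal1 sum_pair.
Qed.

Lemma sum_cell_marginals : \sum_x cell_marginal1 x.1 * cell_marginal2 x.2 = 1.
Proof.
rewrite sum_pair/=; under eq_bigr do rewrite -mulr_sumr.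
rewrite -mulr_suml sum_cell_marginal1 mul1r.
by rewrite /cell_marginal2 exchange_big/= -sum_cell_marginal1.
Qed.

(** Two finite quantizers cut the product space into rectangles, on which the product of the
    marginals is the product of the cell marginals. *)
Lemma mutual_information_ge (w : A * B -> R) : (forall x, 0 < w x) ->
  (((ln 2)^-1 * (\sum_x cell_prob x * ln (w x) + 1 -
     \sum_x cell_marginal1 x.1 * cell_marginal2 x.2 * w x))%:E
   <= mutual_information Q)%E.
Proof.
move=> w0; pose k (z : T1 * T2) := (k1 z.1, k2 z.2).
have kE x : k @^-1` [set x] = (k1 @^-1` [set x.1]) `*` (k2 @^-1` [set x.2]).
  case: x => a b; apply/seteqP; split => -[x y] /=; first by case.
  by rewrite /k/= => -[-> ->].
have mk : measurable_fibers k by move=> x; rewrite kE; exact: measurableX.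
apply: le_trans (relative_entropy_ge _ _ mk w0).
rewrite lee_fin ler_wpM2l ?invr_ge0 ?ln_ge0 ?ler1n//.
rewrite lerB//.
  by rewrite lerD2r; apply: ler_sum => x _; rewrite kE.
apply: ler_sum => x _; rewrite kE.
have h : cell_marginal1 x.1 * cell_marginal2 x.2 =
    fine ((distribution Q fst \x distribution Q snd)%E
      ((k1 @^-1` [set x.1]) `*` (k2 @^-1` [set x.2]))).
  rewrite product_measure1E// fineM ?fin_num_measure//.
  rewrite cell_marginal1E cell_marginal2E; congr (fine (Q _) * fine (Q _)).
    by apply/seteqP; split => -[u v] //= [].
  by apply/seteqP; split => -[u v] //= [].
by rewrite h; exact: lexx.
Qed.

(* Data processing: quantizing both components does not increase the mutual information. *)
Lemma mutual_information_cells :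
  (((ln 2)^-1 * \sum_x cell_prob x *
     ln (cell_prob x / (cell_marginal1 x.1 * cell_marginal2 x.2)))%:E
   <= mutual_information Q)%E.
Proof.
have ln2 : 0 < ln 2 :> R by rewrite ln_gt0// ltr1n.
have m1 x : 0 < cell_prob x -> 0 < cell_marginal1 x.1.
  case: x => a b h; rewrite /cell_marginal1 (bigD1 b)//= ltr_pwDl//.
  by apply: sumr_ge0 => *; exact: cell_prob_ge0.
have m2 x : 0 < cell_prob x -> 0 < cell_marginal2 x.2.
  case: x => a b h; rewrite /cell_marginal2 (bigD1 a)//= ltr_pwDl//.
  by apply: sumr_ge0 => *; exact: cell_prob_ge0.
have m10 a : 0 <= cell_marginal1 a.
  by apply: sumr_ge0 => *; exact: cell_prob_ge0.
have m20 b : 0 <= cell_marginal2 b.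
  by apply: sumr_ge0 => *; exact: cell_prob_ge0.
apply/lee_addgt0Pr => e e0.
pose eta := e * ln 2.
have eta0 : 0 < eta by rewrite mulr_gt0.
(* The likelihood ratio is the natural test function. Cells of probability 0 still need a positive
   weight; [eta] there costs at most [eta / ln 2 = e]. *)
pose w x := if 0 < cell_prob x then
  cell_prob x / (cell_marginal1 x.1 * cell_marginal2 x.2) else eta.
have w0 x : 0 < w x.
  rewrite /w; case: ifPn => // h.
  by rewrite divr_gt0// mulr_gt0 ?m1 ?m2.
rewrite -leeBlDr//; apply: le_trans (mutual_information_ge w0).
rewrite -EFinB lee_fin -[e](mulfK (lt0r_neq0 ln2)) -/eta [eta / _]mulrC -mulrBr.
rewrite ler_wpM2l ?invr_ge0 ?(ltW ln2)//.
have -> : \sum_x cell_prob x * ln (w x) = \sum_x cell_prob x *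
     ln (cell_prob x / (cell_marginal1 x.1 * cell_marginal2 x.2)).
  apply: eq_bigr => x _; rewrite /w; case: ifPn => //.
  rewrite -leNgt => h.
  by rewrite (_ : cell_prob x = 0) ?mul0r//; apply/eqP; rewrite eq_le h cell_prob_ge0.
suff : \sum_x cell_marginal1 x.1 * cell_marginal2 x.2 * w x <= 1 + eta by lra.
apply: (@le_trans _ _ (\sum_x (cell_prob x + cell_marginal1 x.1 * cell_marginal2 x.2 * eta))).
  apply: ler_sum => x _; rewrite /w; case: ifPn => h.
    rewrite mulrC divfK ?gt_eqF ?mulr_gt0 ?m1 ?m2// lerDl.
    by rewrite !mulr_ge0// ltW.
  by rewrite lerDr cell_prob_ge0.
rewrite big_split/= sum_cell_prob -mulr_suml lerD2l.
by rewrite sum_cell_marginals mul1r.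
Qed.

End mutual_information_bound.

(** The one-cell quantizers with weight 1. *)
Lemma mutual_information_ge0 d d' (T1 : measurableType d) (T2 : measurableType d')
    (R : realType) (Q : probability (T1 * T2)%type R) : (0 <= mutual_information Q)%E.
Proof.
have m1 := @measurable_fibers_cst _ T1 _ tt; have m2 := @measurable_fibers_cst _ T2 _ tt.
apply: le_trans (mutual_information_ge Q m1 m2 (w := fun=> 1) _) => [|//].
rewrite lee_fin big1 ?add0r => [|x _]; last by rewrite ln1 mulr0.
under eq_bigr do rewrite mulr1.
by rewrite (sum_cell_marginals Q m1 m2) subrr mulr0.
Qed.

(** * Quantization of complex vectors *)

Section sqnorm.
Context {R : realType} {N : nat}.
Implicit Types u v : cvec R N.

Lemma sqnorm_ge0 v : 0 <= sqnorm v.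
Proof. by apply: sumr_ge0 => i _; rewrite addr_ge0 ?sqr_ge0. Qed.

Lemma sqnorm0 : sqnorm (0 : cvec R N) = 0.
Proof. by apply: big1 => i _; rewrite mxE /= expr0n addr0. Qed.

Lemma sqnormN v : sqnorm (- v) = sqnorm v.
Proof.
by apply: eq_bigr => i _; rewrite mxE; case: (v i ord0) => a b /=; rewrite !sqrrN.
Qed.

Lemma sqnormBC u v : sqnorm (u - v) = sqnorm (v - u).
Proof. by rewrite -sqnormN opprB. Qed.

(** Young's inequality: coordinatewise the difference is [eta (a - b / eta)^2]. A small [eta] lets a
    perturbation [v] cost a factor close to 1 on [u]. *)
Lemma sqnormD u v (eta : R) : 0 < eta ->
  sqnorm (u + v) <= (1 + eta) * sqnorm u + (1 + eta^-1) * sqnorm v.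
Proof.
move=> eta0; rewrite /sqnorm !mulr_sumr -big_split/=; apply: ler_sum => i _.
have sq (a b : R) : (a + b) ^+ 2 <= (1 + eta) * a ^+ 2 + (1 + eta^-1) * b ^+ 2.
  rewrite -subr_ge0.
  have -> : (1 + eta) * a ^+ 2 + (1 + eta^-1) * b ^+ 2 - (a + b) ^+ 2 =
    eta * (a - eta^-1 * b) ^+ 2 by field; rewrite gt_eqF.
  by rewrite mulr_ge0 ?sqr_ge0// ltW.
rewrite mxE; case: (u i ord0) => a b; case: (v i ord0) => a' b' /=.
by have := sq a a'; have := sq b b'; lra.
Qed.

Lemma sqnormD2 u v : sqnorm (u + v) <= 2 * sqnorm u + 2 * sqnorm v.
Proof. by have := sqnormD u v ltr01; rewrite invr1. Qed.

Lemma measurable_cvec_coord (i : 'I_N) :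
  measurable_fun [set: cvec R N] (@cvec_coord R N i).
Proof.
move=> _ Y mY; rewrite setTI; apply: sub_sigma_algebra => /=.
rewrite -bigcup_seq/=; exists i => /=; first by rewrite mem_index_enum.
by exists Y => //; rewrite setTI.
Qed.

Lemma measurable_cvec_Re (i : 'I_N) :
  measurable_fun [set: cvec R N] (fun v : cvec R N => complex.Re (v i ord0)).
Proof. exact: (measurableT_comp measurable_fst (measurable_cvec_coord i)). Qed.

Lemma measurable_cvec_Im (i : 'I_N) :
  measurable_fun [set: cvec R N] (fun v : cvec R N => complex.Im (v i ord0)).
Proof. exact: (measurableT_comp measurable_snd (measurable_cvec_coord i)). Qed.

Lemma measurable_sqnormB d (T : measurableType d) (f g : T -> cvec R N) :
  measurable_fun setT f -> measurable_fun setT g ->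
  measurable_fun setT (fun x => sqnorm (f x - g x)).
Proof.
move=> mf mg; apply: measurable_sum => i.
rewrite (_ : (fun x => _) = (fun x =>
   (complex.Re (f x i ord0) - complex.Re (g x i ord0)) ^+ 2 +
   (complex.Im (f x i ord0) - complex.Im (g x i ord0)) ^+ 2)).
  apply: measurable_funD; apply: measurable_funX; apply: measurable_funB.
  - exact: (measurableT_comp (measurable_cvec_Re i) mf).
  - exact: (measurableT_comp (measurable_cvec_Re i) mg).
  - exact: (measurableT_comp (measurable_cvec_Im i) mf).
  - exact: (measurableT_comp (measurable_cvec_Im i) mg).
apply/funext => x; rewrite !mxE.
by case: (f x i ord0) => a b; case: (g x i ord0) => a' b'.
Qed.

Lemma measurable_sqnorm : measurable_fun [set: cvec R N] (@sqnorm R N).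
Proof.
have := @measurable_sqnormB _ (cvec R N) id (cst 0) (@measurable_id _ _ _) (measurable_cst _).
by congr (measurable_fun _ _); apply/funext => x; rewrite subr0.
Qed.

End sqnorm.

Section quantization.
Context {R : realType} {N : nat}.

Lemma grid (S delta : R) : 0 < S -> 0 < delta ->
  exists (I : finType) (b : I -> cvec R N),
    forall h, sqnorm h <= S -> exists i, sqnorm (h - b i) <= delta.
Proof.
(* Mesh of the grid: the 2N real coordinates contribute [rho^2] each, and [rho <= 1] gives
   [rho^2 <= rho]. *)
move=> S0 d0; pose rho := Num.min 1 (delta / (2 * N%:R + 1)).
have n0 : 0 < 2 * N%:R + 1 :> R by rewrite ltr_wpDl// mulr_ge0.
have rho0 : 0 < rho by rewrite lt_min ltr01 divr_gt0.
have rho1 : rho <= 1 by rewrite ge_min lexx.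
have rhod : N%:R * (rho ^+ 2 + rho ^+ 2) <= delta.
  have h : rho * (2 * N%:R + 1) <= delta.
    by rewrite -ler_pdivlMr// ge_min lexx orbT.
  apply: le_trans h; rewrite expr2.
  have : rho * rho <= rho * 1 by rewrite ler_wpM2l// ltW.
  have : 0 <= N%:R :> R by [].
  nra.
(* [x^2 <= S < (S + 1)^2] bounds the coordinates without a square root. *)
pose L := S + 1.
pose M := (Num.truncn (2 * L / rho)).+1.
pose g (k : 'I_M) := k%:R * rho - L.
have real_grid x : x ^+ 2 <= S -> exists k, (x - g k) ^+ 2 <= rho ^+ 2.
  move=> xS; have xL : `|x| <= L.
    rewrite leNgt; apply/negP => h.
    have : L ^+ 2 < `|x| ^+ 2 by rewrite ltr_pXn2r ?nnegrE// /L; lra.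
    by rewrite real_normK ?num_real// /L !expr2; nra.
  move: xL; rewrite ler_norml => /andP[xL Lx].
  have y0 : 0 <= (x + L) / rho by rewrite divr_ge0 ?(ltW rho0)//; lra.
  have kM : (Num.truncn ((x + L) / rho) < M)%N.
    by rewrite ltnS; apply: le_truncn; rewrite ler_pM2r ?invr_gt0//; lra.
  exists (Ordinal kM); rewrite /g/=.
  have /andP[h1 h2] := truncn_itv y0.
  move: h1 h2; rewrite ler_pdivlMr// ltr_pdivrMr// -natr1 => h1 h2.
  rewrite ler_sqr ?nnegrE//; lra.
exists {ffun 'I_N * bool -> 'I_M}.
exists (fun f : {ffun 'I_N * bool -> 'I_M} => \col_i ((g (f (i, true))) +i* (g (f (i, false))))%C).
move=> h hS.
have hRe i : complex.Re (h i ord0) ^+ 2 <= S.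
  apply: le_trans hS; rewrite /sqnorm (bigD1 i)//= -addrA lerDl.
  by rewrite addr_ge0 ?sqr_ge0// sumr_ge0// => j _; rewrite addr_ge0 ?sqr_ge0.
have hIm i : complex.Im (h i ord0) ^+ 2 <= S.
  apply: le_trans hS; rewrite /sqnorm (bigD1 i)//= addrAC lerDr.
  by rewrite addr_ge0 ?sqr_ge0// sumr_ge0// => j _; rewrite addr_ge0 ?sqr_ge0.
pose F (z : 'I_N * bool) := if z.2 then xget ord0 [set k | (complex.Re (h z.1 ord0) - g k) ^+ 2 <= rho ^+ 2]
  else xget ord0 [set k | (complex.Im (h z.1 ord0) - g k) ^+ 2 <= rho ^+ 2].
exists [ffun z => F z]; apply: le_trans rhod.
have -> : N%:R * (rho ^+ 2 + rho ^+ 2) = \sum_(i < N) (rho ^+ 2 + rho ^+ 2).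
  by rewrite sumr_const card_ord mulr_natl.
apply: ler_sum => i _.
rewrite !mxE !ffunE /F/=.
have [k1 hk1] := real_grid _ (hRe i); have [k2 hk2] := real_grid _ (hIm i).
have := @xgetPex _ ord0 [set k | (complex.Re (h i ord0) - g k) ^+ 2 <= rho ^+ 2]
   (ex_intro _ k1 hk1).
have := @xgetPex _ ord0 [set k | (complex.Im (h i ord0) - g k) ^+ 2 <= rho ^+ 2]
   (ex_intro _ k2 hk2).
move=> /=; set x1 := xget _ _; set x2 := xget _ _.
by case: (h i ord0) => a c /= h2 h1; exact: lerD.
Qed.

(* Points not within delta of an admissible grid point are sent to [None]. *)
Lemma quantizer (S delta : R) : 0 < S -> 0 < delta -> delta <= S ->
  exists (I : finType) (b : I -> cvec R N) (q : cvec R N -> option I),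
   [/\ measurable_fibers q, forall i, sqnorm (b i) <= 4 * S,
    forall h i, q h = Some i -> sqnorm (h - b i) <= delta &
    forall h, q h = None -> S < sqnorm h].
Proof.
move=> S0 d0 dS; have [I [b bP]] := grid S0 d0.
(* If [sqnorm h <= S], a grid point within [delta <= S] of [h] has squared norm at most [2 S + 2 S],
   so the second condition excludes none of the points needed there. *)
pose ok h i := (sqnorm (h - b i) <= delta) && (sqnorm (b i) <= 4 * S).
pose q h := [pick i | ok h i].
pose J := {i | sqnorm (b i) <= 4 * S}.
pose sub (o : option I) : option J := if o is Some i then insub i else None.
have qP h : if q h is Some i then ok h i else forall i, ~~ ok h i.
  by rewrite /q; case: pickP => // nok i; rewrite nok.
exists J, (b \o val), (sub \o q); split.
- have mok : measurable_fibers (fun h => [ffun i => ok h i]).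
    apply: measurable_fibers_ffun => i c.
    have : measurable_fun setT (ok ^~ i).
      apply: measurable_and; last exact: measurable_cst.
      apply: measurable_fun_ler => //.
      exact: measurable_sqnormB.
    by move=> /(_ measurableT [set c]); rewrite setTI; apply.
  have -> : sub \o q = (fun f : {ffun I -> bool} => sub [pick i | f i]) \o
       (fun h => [ffun i => ok h i]).
    apply/funext => h /=; rewrite /q; congr sub.
    by apply: eq_pick => i; rewrite ffunE.
  exact: measurable_fibers_comp.
- by move=> [].
- move=> h [i hi]; rewrite /=; have := qP h; case: (q h) => //= j /andP[h1 h2].
  by rewrite insubT => -[ji]; rewrite -ji.
move=> h; rewrite /=; have := qP h; case: (q h) => [j /andP[h1 h2] /=|nok _].
  by rewrite insubT.
rewrite ltNge; apply/negP => /[dup] hS /bP[i hi].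
have /negP := nok i; apply; rewrite /ok hi/=.
have := sqnormD2 h (b i - h); rewrite addrC subrK sqnormBC => hb.
by apply: (le_trans hb); lra.
Qed.

(** The last two inequalities face opposite directions: one bounds the true distortion of any
    codeword by the finite one, the other bounds the finite distortion of a coupling by its true
    one. A source vector that is not quantized gets finite distortion 0, which makes the latter
    trivial and sends its true cost to the tail term of the former. Reproductions get the larger
    radius [16 S], beyond which 0 is a better choice. *)
Lemma quantization (S eta : R) : 0 < S -> 0 < eta ->
  exists (A B : finType) (qa : cvec R N -> A) (qb : cvec R N -> B)
    (rep : B -> cvec R N) (dist : A -> B -> R),
  [/\ measurable_fibers qa, measurable_fibers qb, forall a b, 0 <= dist a b,
   forall h b, sqnorm (h - rep b) <=
     dist (qa h) b + eta + 130 * (sqnorm h * (S < sqnorm h)%R%:R) &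
   forall h y, dist (qa h) (qb y) <= (1 + eta) ^+ 2 * sqnorm (h - y) + eta].
Proof.
move=> S0 eta0; pose kappa := 1 + eta^-1.
have kappa1 : 1 <= kappa by rewrite lerDl invr_ge0 ltW.
(* The errors of source and reproduction add up to at most [2 delta + 2 delta], weighted by
   [(1 + eta) kappa] through [sqnormD]. *)
pose delta := Num.min S (eta / (4 * (1 + eta) * kappa)).
have ek0 : 0 < 4 * (1 + eta) * kappa by rewrite !mulr_gt0//; lra.
have d0 : 0 < delta by rewrite lt_min S0 divr_gt0.
have dS : delta <= S by rewrite ge_min lexx.
have dk : (1 + eta) * (kappa * (4 * delta)) <= eta.
  have : delta * (4 * (1 + eta) * kappa) <= eta.
    by rewrite -ler_pdivlMr// ge_min lexx orbT.
  lra.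
have dk1 : kappa * delta <= eta.
  have : 0 <= kappa * delta by rewrite mulr_ge0// ltW//; lra.
  nra.
have [A [a [qa [mqa aS aP aN]]]] := quantizer S0 d0 dS.
have S16 : 0 < 16 * S by lra.
have dS16 : delta <= 16 * S by lra.
have [B [b [qb [mqb bS bP bN]]]] := quantizer S16 d0 dS16.
pose rep (o : option B) := if o is Some j then b j else 0.
pose dist (o : option A) (j : option B) :=
  if o is Some i then (1 + eta) * sqnorm (a i - rep j) else 0.
exists (option A), (option B), qa, qb, rep, dist; split => //.
- by move=> [i|] j //=; rewrite mulr_ge0 ?sqnorm_ge0//; lra.
- move=> h j; have sh := sqnorm_ge0 h.
  have out0 : 0 <= 130 * (sqnorm h * (S < sqnorm h)%R%:R).
    by rewrite !mulr_ge0.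
  case E : (qa h) => [i|] /=.
    have := sqnormD (a i - rep j) (h - a i) eta0.
    rewrite addrC addrA subrK -/kappa.
    have := aP _ _ E => h1 h2.
    have : kappa * sqnorm (h - a i) <= kappa * delta by rewrite ler_wpM2l//; lra.
    lra.
  (* Representatives have squared norm at most [4 * 16 S = 64 S < 64 sqnorm h], and
     [2 + 2 * 64 = 130]. *)
  have Sh := aN _ E; rewrite Sh mulr1.
  have rj : sqnorm (rep j) <= 64 * S.
    case: j => [j|] /=; first by have := bS j; lra.
    by rewrite sqnorm0; lra.
  by have := sqnormD2 h (- rep j); rewrite sqnormN; lra.
move=> h y; case E : (qa h) => [i|] /=; last first.
  by rewrite addr_ge0 ?(ltW eta0)// mulr_ge0 ?sqr_ge0 ?sqnorm_ge0.
have hi := aP _ _ E.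
have main z : sqnorm z <= 4 * delta -> forall w, w = h - y + z ->
   (1 + eta) * sqnorm w <= (1 + eta) ^+ 2 * sqnorm (h - y) + eta.
  move=> hz w ->; have := sqnormD (h - y) z eta0; rewrite -/kappa => h1.
  have h2 : kappa * sqnorm z <= kappa * (4 * delta) by rewrite ler_wpM2l//; lra.
  have : (1 + eta) * sqnorm (h - y + z) <= (1 + eta) *
     ((1 + eta) * sqnorm (h - y) + kappa * (4 * delta)).
    by rewrite ler_wpM2l//; lra.
  by rewrite expr2; lra.
case F : (qb y) => [j|] /=.
  have hj := bP _ _ F.
  apply: (main ((a i - h) + (y - b j))); last first.
    by rewrite [X in _ = _ + X]addrC addrA [h - y + _]addrA subrK
      [RHS]addrC addrA subrK.
  have := sqnormD2 (a i - h) (y - b j).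
  by rewrite sqnormBC; lra.
(* [16 S < sqnorm y <= 2 sqnorm (y - a i) + 8 S] yields [sqnorm (a i - y) > 4 S >= sqnorm (a i)]:
   reproducing 0 instead of [y] does not hurt. *)
have yS := bN _ F; rewrite subr0.
have h1 : sqnorm (a i) <= sqnorm (a i - y).
  have := sqnormD2 (y - a i) (a i); rewrite subrK sqnormBC.
  have := aS i; lra.
apply: le_trans (main (a i - h) _ (a i - y) _).
- by rewrite ler_wpM2l//; lra.
- by rewrite sqnormBC; lra.
- by rewrite [RHS]addrC addrA subrK.
Qed.

End quantization.

(** * Gaussian vectors *)

Section normal_moment.
Context {R : realType}.
Notation leb := (@lebesgue_measure R).

Lemma integral_normal_prob (m s : R) (f : R -> \bar R) :
  (forall x, (0 <= f x)%E) -> measurable_fun [set: R] f ->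
  (\int[normal_prob m s]_x f x = \int[leb]_x (f x * (normal_pdf m s x)%:E))%E.
Proof.
move=> f0 mf; have dom := normal_prob_dominates m s.
rewrite -(Radon_Nikodym_SigmaFinite.change_of_variables dom f0 measurableT mf).
have iSF := Radon_Nikodym_SigmaFinite.f_integrable dom.
apply: ae_eq_integral => //.
- by apply: emeasurable_funM => //; exact: measurable_int iSF.
- apply: emeasurable_funM => //; apply/measurable_EFinP; exact: measurable_normal_pdf.
apply: ae_eqe_mul2l; apply: integral_ae_eq => //.
- apply/measurable_EFinP; exact: measurable_normal_pdf.
by move=> E _ mE; rewrite -(Radon_Nikodym_SigmaFinite.f_integral dom mE).
Qed.

(** With [v = (x - m)^2 / s^2], the weight [expR (- v / 2)] splits into [expR (- 3 v / 8)], which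
    absorbs the factor [v] at the price of a constant 3, and [expR (- v / 8)], a Gaussian of twice
    the deviation. *)
Lemma normal_fun_sqr_le (m s x : R) : s != 0 ->
  x ^+ 2 * normal_fun m s x <=
    2 * m ^+ 2 * normal_fun m s x + 6 * s ^+ 2 * normal_fun m (2 * s) x.
Proof.
move=> s0; have s20 : 0 < s ^+ 2 by rewrite exprn_even_gt0.
have x2 : x ^+ 2 <= 2 * m ^+ 2 + 2 * (x - m) ^+ 2.
  by have := sqr_ge0 (x - 2 * m); rewrite !expr2; lra.
apply: (le_trans (ler_wpM2r (normal_fun_ge0 _ _ _) x2)).
rewrite mulrDl lerD2l.
pose v := (x - m) ^+ 2 / s ^+ 2.
have v0 : 0 <= v by rewrite divr_ge0 ?sqr_ge0.
have -> : (x - m) ^+ 2 = s ^+ 2 * v by rewrite /v mulrC divfK ?gt_eqF.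
have -> : normal_fun m s x = expR (- (3 / 8 * v)) * expR (- (v / 8)).
  rewrite -expRD /normal_fun; congr expR; rewrite /v; field; rewrite //.
have -> : normal_fun m (2 * s) x = expR (- (v / 8)).
  rewrite /normal_fun; congr expR; rewrite /v; field; rewrite //.
have h : v * expR (- (3 / 8 * v)) <= 3.
  rewrite expRN ler_pdivrMr ?expR_gt0//.
  by have := expR_ge1Dx (3 / 8 * v); lra.
by have := ler_wpM2l (mulr_ge0 (ltW s20) (expR_ge0 (- (v / 8)))) h; lra.
Qed.

Lemma normal_prob_second_moment (m s : R) : s != 0 ->
  (\int[normal_prob m s]_x (x ^+ 2)%:E < +oo)%E.
Proof.
move=> s0; rewrite integral_normal_prob//; last 2 first.
  by move=> x; rewrite lee_fin sqr_ge0.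
  by apply/measurable_EFinP; exact: measurable_funX.
pose c := 6 * s ^+ 2 * (normal_peak s / normal_peak (2 * s)).
have s20 : 2 * s != 0 by rewrite mulf_neq0.
have c0 : 0 <= c.
  by apply: mulr_ge0; [rewrite mulr_ge0 ?sqr_ge0|rewrite divr_ge0 ?normal_peak_ge0].
apply: (@le_lt_trans _ _ (\int[leb]_x
   ((2 * m ^+ 2)%:E * (normal_pdf m s x)%:E + c%:E * (normal_pdf m (2 * s) x)%:E))%E).
  apply: ge0_le_integral => //.
  - by move=> x _; rewrite -EFinM lee_fin mulr_ge0 ?sqr_ge0 ?normal_pdf_ge0.
  - apply: emeasurable_funM; apply/measurable_EFinP.
      exact: measurable_funX.
    exact: measurable_normal_pdf.
  - by apply: emeasurable_funD; apply: emeasurable_funM => //;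
      apply/measurable_EFinP; exact: measurable_normal_pdf.
  - move=> x _; rewrite -!EFinM -EFinD lee_fin !normal_pdfE//.
    have := ler_wpM2l (normal_peak_ge0 s) (normal_fun_sqr_le m x s0).
    have -> : c * (normal_peak (2 * s) * normal_fun m (2 * s) x) =
       6 * s ^+ 2 * normal_peak s * normal_fun m (2 * s) x.
      rewrite /c; field; rewrite gt_eqF// normal_peak_gt0//.
    lra.
have ipdf t : leb.-integrable setT (EFin \o normal_pdf m t).
  exact: integrable_normal_pdf.
rewrite integralD//; last 2 first.
- exact: (integrableZl measurableT _ (ipdf s)).
- exact: (integrableZl measurableT _ (ipdf (2 * s))).
rewrite (integralZl measurableT (ipdf s)) (integralZl measurableT (ipdf (2 * s))).
by rewrite !integral_normal_pdf !mule1 -EFinD ltry.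
Qed.

Lemma normal_law_second_moment d (T : measurableType d) (mu : probability T R)
    (X : T -> R) (m s : R) : measurable_fun setT X ->
  (forall A : set (measurableTypeR R), measurable A ->
     mu (X @^-1` A) = normal_law m s A) ->
  (\int[mu]_x (X x ^+ 2)%:E < +oo)%E.
Proof.
move=> mX hX.
have msq : measurable_fun [set: measurableTypeR R] (fun x : R => (x ^+ 2)%:E).
  by apply/measurable_EFinP; exact: measurable_funX.
pose X' : T -> measurableTypeR R := X.
have := @ge0_integral_pushforward _ _ _ _ _ X' mX mu setT (fun x : R => (x ^+ 2)%:E) measurableT msq.
rewrite preimage_setT => <-; last by move=> x _; rewrite lee_fin sqr_ge0.
have [s0|s0] := eqVneq s 0.
  rewrite (eq_measure_integral (dirac (m : measurableTypeR R))).
    by rewrite integral_dirac// diracT mul1e ltry.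
  by move=> A mA _; rewrite /= /pushforward hX// /normal_law s0 eqxx.
rewrite (eq_measure_integral (normal_prob m s)).
  exact: normal_prob_second_moment.
by move=> A mA _; rewrite /= /pushforward hX// /normal_law (negbTE s0).
Qed.

End normal_moment.

Section gaussian.
Local Open Scope sesquilinear_scope.
Context {R : realType} {N : nat}.

Lemma mul_trmxC_delta (a : R[i]) (i : 'I_N) (h : cvec R N) :
  ((\col_k (if k == i then a else 0)) ^t* *m (h : 'cV[R[i]]_N)) ord0 ord0 =
  a^*%R * h i ord0.
Proof.
rewrite mxE (bigD1 i)//= !mxE eqxx big1 ?addr0// => k ki.
by rewrite !mxE (negbTE ki) conjC0 mul0r.
Qed.

Section proper_gaussian.
Variables (S : 'M[R[i]]_N) (mu : probability (cvec R N) R).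
Hypothesis hmu : proper_gaussian S mu.

Lemma gaussian_Re_second_moment i :
  (\int[mu]_h (complex.Re (h i ord0) ^+ 2)%:E < +oo)%E.
Proof.
have [lin _ _ _] := hmu.
have [m [s hms]] := lin (\col_k (if k == i then 1 else 0)).
apply: (normal_law_second_moment (m := m) (s := s)).
  exact: measurable_cvec_Re.
move=> A mA; rewrite -(hms A mA); congr (mu _); apply/funext => h /=.
by rewrite mul_trmxC_delta conjC1 mul1r.
Qed.

Lemma gaussian_Im_second_moment i :
  (\int[mu]_h (complex.Im (h i ord0) ^+ 2)%:E < +oo)%E.
Proof.
have [lin _ _ _] := hmu.
(* Multiplying by the conjugate of the imaginary unit moves the imaginary part into the real
   part. *)
have [m [s hms]] := lin (\col_k (if k == i then (0 +i* 1)%C else 0)).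
apply: (normal_law_second_moment (m := m) (s := s)).
  exact: measurable_cvec_Im.
move=> A mA; rewrite -(hms A mA); congr (mu _); apply/funext => h /=.
rewrite mul_trmxC_delta; congr (A _).
by case: (h i ord0) => x y /=; rewrite mul0r sub0r mulN1r opprK.
Qed.

Lemma gaussian_second_moment : (\int[mu]_h (sqnorm h)%:E < +oo)%E.
Proof.
under eq_integral do rewrite /sqnorm -sumEFin.
have mRe i : measurable_fun [set: cvec R N] (fun h : cvec R N => (complex.Re (h i ord0) ^+ 2)%:E).
  by apply/measurable_EFinP; apply: measurable_funX; exact: measurable_cvec_Re.
have mIm i : measurable_fun [set: cvec R N] (fun h : cvec R N => (complex.Im (h i ord0) ^+ 2)%:E).
  by apply/measurable_EFinP; apply: measurable_funX; exact: measurable_cvec_Im.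
rewrite ge0_integral_sum//; last 2 first.
- by move=> i; under eq_fun do rewrite EFinD; exact: emeasurable_funD.
- by move=> i h _; rewrite lee_fin addr_ge0 ?sqr_ge0.
apply: lte_sum_pinfty => i _.
under eq_integral do rewrite EFinD.
rewrite ge0_integralD//.
- rewrite lte_add_pinfty//; [exact: gaussian_Re_second_moment|
    exact: gaussian_Im_second_moment].
- by move=> h _; rewrite lee_fin sqr_ge0.
- by move=> h _; rewrite lee_fin sqr_ge0.
Qed.

Lemma gaussian_sqnorm_integrable : mu.-integrable setT (EFin \o @sqnorm R N).
Proof.
apply/integrableP; split; first by apply/measurable_EFinP; exact: measurable_sqnorm.
under eq_integral do rewrite /= ger0_norm ?sqnorm_ge0//.
exact: gaussian_second_moment.
Qed.

Let integrable_sqr (X : cvec R N -> R) : measurable_fun setT X ->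
  (\int[mu]_h (X h ^+ 2)%:E < +oo)%E -> mu.-integrable setT (EFin \o X).
Proof.
move=> mX X2; have mX2 : measurable_fun setT (fun h => (X h ^+ 2)%:E).
  by apply/measurable_EFinP; exact: measurable_funX.
apply/integrableP; split; first exact/measurable_EFinP.
apply: (@le_lt_trans _ _ (\int[mu]_h (1 + (X h ^+ 2)%:E))%E).
  apply: ge0_le_integralT => h //=.
  rewrite -EFinD lee_fin -[X in _ + X]real_normK ?num_real//.
  by have := sqr_ge0 (`|X h| - 1); have := normr_ge0 (X h); rewrite !expr2; lra.
rewrite ge0_integralD//; last by move=> h _; rewrite lee_fin sqr_ge0.
by rewrite integral_cst// mul1e lte_add_pinfty// -ge0_fin_numE// fin_num_measure.
Qed.

Lemma gaussian_Re_integrable i :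
  mu.-integrable setT (EFin \o (fun h : cvec R N => complex.Re (h i ord0))).
Proof.
by apply: integrable_sqr; [exact: measurable_cvec_Re|exact: gaussian_Re_second_moment].
Qed.

Lemma gaussian_Im_integrable i :
  mu.-integrable setT (EFin \o (fun h : cvec R N => complex.Im (h i ord0))).
Proof.
by apply: integrable_sqr; [exact: measurable_cvec_Im|exact: gaussian_Im_second_moment].
Qed.

Lemma gaussian_Re_mean i : (\int[mu]_h (complex.Re (h i ord0))%:E = 0)%E.
Proof.
have [_ /(_ i) m0 _ _] := hmu.
have /= := congr1 (@complex.Re R) m0; rewrite /Rintegral => h.
by rewrite -[LHS]fineK ?h//; exact: integrable_fin_num (gaussian_Re_integrable i).
Qed.

Lemma gaussian_Im_mean i : (\int[mu]_h (complex.Im (h i ord0))%:E = 0)%E.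
Proof.
have [_ /(_ i) m0 _ _] := hmu.
have /= := congr1 (@complex.Im R) m0; rewrite /Rintegral => h.
by rewrite -[LHS]fineK ?h//; exact: integrable_fin_num (gaussian_Im_integrable i).
Qed.

(** Expanding the square, the term linear in [h] has mean 0 and the constant term is nonnegative.
    Hence no constant reproduction beats 0. *)
Lemma gaussian_shift (b : cvec R N) :
  (\int[mu]_h (sqnorm h)%:E <= \int[mu]_h (sqnorm (h - b))%:E)%E.
Proof.
pose l i (h : cvec R N) := 2 * complex.Re (b i ord0) * complex.Re (h i ord0) +
  2 * complex.Im (b i ord0) * complex.Im (h i ord0).
have lE i : mu.-integrable setT (EFin \o l i) /\ (\int[mu]_h (l i h)%:E = 0)%E.
  have i1 := integrableZl measurableT (2 * complex.Re (b i ord0)) (gaussian_Re_integrable i).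
  have i2 := integrableZl measurableT (2 * complex.Im (b i ord0)) (gaussian_Im_integrable i).
  split; first exact: (integrableD measurableT i1 i2).
  under eq_integral do rewrite EFinD.
  rewrite (integralD measurableT i1 i2).
  rewrite (integralZl measurableT (gaussian_Re_integrable i)).
  rewrite (integralZl measurableT (gaussian_Im_integrable i)).
  by rewrite gaussian_Re_mean gaussian_Im_mean !mule0 adde0.
have iL : mu.-integrable setT (EFin \o (fun h => \sum_i l i h)).
  rewrite (_ : EFin \o _ = fun h => (\sum_i (l i h)%:E)%E); last first.
    by apply/funext => h /=; rewrite sumEFin.
  by apply: integrable_sum => // i _; have [] := lE i.
apply: (@le_trans _ _ (\int[mu]_h ((sqnorm h)%:E - (\sum_i l i h)%:E))%E).
  rewrite (integralB_EFin measurableT gaussian_sqnorm_integrable iL).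
  under [X in (_ - X)%E]eq_integral do rewrite -sumEFin.
  rewrite integral_sum//; last by move=> i; have [] := lE i.
  by rewrite [X in (_ - X)%E]big1 ?sube0// => i _; have [] := lE i.
apply: le_integralT => h; rewrite -EFinB lee_fin.
rewrite /sqnorm -sumrB; apply: ler_sum => i _; rewrite !mxE /l.
case: (h i ord0) => x y; case: (b i ord0) => u v /=.
by have := sqr_ge0 u; have := sqr_ge0 v; rewrite !expr2; lra.
Qed.

(** Dominated convergence along integer thresholds, then monotonicity in the threshold, which lets
    finitely many laws share one. *)
Lemma gaussian_tail (e : R) : 0 < e -> exists S0 : R, forall s, S0 <= s ->
  (\int[mu]_h (sqnorm h * (s < sqnorm h)%R%:R)%:E <= e%:E)%E.
Proof.
move=> e0.
pose f (n : nat) (h : cvec R N) := (sqnorm h * (n%:R < sqnorm h)%R%:R)%:E.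
have mf n : measurable_fun setT (f n).
  apply/measurable_EFinP; apply: measurable_funM; first exact: measurable_sqnorm.
  apply: (@measurable_comp _ _ _ _ _ _ setT (fun b : bool => b%:R : R)) => //.
  by apply: measurable_fun_ltr => //; exact: measurable_sqnorm.
have cv : (\int[mu]_h f n h @[n --> \oo] --> \int[mu]_h (cst 0 h))%E.
  apply: (@dominated_cvg _ _ _ mu setT measurableT f (cst 0%E) (EFin \o @sqnorm R N)) => //.
  - move=> h _; apply: cvg_near_cst; near=> n.
    rewrite /f ltNge (_ : sqnorm h <= n%:R) ?mulr0//.
    by near: n; exact: nbhs_infty_ger.
  - exact: gaussian_sqnorm_integrable.
  - move=> n h _; rewrite /f /= lee_fin normrM ger0_norm ?sqnorm_ge0//.
    by rewrite ler_piMr ?sqnorm_ge0//; case: ltP; rewrite ?normr1 ?normr0.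
rewrite integral_cst// mul0e in cv.
have : \forall n \near \oo, (\int[mu]_h f n h < e%:E)%E.
  apply: (cv [set x | (x < e%:E)%E]); apply: open_nbhs_nbhs; split => /=.
    exact: open_ereal_lt_ereal.
  by rewrite lte_fin.
move=> [n _ /(_ n (leqnn n)) /= hn]; exists n%:R => s ns.
apply: le_trans (ltW hn); apply: ge0_le_integralT => h.
  by rewrite lee_fin mulr_ge0 ?sqnorm_ge0.
rewrite lee_fin ler_wpM2l ?sqnorm_ge0// ler_nat.
case: (ltP s) => //= sh; rewrite (_ : n%:R < sqnorm h)//.
exact: le_lt_trans ns sh.
Unshelve. all: by end_near. Qed.

End proper_gaussian.
End gaussian.

Section finite_valued.
Context d (T : measurableType d) (R : realType) (I : finType) (k : T -> I).
Hypothesis mk : measurable_fibers k.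
Variable mu : probability T R.

Lemma integral_fibers (F : I -> R) : (forall i, 0 <= F i) ->
  (\int[mu]_x (F (k x))%:E = (\sum_i fine (mu (k @^-1` [set i])) * F i)%:E)%E.
Proof.
move=> F0; transitivity (\int[mu]_x (\sum_i (F i)%:E * (\1_(k @^-1` [set i]) x)%:E))%E.
  apply: eq_integral => x _; rewrite (bigD1 (k x))//= big1 ?adde0.
    by rewrite indicE mem_set// mule1.
  move=> i ki; rewrite indicE memNset ?mule0// => /= kx.
  by move: ki; rewrite kx eqxx.
have mi i : measurable_fun [set: T] (fun x => (F i)%:E * (\1_(k @^-1` [set i]) x)%:E)%E.
  apply: emeasurable_funM => //; apply/measurable_EFinP.
  by apply: measurable_indic; exact: mk.
rewrite ge0_integral_sum//; last by move=> i x _; rewrite -EFinM lee_fin mulr_ge0.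
rewrite -sumEFin; apply: eq_bigr => i _.
rewrite ge0_integralZl_EFin//; last first.
  by apply/measurable_EFinP/measurable_indic; exact: mk.
rewrite (@integral_indic _ _ _ mu setT measurableT _ (mk i)) setIT.
by rewrite muleC EFinM fineK// fin_num_measure//; exact: mk.
Qed.

Lemma probability_fibers (D : I -> bool) :
  mu [set x | D (k x)] = (\sum_i fine (mu (k @^-1` [set i])) * (D i)%:R)%:E.
Proof.
rewrite -integral_fibers//.
have mD : measurable [set x | D (k x)].
  exact: (measurable_fibers_preimage [set i | D i] mk).
rewrite -[X in mu X]setIT -(@integral_indic _ _ _ mu setT measurableT _ mD).
apply: eq_integral => x _; rewrite indicE; congr (_%:R%:E).
by case: (boolP (D (k x))) => h; [rewrite mem_set|rewrite memNset//; apply/negP].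
Qed.

End finite_valued.

Lemma interval_index_lt (tau n t : nat) : (0 < tau)%N -> (t < n)%N ->
  (t %/ tau < intervals tau n)%N.
Proof.
move=> tau0 tn; rewrite /intervals.
apply: (@leq_trans ((t + tau) %/ tau)); first by rewrite divnDr ?dvdnn// divnn tau0 addn1.
by apply: leq_div2r; lia.
Qed.

Lemma intervals_le (tau n : nat) : (0 < tau)%N -> (intervals tau n <= n)%N.
Proof.
move=> tau0; rewrite /intervals; case: n => [|n]; first by rewrite divn_small; lia.
by rewrite -ltnS ltn_divLR//; nia.
Qed.

Lemma intervals_mul (tau n : nat) : (0 < tau)%N ->
  (intervals tau n * tau <= n + tau)%N.
Proof. by move=> tau0; have := leq_divM (n + tau.-1) tau; rewrite /intervals; lia. Qed.

Definition interval_index (tau n : nat) (tau0 : (0 < tau)%N) (t : 'I_n) :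
  'I_(intervals tau n) := Ordinal (interval_index_lt tau0 (ltn_ord t)).

(** Within an interval the remainder modulo [tau] determines the time. *)
Lemma card_interval (tau n : nat) (tau0 : (0 < tau)%N) (j : 'I_(intervals tau n)) :
  (#|[pred t : 'I_n | interval_index tau0 t == j]| <= tau)%N.
Proof.
rewrite -[leqRHS]card_ord.
pose f (t : 'I_n) : 'I_tau := Ordinal (ltn_pmod t tau0).
rewrite -(card_in_imset (f := f) (D := [pred t | interval_index tau0 t == j])).
  exact: max_card.
move=> t u; rewrite !inE => /eqP tj /eqP uj [tu]; apply: val_inj => /=.
rewrite (divn_eq t tau) (divn_eq u tau) tu; congr (_ * _ + _)%N.
by have := congr1 val tj; have := congr1 val uj => /= <- <-.
Qed.

Lemma pmf_index_gt0 (R : realType) (K : nat) (p : 'I_K -> R) :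
  \sum_c p c = 1 -> (0 < K)%N.
Proof.
case: (posnP K) => // K0; rewrite big1 => [/eqP|c _]; first by rewrite (eq_sym 0) oner_eq0.
by have := ltn_ord c; rewrite [X in (_ < X)%N]K0.
Qed.

(** * Codes for the mixture source *)

Section source.
Context {R : realType} {K N : nat} {d : measure_display} {Omega : measurableType d}.
Variables (tau : nat) (tau0 : (0 < tau)%N) (P : probability Omega R).
Variables (p : 'I_K -> R) (mu : 'I_K -> probability (cvec R N) R).
Variables (C : nat -> Omega -> 'I_K) (h : nat -> Omega -> cvec R N).
Hypothesis p0 : forall c, 0 <= p c.
Hypothesis p1 : \sum_c p c = 1.
Hypothesis hsource : mixture_source tau P p mu C h.

Definition cell_law (A : finType) (qa : cvec R N -> A) (c : 'I_K) (a : A) : R :=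
  fine (mu c (qa @^-1` [set a])).

Definition source_state (A : finType) (qa : cvec R N -> A) (n : nat) (w : Omega) :=
  ([ffun j : 'I_(intervals tau n) => C j w], [ffun t : 'I_n => qa (h t w)]).

Lemma source_label_measurable n :
  measurable_fibers (fun w => [ffun j : 'I_n => C j w]).
Proof. by have [mC _ _] := hsource; apply: measurable_fibers_ffun => j c; exact: mC. Qed.

Lemma source_vector_measurable t : measurable_fun setT (h t).
Proof. by have [_ mh _] := hsource. Qed.

Lemma source_state_measurable (A : finType) (qa : cvec R N -> A) n :
  measurable_fibers qa -> measurable_fibers (source_state qa n).
Proof.
move=> mqa [cc a].
rewrite (_ : _ @^-1` _ =
  (fun w => [ffun j : 'I_(intervals tau n) => C j w]) @^-1` [set cc] `&`
  (fun w => [ffun t : 'I_n => qa (h t w)]) @^-1` [set a]).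
  apply: measurableI; first exact: source_label_measurable.
  apply: measurable_fibers_ffun => t b.
  rewrite -[X in measurable X]setTI.
  exact: (source_vector_measurable t measurableT (mqa b)).
by apply/seteqP; split => w /=; [case=> -> ->|case=> <- <-].
Qed.

Lemma source_state_law (A : finType) (qa : cvec R N -> A) n x :
  measurable_fibers qa ->
  P (source_state qa n @^-1` [set x]) =
  (block_prob p (cell_law qa) (@interval_index tau n tau0) x.1 x.2)%:E.
Proof.
move=> mqa; case: x => cc a /=; have [_ _ hP] := hsource.
(* The source is specified by sequences over all of [nat]; beyond the block they are filled with a
   default label and with the full space. *)
pose k0 := Ordinal (pmf_index_gt0 p1).
pose c j := if insub j is Some j' then cc j' else k0.
pose E t := if insub t is Some t' then qa @^-1` [set a t'] else setT.
have mE t : measurable (E t).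
  by rewrite /E; case: insubP => [t' _ _|_]; [exact: mqa|exact: measurableT].
have := hP n c E mE.
rewrite (_ : [set w | _] = source_state qa n @^-1` [set (cc, a)]); last first.
  apply/seteqP; split => w /=.
    move=> [h1 h2]; congr pair; apply/ffunP => t; rewrite ffunE.
      by have := h1 _ (ltn_ord t); rewrite /c valK.
    by have := h2 _ (ltn_ord t); rewrite /E valK.
  move=> [h1 h2]; split => [j jn|t tn].
    by rewrite /c insubT /= -h1 ffunE.
  by rewrite /E insubT /= -h2 ffunE.
move=> ->; rewrite /block_prob EFinM; congr (_ * _)%E.
  by congr (_%:E); apply: eq_bigr => j _; rewrite /c valK.
rewrite -prodEFin; apply: eq_bigr => t _.
rewrite /E valK /cell_law fineK; last by rewrite fin_num_measure//; exact: mqa.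
have tn := interval_index_lt tau0 (ltn_ord t).
congr (mu _ _); rewrite /c insubT /=; congr (cc _); exact: val_inj.
Qed.

(** Only the label of the interval containing [t] matters; the others, and the vectors before [t],
    are marginalized out of the block law. *)
Lemma source_vector_law t (A : set (cvec R N)) : measurable A ->
  P (h t @^-1` A) = (\sum_c (p c)%:E * mu c A)%E.
Proof.
move=> mA; have [_ mh hP] := hsource.
pose m := intervals tau t.+1.
pose j0 : 'I_m := @interval_index tau t.+1 tau0 ord_max.
have mlab : measurable_fibers (fun w => [ffun j : 'I_m => C j w]).
  exact: source_label_measurable.
have mhA : measurable (h t @^-1` A).
  by rewrite -[X in measurable X]setTI; exact: mh.
rewrite (measure_partition mlab P mhA).
pose k0 := Ordinal (pmf_index_gt0 p1).
pose E s := if s == t then A else setT.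
have mE s : measurable (E s).
  by rewrite /E; case: eqP => _; [exact: mA|exact: measurableT].
have cell (cc : {ffun 'I_m -> 'I_K}) :
    P (h t @^-1` A `&` (fun w => [ffun j : 'I_m => C j w]) @^-1` [set cc]) =
    ((\prod_j p (cc j)) * fine (mu (cc j0) A))%:E.
  pose c j := if insub j is Some j' then cc j' else k0.
  have := hP t.+1 c E mE.
  rewrite (_ : [set w | _] = h t @^-1` A `&`
      (fun w => [ffun j : 'I_m => C j w]) @^-1` [set cc]); last first.
    apply/seteqP; split => w /=.
      move=> [h1 h2]; split.
        by have := h2 _ (ltnSn t); rewrite /E eqxx.
      apply/ffunP => j; rewrite ffunE.
      by have := h1 _ (ltn_ord j); rewrite /c valK.
    move=> [hA h1]; split => [j jn|s sn].
      by rewrite /c insubT /= -h1 ffunE.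
    by rewrite /E; case: eqP => [->|].
  move=> ->; rewrite EFinM; congr (_ * _)%E.
    by congr (_%:E); apply: eq_bigr => j _; rewrite /c valK.
  rewrite big_ord_recr/= big1 => [|s _]; last first.
    by rewrite /E ltn_eqF//= probability_setT.
  rewrite mul1e /E eqxx fineK ?fin_num_measure//.
  have tn := interval_index_lt tau0 (ltnSn t).
  congr (mu _ _); rewrite /c insubT /=; congr (cc _); exact: val_inj.
transitivity (\sum_(cc : {ffun 'I_m -> 'I_K}) ((\prod_j p (cc j)) * fine (mu (cc j0) A))%:E)%E.
  by apply: eq_bigr => cc _; exact: cell.
under [RHS]eq_bigr do rewrite -[mu _ A]fineK ?fin_num_measure// -EFinM.
rewrite !sumEFin; congr (_%:E).
(* With the factor of [j0] moved inside the product, the sum over label words distributes, and every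
   other label sums to 1. *)
have -> : \sum_(cc : {ffun 'I_m -> 'I_K}) (\prod_j p (cc j)) * fine (mu (cc j0) A) =
   \sum_(cc : {ffun 'I_m -> 'I_K}) \prod_j (p (cc j) * (if j == j0 then fine (mu (cc j) A) else 1)).
  apply: eq_bigr => cc _; rewrite big_split/=; congr (_ * _).
  rewrite (bigD1 j0)//= eqxx big1 ?mulr1// => j jj0.
  by rewrite (negbTE jj0).
rewrite -(bigA_distr_bigA (fun j c => p c * (if j == j0 then fine (mu c A) else 1))).
rewrite (bigD1 j0)//= eqxx [X in _ * X]big1 ?mulr1// => j jj0.
by rewrite (negbTE jj0) -[RHS]p1; apply: eq_bigr => c _; rewrite mulr1.
Qed.

Lemma source_vector_integral t (g : cvec R N -> \bar R) :
  measurable_fun setT g -> (forall v, (0 <= g v)%E) ->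
  (\int[P]_w g (h t w) = \sum_c (p c)%:E * \int[mu c]_v g v)%E.
Proof.
move=> mg g0; have mh := source_vector_measurable t.
pose k0 := Ordinal (pmf_index_gt0 p1).
have := @ge0_integral_pushforward _ _ _ _ _ (h t) mh P setT g measurableT mg.
rewrite preimage_setT => <-; last by move=> v _; exact: g0.
(* [msum] takes a family indexed by [nat], hence the default label [k0]. *)
pose m_ (i : nat) : {measure set (cvec R N) -> \bar R} :=
  mscale (NngNum (p0 (insubd k0 i))) (mu (insubd k0 i)).
rewrite (eq_measure_integral (msum m_ K)) => [|A mA _].
  rewrite ge0_integral_measure_sum//; apply: eq_bigr => c _.
  by rewrite /m_ valKd ge0_integral_mscale.
rewrite /= /pushforward source_vector_law// /msum/=.
by apply: eq_bigr => c _; rewrite valKd.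
Qed.

End source.

Lemma measurable_fun_fibers d d' (T : measurableType d) (T' : measurableType d')
    (I : finType) (k : T -> I) (F : I -> T') :
  measurable_fibers k -> measurable_fun setT (fun x => F (k x)).
Proof.
move=> mk _ Y mY; rewrite setTI.
exact: (measurable_fibers_preimage (F @^-1` Y) mk).
Qed.

(** * Expected distortion of quantized codes *)

Section expected_distortion.
Context {R : realType} {K N : nat} {d : measure_display} {Omega : measurableType d}.
Variables (tau : nat) (tau0 : (0 < tau)%N) (P : probability Omega R).
Variables (p : 'I_K -> R) (mu : 'I_K -> probability (cvec R N) R).
Variables (C : nat -> Omega -> 'I_K) (h : nat -> Omega -> cvec R N).
Hypothesis N0 : (0 < N)%N.
Hypothesis p0 : forall c, 0 <= p c.
Hypothesis p1 : \sum_c p c = 1.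
Hypothesis hsource : mixture_source tau P p mu C h.
Variables (A B : finType) (qa : cvec R N -> A) (rep : B -> cvec R N).
Variables (dist : A -> B -> R) (eta eg dmax : R) (g : cvec R N -> R).
Hypothesis mqa : measurable_fibers qa.
Hypothesis mg : measurable_fun setT g.
Hypothesis g0 : forall v, 0 <= g v.
Hypothesis hg : forall c, (\int[mu c]_v (g v)%:E <= eg%:E)%E.
Hypothesis eta0 : 0 <= eta.
Hypothesis dist0 : forall a b, 0 <= dist a b.
Hypothesis hdmax : forall a b, dist a b <= dmax.
Hypothesis hdist : forall v b, sqnorm (v - rep b) <= dist (qa v) b + eta + g v.

Lemma source_vector_integral_le t : (\int[P]_w (g (h t w))%:E <= eg%:E)%E.
Proof.
rewrite (source_vector_integral tau0 p0 p1 hsource t (g := EFin \o g)); last 2 first.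
- exact/measurable_EFinP.
- by move=> v; rewrite lee_fin.
apply: (@le_trans _ _ (\sum_c (p c)%:E * eg%:E)%E).
  by apply: lee_sum => c _; rewrite lee_wpmul2l ?lee_fin.
under eq_bigr do rewrite -EFinM.
by rewrite sumEFin -mulr_suml p1 mul1r.
Qed.

(** Good states cost [L] per vector and bad ones at most [dmax]; quantization adds [eta] and the
    tail [eg]. The integrand is dominated by a function of the finite state plus the tails, so the
    selection [y] may be an arbitrary function of the outcome. *)
Lemma expected_distortion_le n (y : Omega -> 'I_n -> B) (L e : R)
    (bad : {ffun 'I_(intervals tau n) -> 'I_K} * {ffun 'I_n -> A} -> bool) :
  (0 < n)%N -> 0 <= L -> 0 <= dmax ->
  (forall w, ~~ bad (source_state tau C h qa n w) ->
     \sum_(t < n) dist (qa (h t w)) (y w t) <= n%:R * L) ->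
  (P [set w | bad (source_state tau C h qa n w)] <= e%:E)%E ->
  ('E_P[fun w => block_distortion (source_block h n w) [tuple rep (y w t) | t < n]]
     <= (N%:R^-1 * (L + dmax * e + eta + eg))%:E)%E.
Proof.
move=> n0 L0 dm0 hy hbad.
have mZ := source_state_measurable hsource mqa (n := n).
set Z := source_state tau C h qa n in hy hbad mZ *.
have n0' : 0 < n%:R :> R by rewrite ltr0n.
have N0' : 0 < N%:R :> R by rewrite ltr0n.
pose F x : R := N%:R^-1 * (L + eta + dmax * (bad x)%:R).
have F0 x : 0 <= F x by rewrite mulr_ge0 ?invr_ge0// !addr_ge0// mulr_ge0.
pose k : R := (n%:R * N%:R)^-1.
have k0 : 0 <= k by rewrite invr_ge0 mulr_ge0.
rewrite unlock.
apply: (@le_trans _ _ (\int[P]_w ((F (Z w))%:E + \sum_(t < n) k%:E * (g (h t w))%:E))%E).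
  apply: ge0_le_integralT => w.
    rewrite lee_fin mulr_ge0// sumr_ge0// => t _; exact: sqnorm_ge0.
  under eq_bigr do rewrite -EFinM.
  rewrite sumEFin -EFinD lee_fin /block_distortion -/k.
  have -> : F (Z w) = k * (n%:R * (L + eta + dmax * (bad (Z w))%:R)).
    by rewrite /F /k; field; rewrite !gt_eqF.
  rewrite -mulr_sumr -mulrDr ler_wpM2l//.
  apply: (@le_trans _ _ (\sum_(t < n) (dist (qa (h t w)) (y w t) + eta + g (h t w)))).
    by apply: ler_sum => t _; rewrite !tnth_mktuple.
  rewrite !big_split/= lerD2r sumr_const card_ord -[eta *+ n]mulr_natl.
  rewrite addrAC mulrDr lerD2r.
  case: (boolP (bad (Z w))) => [_|/hy hL]; last by rewrite mulr0 addr0.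
  apply: (@le_trans _ _ (n%:R * dmax)).
    rewrite mulr_natl -[X in _ <= _ *+ X](card_ord n) -sumr_const.
    by apply: ler_sum => t _.
  by rewrite ler_wpM2l ?ler0n// mulr1 lerDr.
have mgt t : measurable_fun setT (fun w => (g (h t w))%:E).
  apply/measurable_EFinP.
  exact: (measurableT_comp mg (source_vector_measurable hsource t)).
rewrite ge0_integralD//; last 4 first.
- by move=> w _; rewrite lee_fin.
- by apply/measurable_EFinP; exact: measurable_fun_fibers.
- by move=> w _; apply: sume_ge0 => t _; rewrite -EFinM lee_fin mulr_ge0.
- by apply: emeasurable_sum => t; apply: emeasurable_funM.
rewrite (integral_fibers mZ)//.
rewrite ge0_integral_sum//; last 2 first.
- by move=> t; apply: emeasurable_funM.
- by move=> t w _; rewrite -EFinM lee_fin mulr_ge0.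
have -> : N%:R^-1 * (L + dmax * e + eta + eg) =
   N%:R^-1 * (L + eta + dmax * e) + N%:R^-1 * eg by ring.
rewrite EFinD; apply: leeD.
  rewrite (probability_fibers mZ) lee_fin in hbad.
  rewrite lee_fin; under eq_bigr do rewrite /F mulrCA mulrDr mulrCA.
  rewrite -mulr_sumr ler_wpM2l ?invr_ge0// big_split/= -mulr_suml -mulr_sumr.
  rewrite lerD ?ler_wpM2l//.
  have := probability_fibers mZ P (fun=> true).
  under eq_bigr do rewrite mulr1.
  rewrite (_ : [set w | true] = setT) ?probability_setT; last exact/seteqP.
  by move=> [<-]; rewrite mul1r.
apply: (@le_trans _ _ (\sum_(t < n) (k * eg)%:E)%E).
  apply: lee_sum => t _; rewrite ge0_integralZl_EFin//; last by move=> w _; rewrite lee_fin.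
  by rewrite EFinM lee_wpmul2l ?lee_fin//; exact: source_vector_integral_le.
rewrite sumEFin lee_fin sumr_const card_ord -mulr_natl /k.
by rewrite le_eqVlt; apply/orP; left; apply/eqP; field; rewrite !gt_eqF.
Qed.

End expected_distortion.

(** * Near-optimal test channels *)

Section near_optimal.
Context {R : realType} {K N : nat}.
Hypothesis N0 : (0 < N)%N.

Lemma joint_law_marginal (nu : probability (cvec R N) R)
    (k : R.-pker (cvec R N) ~> (cvec R N))
    (Q : probability (cvec R N * cvec R N)%type R) (A : set (cvec R N)) :
  joint_law nu k Q -> measurable A -> Q (A `*` setT) = nu A.
Proof.
move=> kQ mA; rewrite kQ; last exact: measurableX.
rewrite -[X in _ = nu X]setIT -(@integral_indic _ _ _ nu setT measurableT _ mA).
apply: eq_integral => x _; rewrite indicE.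
case: (boolP (x \in A)) => xA; first by rewrite in_xsectionX// prob_kernel.
by rewrite notin_xsectionX// measure0.
Qed.

Lemma rate_distortion_ge0 (nu : probability (cvec R N) R) (D : R) :
  (0 <= rate_distortion nu D)%E.
Proof.
rewrite /rate_distortion mule_ge0 ?lee_fin ?invr_ge0//.
by apply: le_ereal_inf_tmp => _ [Q _ <-]; exact: mutual_information_ge0.
Qed.

Variables (p : 'I_K -> R) (mu : 'I_K -> probability (cvec R N) R).
Hypothesis p_gt0 : forall c, 0 < p c.
Hypothesis p1 : \sum_c p c = 1.

(** The strict inequality leaves a gap; half of it, added to the rate of every component, makes each
    infimum strictly exceeded, so that a channel below it exists. *)
Lemma rate_cond_near_optimal (D x : R) : (rate_cond p mu D < x%:E)%E ->
  exists (Q : 'I_K -> probability (cvec R N * cvec R N)%type R) (i Dc : 'I_K -> R),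
  [/\ forall c, exists k : R.-pker (cvec R N) ~> (cvec R N), joint_law (mu c) k (Q c),
     forall c, (mutual_information (Q c) <= (i c)%:E)%E, \sum_c p c * i c < N%:R * x,
     forall c, (\int[Q c]_z (sqnorm (z.1 - z.2))%:E <= (N%:R * Dc c)%:E)%E &
     (forall c, 0 <= Dc c) /\ \sum_c p c * Dc c <= D].
Proof.
move=> /ereal_inf_lt[_ [Dc [Dc0 DcD] <-] lex].
pose rd c := rate_distortion (mu c) (Dc c).
have rd0 c : (0 <= rd c)%E by exact: rate_distortion_ge0.
(* As [p c > 0], a finite weighted sum forces every term to be finite. *)
have prd0 c : (0 <= (p c)%:E * rd c)%E by rewrite mule_ge0// lee_fin ltW.
have rdfin c : rd c \is a fin_num.
  rewrite ge0_fin_numE//.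
  have : ((p c)%:E * rd c < +oo)%E.
    apply: (le_lt_trans _ (lt_trans lex (ltry x))).
    rewrite (bigD1 c)//= leeDl//; apply: sume_ge0 => c' _; exact: prd0.
  apply: contraTT; rewrite -!leNgt !leye_eq => /eqP ->.
  by rewrite gt0_muley ?lte_fin.
pose v c := fine (rd c).
have vx : \sum_c p c * v c < x.
  rewrite -lte_fin -sumEFin; apply: le_lt_trans lex.
  by apply: lee_sum => c _; rewrite EFinM fineK.
pose del := (x - \sum_c p c * v c) / 2.
have del0 : 0 < del by rewrite divr_gt0// subr_gt0.
have N0' : 0 < N%:R :> R by rewrite ltr0n.
have ex c : exists Q : probability (cvec R N * cvec R N)%type R,
   [/\ exists k : R.-pker (cvec R N) ~> (cvec R N), joint_law (mu c) k Q,
     (mutual_information Q <= (N%:R * (v c + del))%:E)%E &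
     (\int[Q]_z (sqnorm (z.1 - z.2))%:E <= (N%:R * Dc c)%:E)%E].
  have : (rd c < (v c + del)%:E)%E.
    by rewrite -[rd c]fineK// lte_fin ltrDl.
  rewrite /rd /rate_distortion lte_pdivrMl// -EFinM.
  move=> /ereal_inf_lt[_ [Q [kQ dQ] <-] hQ]; exists Q; split => //.
    exact: ltW.
  by move: dQ; rewrite lee_pdivrMl// -EFinM.
have [Q hQ] := choice ex.
exists Q, (fun c => N%:R * (v c + del)), Dc; split => //.
- by move=> c; have [] := hQ c.
- by move=> c; have [] := hQ c.
- under eq_bigr do rewrite mulrCA mulrDr.
  rewrite -mulr_sumr ltr_pM2l// big_split/= -mulr_suml p1 mul1r.
  by rewrite /del; lra.
- by move=> c; have [] := hQ c.
Qed.

End near_optimal.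

Section quantized_codes.
Context {R : realType} {K N : nat} (tau n M : nat).
Context {A : finType} (qa : cvec R N -> A).
Hypothesis mqa : measurable_fibers qa.

Lemma measurable_quantized_tuple :
  measurable_fibers (fun v : n.-tuple (cvec R N) => [ffun t => qa (tnth v t)]).
Proof.
apply: measurable_fibers_ffun => t a; rewrite -[X in measurable X]setTI.
exact: (measurable_tnth t measurableT (mqa a)).
Qed.

(** The encoder sees the block only through [qa], so every selection rule [sel] is measurable. *)
Definition quantized_code (sel : {ffun 'I_n -> A} -> 'I_M)
    (y : 'I_M -> n.-tuple (cvec R N)) : @Defs.code R N n M :=
  @Code R N n M (fun v => sel [ffun t => qa (tnth v t)]) y
    (measurable_fibers_comp sel measurable_quantized_tuple).

Definition quantized_label_code
    (sel : (intervals tau n).-tuple 'I_K -> {ffun 'I_n -> A} -> 'I_M)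
    (y : 'I_M -> n.-tuple (cvec R N))
    (l : 'I_M -> (intervals tau n).-tuple 'I_K) : @label_code R K N tau n M :=
  @LabelCode R K N tau n M (fun c v => sel c [ffun t => qa (tnth v t)]) y l
    (fun c => measurable_fibers_comp (sel c) measurable_quantized_tuple).

End quantized_codes.

Section numeric_bounds.
Context {R : realType}.

(** Rounding to an integer loses at most 1, while [expR (n gap) >= 2]: with
    [E = expR (n (G0 - gap)) >= 1], one has [M > 2 E - 1 >= E]. *)
Lemma codebook_size_le (n M : nat) (G0 gap : R) : 0 <= G0 - gap ->
  1 <= n%:R * gap -> expR (n%:R * G0) < M.+1%:R ->
  expR (n%:R * (G0 - gap)) <= M%:R.
Proof.
move=> Gg ngap.
have -> : n%:R * G0 = n%:R * (G0 - gap) + n%:R * gap by ring.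
rewrite expRD -natr1 => nM.
have E1 : 1 <= expR (n%:R * (G0 - gap)) by rewrite -expR0 ler_expR mulr_ge0.
have E2 : 2 <= expR (n%:R * gap) by apply: le_trans (expR_ge1Dx _); lra.
by have := ler_wpM2l (expR_ge0 (n%:R * (G0 - gap))) E2; lra.
Qed.

(** [(1 + eta)^2 <= 1 + 3 eta], and the additive multiples of [eta] total 132, for which 133 leaves
    room. *)
Lemma distortion_slack (N : nat) (D Dl dmax eta e1 e : R) : (0 < N)%N ->
  0 <= D -> 0 < eta -> eta <= 1 -> 0 < e ->
  Dl <= (1 + eta) ^+ 2 * (N%:R * D) + eta ->
  eta * (3 * D + 133) <= e / 2 -> e1 * (1 + dmax) <= e / 2 ->
  N%:R^-1 * (Dl + e1 + dmax * e1 + eta + 130 * eta) <= D + e.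
Proof.
move=> N0 D0 eta0 eta1 e0 Dle h1 h2.
have N1 : 1 <= N%:R :> R by rewrite ler1n.
have N0' : 0 < N%:R :> R by rewrite ltr0n.
rewrite mulrC ler_pdivrMr//.
have h3 : eta ^+ 2 * (N%:R * D) <= eta * (N%:R * D).
  by rewrite ler_wpM2r ?mulr_ge0// expr2 ger_pMl.
have h4 : eta * (3 * D + 133) * N%:R <= e / 2 * N%:R.
  by rewrite ler_wpM2r// ltW.
have h5 : e1 * (1 + dmax) * 1 <= e / 2 * N%:R.
  rewrite mulr1; apply: le_trans h2 _; rewrite ler_peMr// ltW// divr_gt0//.
have h6 : eta * 1 <= eta * N%:R by rewrite ler_wpM2l// ltW.
by move: Dle h4 h5; rewrite sqrrD; lra.
Qed.

End numeric_bounds.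

Section cell_distortion.
Context {R : realType} {N : nat} (Q : probability (cvec R N * cvec R N)%type R).
Context {A B : finType} (qa : cvec R N -> A) (qb : cvec R N -> B).
Hypotheses (mqa : measurable_fibers qa) (mqb : measurable_fibers qb).

Lemma cell_distortion_le (dist : A -> B -> R) (eta v : R) :
  (forall a b, 0 <= dist a b) -> 0 <= eta ->
  (forall h y, dist (qa h) (qb y) <= (1 + eta) ^+ 2 * sqnorm (h - y) + eta) ->
  (\int[Q]_z (sqnorm (z.1 - z.2))%:E <= v%:E)%E ->
  \sum_z cell_prob Q qa qb z * dist z.1 z.2 <= (1 + eta) ^+ 2 * v + eta.
Proof.
move=> dist0 eta0 hdist hv.
have mk : measurable_fibers (fun z : cvec R N * cvec R N => (qa z.1, qb z.2)).
  move=> [a b]; rewrite (_ : _ @^-1` _ = (qa @^-1` [set a]) `*` (qb @^-1` [set b])).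
    exact: measurableX.
  by apply/seteqP; split => -[u w] /=; [case=> -> ->|case=> -> ->].
have := integral_fibers mk Q (F := fun z => dist z.1 z.2) (fun z => dist0 _ _).
rewrite (eq_bigr (fun z => cell_prob Q qa qb z * dist z.1 z.2)); last first.
  move=> [a b] _; congr (fine (Q _) * _).
  by apply/seteqP; split => -[u w] /=; [case=> -> ->|case=> -> ->].
move=> WE; rewrite -lee_fin -WE /=.
have msq : measurable_fun setT (fun z : cvec R N * cvec R N => (sqnorm (z.1 - z.2))%:E).
  by apply/measurable_EFinP; apply: measurable_sqnormB.
apply: (@le_trans _ _ (\int[Q]_z (((1 + eta) ^+ 2)%:E * (sqnorm (z.1 - z.2))%:E + eta%:E))%E).
  apply: ge0_le_integralT => z; first by rewrite lee_fin.
  by rewrite -EFinM -EFinD lee_fin.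
rewrite ge0_integralD//; last 2 first.
- by move=> z _; rewrite -EFinM lee_fin mulr_ge0 ?sqr_ge0 ?sqnorm_ge0.
- by apply: emeasurable_funM.
rewrite ge0_integralZl_EFin ?sqr_ge0//; last first.
  by move=> z _; rewrite lee_fin sqnorm_ge0.
have -> : (\int[Q]_z (cst eta%:E z) = eta%:E)%E.
  by rewrite integral_cst// [X in (_ * X)%E]probability_setT mule1.
rewrite EFinD leeD//.
by rewrite [leRHS]EFinM; apply: lee_wpmul2l; [rewrite lee_fin sqr_ge0|exact: hv].
Qed.

End cell_distortion.

Section gaussian_quantization.
Context {R : realType} {K N : nat}.
Variables (Sigma : 'I_K -> 'M[R[i]]_N) (mu : 'I_K -> probability (cvec R N) R).
Hypothesis hmu : forall c, proper_gaussian (Sigma c) (mu c).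

Let gaussians_tail (e : R) : 0 < e -> exists2 s : R, 0 < s &
  forall c, (\int[mu c]_v (sqnorm v * (s < sqnorm v)%R%:R)%:E <= e%:E)%E.
Proof.
move=> e0; have /choice[s0 hs0] := fun c => gaussian_tail (hmu c) e0.
exists (1 + \sum_c `|s0 c|).
  by rewrite ltr_pwDl// sumr_ge0.
move=> c; apply: hs0; rewrite (le_trans (ler_norm _))// (bigD1 c)//=.
have : 0 <= \sum_(i < K | i != c) `|s0 i| by exact: sumr_ge0.
lra.
Qed.

Let measurable_tail (s : R) :
  measurable_fun [set: cvec R N] (fun v => sqnorm v * (s < sqnorm v)%R%:R).
Proof.
apply: measurable_funM; first exact: measurable_sqnorm.
apply: (@measurable_comp _ _ _ _ _ _ setT (fun b : bool => b%:R : R)) => //.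
by apply: measurable_fun_ltr => //; exact: measurable_sqnorm.
Qed.

(** One radius serves all of the finitely many components; [g] is the quadratic tail beyond it. *)
Lemma gaussian_quantization (eta : R) : 0 < eta ->
  exists (A B : finType) (qa : cvec R N -> A) (qb : cvec R N -> B) (rep : B -> cvec R N)
    (dist : A -> B -> R) (dmax : R) (g : cvec R N -> R),
  [/\ measurable_fibers qa /\ measurable_fibers qb,
    (forall a b, 0 <= dist a b) /\ (forall a b, dist a b <= dmax),
    [/\ measurable_fun setT g, forall v, 0 <= g v &
      forall c, (\int[mu c]_v (g v)%:E <= (130 * eta)%:E)%E],
    forall v b, sqnorm (v - rep b) <= dist (qa v) b + eta + g v &
    forall h y, dist (qa h) (qb y) <= (1 + eta) ^+ 2 * sqnorm (h - y) + eta].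
Proof.
move=> eta0; have [s s0 hs] := gaussians_tail eta0.
have [A [B [qa [qb [rep [dist [mqa mqb dist0 hdist1 hdist2]]]]]]] :=
  @quantization R N s eta s0 eta0.
have [dmax _ hdmax] := finite_bound (fun z : A * B => dist z.1 z.2).
exists A, B, qa, qb, rep, dist, dmax, (fun v => 130 * (sqnorm v * (s < sqnorm v)%R%:R)).
split => //; split => //.
- by move=> a b; rewrite (le_trans (ler_norm _) (hdmax (a, b))).
- by apply: measurable_funM => //; exact: measurable_tail.
- by move=> v; rewrite !mulr_ge0// sqnorm_ge0.
move=> c; under eq_integral do rewrite EFinM.
rewrite ge0_integralZl_EFin//.
- by rewrite EFinM; apply: lee_wpmul2l; [rewrite lee_fin|exact: hs].
- by move=> v _; rewrite lee_fin mulr_ge0// sqnorm_ge0.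
- by apply/measurable_EFinP; exact: measurable_tail.
Qed.

End gaussian_quantization.

(** * Codes at every rate above the target *)

Section codes.
Context {R : realType} {K N : nat} {d : measure_display} {Omega : measurableType d}.
Variables (tau : nat) (tau0 : (0 < tau)%N) (P : probability Omega R).
Variables (p : 'I_K -> R) (mu : 'I_K -> probability (cvec R N) R).
Variables (Sigma : 'I_K -> 'M[R[i]]_N).
Variables (C : nat -> Omega -> 'I_K) (h : nat -> Omega -> cvec R N).
Hypothesis N0 : (0 < N)%N.
Hypothesis p_gt0 : forall c, 0 < p c.
Hypothesis p1 : \sum_c p c = 1.
Hypothesis hmu : forall c, proper_gaussian (Sigma c) (mu c).
Hypothesis hsource : mixture_source tau P p mu C h.

Lemma entropy2_ge0 : 0 <= entropy2 p.
Proof.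
rewrite /entropy2 -sumrN sumr_ge0// => c _; rewrite -mulrN mulr_ge0 ?(ltW (p_gt0 c))//.
rewrite /log2 -mulNr divr_ge0 ?ln_ge0 ?ler1n// oppr_ge0 ln_le0//.
by rewrite -p1 (bigD1 c)//= lerDl sumr_ge0// => i _; exact: ltW.
Qed.

(** [M] is only bounded below through the rate, so that an index set sized for a longer block can be
    used. Both codes come from the same codebook. *)
Lemma codes_exist (D r e : R) : (rate_gmtc tau p mu D < r%:E)%E -> 0 < e ->
  exists n0 : nat, forall n M, (n0 <= n)%N ->
    2 `^ (n%:R * N%:R * r) < M.+1%:R ->
  (exists f : @label_code R K N tau n M,
     let index w := lencode f (label_block tau C n w) (source_block h n w) in
     (P [set w | ldecode_label f (index w) <> label_block tau C n w] <= e%:E)%E /\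
     ('E_P[fun w => block_distortion (source_block h n w) (ldecode f (index w))]
       <= (D + e)%:E)%E) /\
  (exists f : @Defs.code R N n M,
     ('E_P[fun w => block_distortion (source_block h n w)
         (Defs.decode f (Defs.encode f (source_block h n w)))] <= (D + e)%:E)%E).
Proof.
move=> rr e0.
have p0 c : 0 <= p c by exact: ltW.
have N0' : 0 < N%:R :> R by rewrite ltr0n.
have tau0' : 0 < tau%:R :> R by rewrite ltr0n.
have ln2 : 0 < ln 2 :> R by rewrite ln_gt0// ltr1n.
(* Rate left for the vectors once the labels are paid for. *)
pose x := r - entropy2 p / (tau%:R * N%:R).
have rx : (rate_cond p mu D < x%:E)%E.
  by move: rr; rewrite /rate_gmtc -lteBrDr.
have [Q [i [Dc [kQ MIi pix sqDc [Dc0 DcD]]]]] := rate_cond_near_optimal N0 p_gt0 p1 rx.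
have i0 c : 0 <= i c.
  by rewrite -lee_fin; exact: le_trans (mutual_information_ge0 _) (MIi c).
have D0 : 0 <= D by apply: le_trans DcD; apply: sumr_ge0 => c _; rewrite mulr_ge0.
pose H : R := \sum_k p k * - ln (p k).
have HE : ln 2 * (N%:R * (entropy2 p / (tau%:R * N%:R))) = H / tau%:R.
  rewrite /H /entropy2 /log2.
  have -> : \sum_c p c * (ln (p c) / ln 2) = (\sum_c p c * ln (p c)) / ln 2.
    by rewrite mulr_suml; apply: eq_bigr => c _; rewrite mulrA.
  have -> : \sum_k p k * - ln (p k) = - \sum_k p k * ln (p k).
    by rewrite -sumrN; apply: eq_bigr => k _; rewrite mulrN.
  by field; rewrite !gt_eqF.
have ent0 : 0 <= entropy2 p / (tau%:R * N%:R) by rewrite divr_ge0 ?entropy2_ge0// mulr_ge0.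
have x0 : 0 < x.
  rewrite -(pmulr_rgt0 _ N0'); apply: le_lt_trans pix.
  by apply: sumr_ge0 => c _; rewrite mulr_ge0.
have r0 : 0 < r by rewrite /x in x0; lra.
pose G0 := N%:R * r * ln 2.
have G00 : 0 < G0 by rewrite !mulr_gt0.
(* Rate slack in nats per vector. One half pays for the excess [e1] in [finite_coding], the other,
   through [gap2], for rounding the size of the index set. *)
pose gap := ln 2 * (N%:R * x - \sum_c p c * i c).
have gap0 : 0 < gap by rewrite mulr_gt0// subr_gt0.
pose gap2 := Num.min (gap / 2) G0.
have gap20 : 0 < gap2 by rewrite lt_min G00 andbT divr_gt0.
pose eta := Num.min 1 (e / 2 / (3 * D + 133)).
have D3 : 0 < 3 * D + 133 by lra.
have eta0 : 0 < eta by rewrite lt_min ltr01 !divr_gt0.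
have eta1 : eta <= 1 by rewrite ge_min lexx.
have etae : eta * (3 * D + 133) <= e / 2.
  by rewrite -ler_pdivlMr// ge_min lexx orbT.
have [A [B [qa [qb [rep [dist [dmax [g]]]]]]]] := gaussian_quantization hmu eta0.
case=> -[mqa mqb] [dist0 hdmax] [mg g0 hg] hdist1 hdist2.
have dmax0 : 0 <= dmax by apply: le_trans (dist0 (qa 0) (qb 0)) (hdmax _ _).
pose e1 := Num.min (e / 2 / (1 + dmax)) (gap / 2).
have e10 : 0 < e1 by rewrite lt_min !divr_gt0// ltr_pwDl.
have e1gap : e1 <= gap / 2 by rewrite ge_min lexx orbT.
have e1e : e1 * (1 + dmax) <= e / 2.
  by rewrite -ler_pdivlMr ?ltr_pwDl// ge_min lexx.
have e1le : e1 <= e by have := mulr_ge0 (ltW e10) dmax0; lra.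
pose W c := cell_prob (Q c) qa qb.
have W0 c z : 0 <= W c z by exact: cell_prob_ge0.
have W1 c : \sum_z W c z = 1 by exact: sum_cell_prob.
(* Every coupling has the component law as first marginal, so the finite source built from the test
   channels is the quantized true source. *)
have margE c a : marginal1 W c a = cell_law mu qa c a.
  have -> : marginal1 W c a = cell_marginal1 (Q c) qa qb a by [].
  rewrite cell_marginal1E//; have [k hk] := kQ c.
  by rewrite (joint_law_marginal hk).
pose I : R := \sum_k p k * \sum_z W k z * information W k z.
have Ile : I <= ln 2 * \sum_c p c * i c.
  rewrite mulr_sumr; apply: ler_sum => c _; rewrite mulrCA ler_wpM2l//.
  have := le_trans (mutual_information_cells (Q c) mqa mqb) (MIi c).
  by rewrite lee_fin mulrC ler_pdivrMr// mulrC.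
pose Dl : R := \sum_k p k * (\sum_z W k z * dist z.1 z.2).
have Dl0 : 0 <= Dl.
  by apply: sumr_ge0 => c _; rewrite mulr_ge0// sumr_ge0// => z _; rewrite mulr_ge0.
have Dle : Dl <= (1 + eta) ^+ 2 * (N%:R * D) + eta.
  have Wd c : \sum_z W c z * dist z.1 z.2 <= (1 + eta) ^+ 2 * (N%:R * Dc c) + eta.
    by apply: cell_distortion_le => //; exact: ltW.
  apply: (@le_trans _ _ (\sum_c (p c * ((1 + eta) ^+ 2 * (N%:R * Dc c) + eta)))).
    by apply: ler_sum => c _; rewrite ler_wpM2l.
  rewrite (eq_bigr (fun c => (1 + eta) ^+ 2 * N%:R * (p c * Dc c) + p c * eta)); last first.
    by move=> c _; ring.
  rewrite big_split/= -mulr_sumr -mulr_suml p1 mul1r lerD2r mulrA.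
  by rewrite ler_wpM2l// mulr_ge0 ?sqr_ge0.
have [n1 hn1] := @finite_coding R 'I_K A B p W p_gt0 p1 W0 W1 dist tau e1 tau0 e10.
exists (n1 + 1 + (Num.truncn gap2^-1).+1)%N => n M nn nM.
have n0 : (0 < n)%N by apply: leq_trans nn; rewrite addnS.
have n10 : (n1 <= n)%N by apply: leq_trans nn; rewrite -addnA leq_addr.
have ngap : 1 <= n%:R * gap2.
  rewrite -ler_pdivrMr// mul1r (le_trans (ltW (truncnS_gt _)))// ler_nat.
  exact: leq_trans (leq_addl _ _) nn.
have expM : expR (n%:R * (I + H / tau%:R + e1)) <= M%:R.
  have nM' : expR (n%:R * G0) < M.+1%:R.
    rewrite (_ : expR _ = 2 `^ (n%:R * N%:R * r))// /powR pnatr_eq0/=.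
    by congr expR; rewrite /G0; ring.
  apply: le_trans (codebook_size_le _ ngap nM'); last first.
    by rewrite subr_ge0 ge_min lexx orbT.
  rewrite ler_expR ler_wpM2l// lerBrDr.
  have -> : G0 = ln 2 * (N%:R * x) + H / tau%:R by rewrite -HE /x /G0; ring.
  rewrite (_ : I + _ + _ + _ = I + (e1 + gap2) + H / tau%:R); last by ring.
  rewrite lerD2r; apply: (@le_trans _ _ (ln 2 * (\sum_c p c * i c) + gap)).
    rewrite lerD// [leRHS]splitr lerD//.
    by rewrite ge_min lexx.
  by rewrite /gap mulrBr addrC subrK.
have [f hf] := hn1 _ _ (@interval_index tau n tau0) M n10 (intervals_le _ tau0)
  (intervals_mul _ tau0) (card_interval tau0) expM.
have M0 : (0 < M)%N.
  by rewrite -(ltr_nat R); apply: lt_le_trans expM; exact: expR_gt0.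
pose j0 := Ordinal M0.
pose L := Dl + e1.
have L0 : 0 <= L by rewrite addr_ge0// ltW.
pose good (x : {ffun 'I_(intervals tau n) -> 'I_K} * {ffun 'I_n -> A}) (j : 'I_M) :=
  ((f j).1 == x.1) && (\sum_t dist (x.2 t) ((f j).2 t) <= n%:R * L).
pose bad x := ~~ [exists j, good x j].
have mZ := source_state_measurable hsource mqa (n := n).
have Pbad : (P [set w | bad (source_state tau C h qa n w)] <= e1%:E)%E.
  rewrite (probability_fibers mZ) lee_fin; apply: le_trans hf.
  rewrite sum_pair; apply: ler_sum => c _; apply: ler_sum => a _.
  rewrite (source_state_law tau0 p1 hsource _ mqa)/= le_eqVlt; apply/orP; left.
  apply/eqP; congr (_ * _ * _); apply: eq_bigr => t _.
  by rewrite margE.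
have final : N%:R^-1 * (L + dmax * e1 + eta + 130 * eta) <= D + e.
  exact: distortion_slack.
have distE (sel : Omega -> 'I_M) :
    (forall w, ~~ bad (source_state tau C h qa n w) ->
       \sum_(t < n) dist (qa (h t w)) ((f (sel w)).2 t) <= n%:R * L) ->
    ('E_P[fun w => block_distortion (source_block h n w)
         [tuple rep ((f (sel w)).2 t) | t < n]] <= (D + e)%:E)%E.
  move=> hsel.
  apply: le_trans (expected_distortion_le tau0 N0 p0 p1 hsource mqa mg g0 hg
     (ltW eta0) hdmax hdist1 (y := fun w t => (f (sel w)).2 t) n0 L0 dmax0 hsel Pbad) _.
  by rewrite lee_fin.
pose y j := [tuple rep ((f j).2 t) | t < n].
have stE w : [ffun t => qa (tnth (source_block h n w) t)] = (source_state tau C h qa n w).2.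
  by apply/ffunP => t; rewrite !ffunE tnth_mktuple.
have stE1 w : [ffun j => tnth (label_block tau C n w) j] = (source_state tau C h qa n w).1.
  by apply/ffunP => t; rewrite !ffunE tnth_mktuple.
split.
  pose sel (c : (intervals tau n).-tuple 'I_K) (a : {ffun 'I_n -> A}) :=
    odflt j0 [pick j | good ([ffun j' => tnth c j'], a) j].
  exists (quantized_label_code mqa sel y (fun j => [tuple (f j).1 j' | j' < intervals tau n])).
  have selP w : ~~ bad (source_state tau C h qa n w) ->
      good (source_state tau C h qa n w) (sel (label_block tau C n w)
        [ffun t => qa (tnth (source_block h n w) t)]).
    rewrite negbK /sel stE1 stE -surjective_pairing => /existsP[j hj].
    by case: pickP => [//|/(_ j)]; rewrite hj.
  split.
    apply: (@le_trans _ _ (P [set w | bad (source_state tau C h qa n w)])).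
      pose lab (c : {ffun 'I_(intervals tau n) -> 'I_K}) :=
        [tuple c j | j < intervals tau n].
      have lbE w : label_block tau C n w = lab (source_state tau C h qa n w).1.
        by apply: eq_from_tnth => j; rewrite !tnth_mktuple ffunE.
      apply: le_measure; rewrite ?inE; last 1 first.
      - move=> w /=; apply: contra_notT => /selP /andP[/eqP fsel _].
        by rewrite fsel lbE.
      - rewrite (_ : [set w | _] = source_state tau C h qa n @^-1`
            [set x | lab (f (sel (lab x.1) x.2)).1 <> lab x.1]).
          exact: measurable_fibers_preimage.
        by apply/funext => w /=; rewrite stE -lbE.
      exact: (measurable_fibers_preimage [set x | bad x] mZ).
    by apply: (le_trans Pbad); rewrite lee_fin.
  apply: distE => w /selP /andP[_]; rewrite -!stE.
  by under eq_bigr do rewrite ffunE tnth_mktuple.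
(* The chosen codeword may carry wrong labels. Whenever some codeword covers the true pair, one
   within the distortion threshold exists. *)
pose sel (a : {ffun 'I_n -> A}) :=
  odflt j0 [pick j | \sum_t dist (a t) ((f j).2 t) <= n%:R * L].
exists (quantized_code mqa sel y).
apply: distE => w; rewrite negbK => /existsP[j /andP[_ hj]].
rewrite /= /sel stE; case: pickP => [j' /=|/(_ j)]; last by rewrite hj.
by under eq_bigr do rewrite ffunE.
Qed.

End codes.

(** * Limits along the blocklength *)

Section asymptotics.
Context {R : realType}.

Lemma limn_esup_le (u : nat -> \bar R) (D : R) :
  (forall e : R, 0 < e -> exists n0 : nat, forall n, (n0 <= n)%N -> (u n <= (D + e)%:E)%E) ->
  (limn_esup u <= D%:E)%E.
Proof.
move=> h; apply/lee_addgt0Pr => e e0; have [n0 hn0] := h e e0.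
apply: (@le_trans _ _ (ereal_sup (u @` [set n | (n0 <= n)%N]))).
  by apply: ereal_inf_lbound; exists [set n | (n0 <= n)%N] => //; exists n0.
by apply: ge_ereal_sup => _ [n /= nn <-]; exact: hn0.
Qed.

(** Each accuracy is reached from some blocklength on, but a single sequence must serve all
    accuracies. At [n] the best accuracy [1 / (k + 1)] with [k <= n] that can be attained is chosen;
    [inhabited] covers the lengths at which none is. *)
Lemma diagonal (F : nat -> Type) (ok : forall n, F n -> R -> Prop) :
  (forall n, inhabited (F n)) ->
  (forall n f e e', e <= e' -> ok n f e -> ok n f e') ->
  (forall e, 0 < e -> exists n0 : nat, forall n, (n0 <= n)%N -> exists f, ok n f e) ->
  exists f : forall n, F n, forall e, 0 < e -> exists n0 : nat,
    forall n, (n0 <= n)%N -> ok n (f n) e.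
Proof.
move=> inh mono ex.
pose ek (k : nat) : R := k.+1%:R^-1.
pose good n k := exists f, ok n f (ek k).
have best n : exists f : F n, forall k, (k <= n)%N -> good n k -> ok n f (ek k).
  have [[k1 /andP[k1n /asboolP gk1]]|nok] := pselect (exists k, (k <= n)%N && `[< good n k >]).
    have bnd k : (k <= n)%N && `[< good n k >] -> (k <= n)%N by case/andP.
    have exk : exists k, (k <= n)%N && `[< good n k >].
      by exists k1; rewrite k1n; apply/asboolP.
    have [k /andP[kn /asboolP[f hf]] kmax] := ex_maxnP exk bnd.
    exists f => k' k'n gk'; apply: mono hf.
    rewrite lef_pV2 ?posrE ?ltr0n// ler_nat ltnS; apply: kmax.
    by rewrite k'n; apply/asboolP.
  have [f] := inh n; exists f => k kn gk; exfalso; apply: nok; exists k.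
  by rewrite kn; apply/asboolP.
exists (fun n => sval (cid (best n))) => e e0.
pose k := Num.truncn e^-1.
have eke : ek k <= e.
  rewrite -[leRHS]invrK lef_pV2 ?posrE ?invr_gt0 ?ltr0n//.
  by rewrite ltW// truncnS_gt.
have ek0 : 0 < ek k by rewrite invr_gt0 ltr0n.
have [n0 hn0] := ex _ ek0.
exists (maxn n0 k) => n; rewrite geq_max => /andP[n0n kn].
by apply: mono eke _; case: cid => f /= hf; apply: hf => //; exact: hn0.
Qed.

Lemma index_count_lt (r : R) (n N : nat) :
  2 `^ (n%:R * N%:R * r) < (@index_count R N r n).+1%:R.
Proof. exact: truncnS_gt. Qed.

Lemma index_count_gt0 (r : R) (n N : nat) : 0 <= r -> (0 < @index_count R N r n)%N.
Proof.
move=> r0; rewrite /index_count truncn_gt0.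
rewrite -[leLHS](powRr0 2) ler_powR ?ler1n//.
by rewrite !mulr_ge0.
Qed.

End asymptotics.

Section achievability.
Context {R : realType} {K N : nat} {d : measure_display} {Omega : measurableType d}.
Variables (tau : nat) (tau0 : (0 < tau)%N) (P : probability Omega R).
Variables (p : 'I_K -> R) (mu : 'I_K -> probability (cvec R N) R).
Variables (Sigma : 'I_K -> 'M[R[i]]_N).
Variables (C : nat -> Omega -> 'I_K) (h : nat -> Omega -> cvec R N).
Hypothesis N0 : (0 < N)%N.
Hypothesis p_gt0 : forall c, 0 < p c.
Hypothesis p1 : \sum_c p c = 1.
Hypothesis hmu : forall c, proper_gaussian (Sigma c) (mu c).
Hypothesis hsource : mixture_source tau P p mu C h.

Lemma rate_cond_ge0 (D : R) : (0 <= rate_cond p mu D)%E.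
Proof.
apply: le_ereal_inf_tmp => _ [Dc _ <-]; apply: sume_ge0 => c _.
by rewrite mule_ge0 ?rate_distortion_ge0// lee_fin ltW.
Qed.

Lemma rate_gmtc_ge0 (D : R) : (0 <= rate_gmtc tau p mu D)%E.
Proof.
rewrite /rate_gmtc adde_ge0 ?rate_cond_ge0// lee_fin divr_ge0 ?mulr_ge0//.
exact: entropy2_ge0.
Qed.

Lemma achievable_with_labels_gt (D r : R) : (rate_gmtc tau p mu D < r%:E)%E ->
  achievable_with_labels tau P C h r D.
Proof.
move=> hr; have r0 : 0 < r by rewrite -lte_fin (le_lt_trans (rate_gmtc_ge0 D)).
pose err n (f : @label_code R K N tau n (@index_count R N r n)) :=
  P [set w | ldecode_label f (lencode f (label_block tau C n w) (source_block h n w))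
     <> label_block tau C n w].
pose dis n (f : @label_code R K N tau n (@index_count R N r n)) :=
  ('E_P[fun w => block_distortion (source_block h n w)
     (ldecode f (lencode f (label_block tau C n w) (source_block h n w)))])%E.
have [] := @diagonal R (fun n => @label_code R K N tau n (@index_count R N r n))
  (fun n f e => (err n f <= e%:E)%E /\ (dis n f <= (D + e)%:E)%E).
- move=> n; pose c0 := Ordinal (pmf_index_gt0 p1).
  pose m0 : 'I_(@index_count R N r n) := Ordinal (index_count_gt0 n N (ltW r0)).
  constructor; apply: (@LabelCode R K N tau n _ (fun _ _ => m0) (fun=> [tuple 0 | _ < n])
    (fun=> [tuple c0 | _ < intervals tau n])) => c.
  exact: measurable_fibers_cst.
- move=> n f e e' ee' [h1 h2]; split; first by rewrite (le_trans h1)// lee_fin.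
  by rewrite (le_trans h2)// lee_fin lerD2l.
- move=> e e0; have [n0 hn0] := codes_exist tau0 N0 p_gt0 p1 hmu hsource hr e0.
  exists n0 => n nn; have [[f hf] _] := hn0 n _ nn (index_count_lt r n N).
  by exists f.
move=> f hf; exists f; split.
  apply: limn_esup_le_cvg => //.
  apply: limn_esup_le => e e0; have [n0 hn0] := hf e e0.
  by exists n0 => n /hn0[h1 _]; rewrite add0r.
apply: limn_esup_le => e e0; have [n0 hn0] := hf e e0.
by exists n0 => n /hn0[].
Qed.

End achievability.

Lemma measurable_fun_select d (T : measurableType d) (R : realType) (I : finType)
    (k : T -> I) (F : I -> T -> R) :
  measurable_fibers k -> (forall i, measurable_fun setT (F i)) ->
  measurable_fun setT (fun x => F (k x) x).
Proof.
move=> mk mF; rewrite (_ : (fun x => _) = fun x => \sum_i F i x * \1_(k @^-1` [set i]) x).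
  apply: measurable_sum => i; apply: measurable_funM; first exact: mF.
  by apply: measurable_indic; exact: mk.
apply/funext => x; rewrite (bigD1 (k x))//= big1 ?addr0 => [|i ki].
  by rewrite indicE mem_set// mulr1.
rewrite indicE memNset ?mulr0// => /= kx.
by move: ki; rewrite kx eqxx.
Qed.

(** * The exact rate *)

Section time_sharing.
Context {R : realType} {K N : nat} {d : measure_display} {Omega : measurableType d}.
Variables (tau : nat) (tau0 : (0 < tau)%N) (P : probability Omega R).
Variables (p : 'I_K -> R) (mu : 'I_K -> probability (cvec R N) R).
Variables (Sigma : 'I_K -> 'M[R[i]]_N).
Variables (C : nat -> Omega -> 'I_K) (h : nat -> Omega -> cvec R N).
Hypothesis N0 : (0 < N)%N.
Hypothesis p_gt0 : forall c, 0 < p c.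
Hypothesis p1 : \sum_c p c = 1.
Hypothesis hmu : forall c, proper_gaussian (Sigma c) (mu c).
Hypothesis hsource : mixture_source tau P p mu C h.

Lemma second_moment_bound : exists2 V : R, 0 <= V &
  forall c, (\int[mu c]_v (sqnorm v)%:E <= V%:E)%E.
Proof.
pose v c := (\int[mu c]_v (sqnorm v)%:E)%E.
have v0 c : (0 <= v c)%E by apply: integral_ge0 => x _; rewrite lee_fin sqnorm_ge0.
have vfin c : v c \is a fin_num by rewrite ge0_fin_numE//; exact: gaussian_second_moment (hmu c).
exists (\sum_c fine (v c)); first by apply: sumr_ge0 => c _; exact: fine_ge0.
move=> c; rewrite -/(v c) -[v c]fineK// lee_fin (bigD1 c)//= lerDl.
by apply: sumr_ge0 => c' _; exact: fine_ge0.
Qed.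

Lemma measurable_source_block n : measurable_fun setT (source_block h n).
Proof.
apply/measurable_fun_tnthP => t.
rewrite (_ : _ \o _ = h t); last by apply/funext => w /=; rewrite tnth_mktuple.
exact: (source_vector_measurable hsource).
Qed.

Lemma measurable_encoded n M (f : @Defs.code R N n M) :
  measurable_fibers (fun w => Defs.encode f (source_block h n w)).
Proof.
move=> m; rewrite -[X in measurable X]setTI.
exact: (measurable_source_block measurableT (encode_measurable f m)).
Qed.

Lemma measurable_distortion n M (f : @Defs.code R N n M) :
  measurable_fun setT (fun w => block_distortion (source_block h n w)
    (Defs.decode f (Defs.encode f (source_block h n w)))).
Proof.
apply: (@measurable_fun_select _ _ _ _ (fun w => Defs.encode f (source_block h n w))
  (fun m w => block_distortion (source_block h n w) (Defs.decode f m))).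
  exact: measurable_encoded.
move=> m; apply: measurable_funM => //; apply: measurable_sum => t.
apply: measurable_sqnormB => //.
rewrite (_ : (fun w => _) = h t); last by apply/funext => w /=; rewrite tnth_mktuple.
exact: (source_vector_measurable hsource).
Qed.

Definition truncate (n n' : nat) (le_n : (n' <= n)%N) (v : n.-tuple (cvec R N)) :=
  [tuple tnth v (widen_ord le_n t) | t < n'].

Lemma measurable_truncate n n' (le_n : (n' <= n)%N) :
  measurable_fun setT (truncate le_n).
Proof.
apply/measurable_fun_tnthP => t.
rewrite (_ : _ \o _ = @tnth _ _ ^~ (widen_ord le_n t)).
  exact: measurable_tnth.
by apply/funext => v /=; rewrite tnth_mktuple.
Qed.

(** The vectors beyond [n'] are reconstructed as 0, the default value of [nth]. *)
Definition extended_code n n' M (le_n : (n' <= n)%N) (f : @Defs.code R N n' M) :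
    @Defs.code R N n M :=
  @Code R N n M (fun v => Defs.encode f (truncate le_n v))
    (fun m => [tuple nth 0 (Defs.decode f m) t | t < n])
    (fun m => eq_ind _ measurable (measurable_truncate le_n measurableT (encode_measurable f m))
       _ (setTI _)).

(** Each undescribed vector costs at most its second moment, where [N >= 1] absorbs the factor
    [1 / N]. For the described ones, normalizing by [n] instead of [n'] only helps. *)
Lemma extended_distortion n n' M (le_n : (n' <= n)%N) (f : @Defs.code R N n' M)
    (x V : R) : (0 < n')%N -> 0 <= x ->
  (forall c, (\int[mu c]_v (sqnorm v)%:E <= V%:E)%E) ->
  ('E_P[fun w => block_distortion (source_block h n' w)
     (Defs.decode f (Defs.encode f (source_block h n' w)))] <= x%:E)%E ->
  ('E_P[fun w => block_distortion (source_block h n w)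
     (Defs.decode (extended_code le_n f) (Defs.encode (extended_code le_n f) (source_block h n w)))]
   <= (x + (n - n')%N%:R / n%:R * V)%:E)%E.
Proof.
move=> n'0 x0 hV; rewrite unlock => hx.
have n0 : (0 < n)%N by exact: leq_trans le_n.
have n0' : 0 < n%:R :> R by rewrite ltr0n.
have n'0' : 0 < n'%:R :> R by rewrite ltr0n.
have N0' : 0 < N%:R :> R by rewrite ltr0n.
have N1 : 1 <= N%:R :> R by rewrite ler1n.
have p0 c : 0 <= p c by exact: ltW.
have V0 : 0 <= V.
  rewrite -lee_fin; apply: le_trans (hV (Ordinal (pmf_index_gt0 p1))).
  by apply: integral_ge0 => v _; rewrite lee_fin sqnorm_ge0.
have trE w : truncate le_n (source_block h n w) = source_block h n' w.
  by apply: eq_from_tnth => t; rewrite !tnth_mktuple.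
pose bd w := block_distortion (source_block h n' w)
     (Defs.decode f (Defs.encode f (source_block h n' w))).
have bd0 w : 0 <= bd w.
  by rewrite mulr_ge0 ?invr_ge0 ?mulr_ge0// sumr_ge0// => t _; exact: sqnorm_ge0.
have mbd : measurable_fun setT (EFin \o bd).
  by apply/measurable_EFinP; exact: measurable_distortion.
pose k : R := (n%:R * N%:R)^-1.
have k0 : 0 <= k by rewrite invr_ge0 mulr_ge0.
have msq t : measurable_fun setT (fun w => (sqnorm (h t w))%:E).
  apply/measurable_EFinP.
  exact: (measurableT_comp measurable_sqnorm (source_vector_measurable hsource t)).
apply: (@le_trans _ _ (\int[P]_w ((bd w)%:E + \sum_(n' <= t < n) k%:E * (sqnorm (h t w))%:E))%E).
  apply: ge0_le_integralT => w.
    by rewrite lee_fin mulr_ge0// sumr_ge0// => t _; exact: sqnorm_ge0.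
  under eq_bigr do rewrite -EFinM.
  rewrite sumEFin -EFinD lee_fin /= trE /block_distortion -/k.
  set m := Defs.encode f _.
  have -> : \sum_(t < n) sqnorm (tnth (source_block h n w) t -
       tnth [tuple nth 0 (Defs.decode f m) t | t < n] t) =
     \sum_(0 <= t < n) sqnorm (h t w - nth 0 (Defs.decode f m) t).
    by rewrite big_mkord; apply: eq_bigr => t _; rewrite !tnth_mktuple.
  rewrite (big_cat_nat (n := n'))//= mulrDr lerD//.
    rewrite big_mkord /bd /block_distortion -/m.
    rewrite [leRHS](_ : _ = (n'%:R * N%:R)^-1 *
      \sum_(t < n') sqnorm (h t w - nth 0 (Defs.decode f m) t)).
      rewrite ler_wpM2r//; first by apply: sumr_ge0 => t _; exact: sqnorm_ge0.
      by rewrite lef_pV2 ?posrE ?mulr_gt0// ler_pM2r// ler_nat.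
    congr (_ * _); apply: eq_bigr => t _; rewrite tnth_mktuple.
    by rewrite (tnth_nth 0).
  rewrite -mulr_sumr ler_wpM2l// big_nat_cond [leRHS]big_nat_cond.
  apply: ler_sum => t /andP[/andP[nt _] _].
  by rewrite nth_default ?subr0// size_tuple.
rewrite ge0_integralD//; last 3 first.
- by move=> w _; rewrite lee_fin.
- by move=> w _; apply: sume_ge0 => t _; rewrite -EFinM lee_fin mulr_ge0 ?sqnorm_ge0.
- by apply: emeasurable_sum => t; apply: emeasurable_funM.
rewrite EFinD; apply: leeD; first exact: hx.
rewrite ge0_integral_sum//; last 2 first.
- by move=> t; apply: emeasurable_funM.
- by move=> t w _; rewrite -EFinM lee_fin mulr_ge0 ?sqnorm_ge0.
apply: (@le_trans _ _ (\sum_(n' <= t < n) (k * V)%:E)%E).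
  apply: lee_sum => t _; rewrite ge0_integralZl_EFin//; last first.
    by move=> w _; rewrite lee_fin sqnorm_ge0.
  rewrite EFinM; apply: lee_wpmul2l; first by rewrite lee_fin.
  apply: (source_vector_integral_le tau0 p0 p1 hsource (g := @sqnorm R N)) => //.
    exact: measurable_sqnorm.
  exact: sqnorm_ge0.
rewrite sumEFin lee_fin sumr_const_nat -[leLHS]mulr_natl mulrA ler_wpM2r//.
rewrite ler_wpM2l// /k lef_pV2 ?posrE ?mulr_gt0//.
by rewrite ler_peMr// ltW.
Qed.

End time_sharing.

(** The shortened length n' satisfies n / n' >= 1 + 1 / (2 q). This amounts to
    [n <= (n %/ q) (2 q + 1)], which holds because [n < q (n %/ q + 1)] and [n %/ q >= 1]. *)
Lemma time_sharing_bound (n q : nat) : (0 < q)%N -> (q <= n)%N ->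
  ((n - n %/ q) * (2 * q + 1) <= 2 * q * n)%N.
Proof.
move=> q0 qn; have u1 : (0 < n %/ q)%N by rewrite divn_gt0.
have := divn_eq n q; have := ltn_pmod n q0.
set u := (n %/ q)%N in u1 *; set v := (n %% q)%N => vq nE.
by rewrite nE; nia.
Qed.

Lemma time_sharing_length (n n1 q : nat) : (1 < q)%N -> (2 * n1 + q + 2 <= n)%N ->
  [/\ q <= n, n1 <= n - n %/ q & 0 < n - n %/ q]%N.
Proof.
move=> q1 nn; have nq2 : (n %/ q <= n %/ 2)%N by exact: leq_div2l.
by split; lia.
Qed.

Section exact_rate.
Context {R : realType} {K N : nat} {d : measure_display} {Omega : measurableType d}.
Variables (tau : nat) (tau0 : (0 < tau)%N) (P : probability Omega R).
Variables (p : 'I_K -> R) (mu : 'I_K -> probability (cvec R N) R).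
Variables (Sigma : 'I_K -> 'M[R[i]]_N).
Variables (C : nat -> Omega -> 'I_K) (h : nat -> Omega -> cvec R N).
Hypothesis N0 : (0 < N)%N.
Hypothesis p_gt0 : forall c, 0 < p c.
Hypothesis p1 : \sum_c p c = 1.
Hypothesis hmu : forall c, proper_gaussian (Sigma c) (mu c).
Hypothesis hsource : mixture_source tau P p mu C h.

Definition constant_code n M (m0 : 'I_M) : @Defs.code R N n M :=
  @Code R N n M (fun=> m0) (fun=> [tuple 0 | _ < n])
    (@measurable_fibers_cst _ _ _ m0).

Lemma rate_cond_distortion_ge0 (D : R) : (rate_cond p mu D < +oo)%E -> 0 <= D.
Proof.
move=> /ereal_inf_lt[_ [Dc [Dc0 DcD] _] _]; apply: le_trans DcD.
by apply: sumr_ge0 => c _; rewrite mulr_ge0// ltW.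
Qed.

Lemma achievable_pos_rate (D r : R) : 0 < r -> (rate_gmtc tau p mu D <= r%:E)%E ->
  achievable P h r D.
Proof.
move=> r0 hr.
have D0 : 0 <= D.
  apply: rate_cond_distortion_ge0; apply: le_lt_trans (ltry r).
  apply: le_trans hr; rewrite leeDl// lee_fin divr_ge0 ?mulr_ge0//.
  exact: entropy2_ge0.
have [V V0 hV] := second_moment_bound hmu.
pose F n := @Defs.code R N n (@index_count R N r n).
pose dis n (f : F n) := ('E_P[fun w => block_distortion (source_block h n w)
     (Defs.decode f (Defs.encode f (source_block h n w)))])%E.
have [] := @diagonal R F (fun n f e => (dis n f <= (D + e)%:E)%E).
- by move=> n; constructor; exact: constant_code (Ordinal (index_count_gt0 n N (ltW r0))).
- by move=> n f e e' ee' h1; rewrite (le_trans h1)// lee_fin lerD2l.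
(* Omitting a fraction [1 / q] of the block costs at most [V / q <= e / 2]; the shift by 2 ensures
   [q > 1]. *)
- move=> e e0; pose q := (Num.truncn (2 * V / e)).+2.
  have q0 : 0 < q%:R :> R by rewrite ltr0n.
  have qV : q%:R^-1 * V <= e / 2.
    rewrite mulrC ler_pdivrMr//.
    have : 2 * V / e <= q%:R.
      by rewrite ltW// (lt_le_trans (truncnS_gt _))// ler_nat.
    by rewrite ler_pdivrMr//; lra.
  (* [r (1 + 1 / (2 q))]: a rate above [r] that the index set of length [n] still supports on the
     shortened block. *)
  pose r1 := r * (2 * q%:R + 1) / (2 * q%:R).
  have rr1 : (rate_gmtc tau p mu D < r1%:E)%E.
    apply: le_lt_trans hr _; rewrite lte_fin /r1 ltr_pdivlMr ?mulr_gt0//.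
    by rewrite ltr_pM2l// ltrDl.
  have e20 : 0 < e / 2 by rewrite divr_gt0.
  have [n1 hn1] := codes_exist tau0 N0 p_gt0 p1 hmu hsource rr1 e20.
  exists (2 * n1 + q + 2)%N => n nn.
  have [qn n1n' n'0] := time_sharing_length (isT : (1 < q)%N) nn.
  have le_n : (n - n %/ q <= n)%N by exact: leq_subr.
  have [|_ [f hf]] := hn1 (n - n %/ q)%N (@index_count R N r n) n1n' _.
    apply: le_lt_trans (index_count_lt r n N).
    rewrite ler_powR ?ler1n// /r1.
    rewrite mulrA ler_pdivrMr ?mulr_gt0//.
    have := time_sharing_bound (ltn0Sn _) qn.
    rewrite -(ler_nat R) !natrM natrD natrM => hts.
    have Nr : 0 <= N%:R * r by rewrite mulr_ge0// ltW.
    have := ler_wpM2l Nr hts; set n' := (n - _)%N.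
    have -> : N%:R * r * (n'%:R * (2 * q%:R + 1)) = n'%:R * N%:R * (r * (2 * q%:R + 1)).
      by ring.
    by have -> : N%:R * r * (2 * q%:R * n%:R) = n%:R * N%:R * r * (2 * q%:R) by ring.
  exists (extended_code le_n f); rewrite /dis.
  have x0 : 0 <= D + e / 2 by rewrite addr_ge0// ltW.
  apply: (le_trans (extended_distortion tau0 N0 p_gt0 p1 hsource le_n n'0 x0 hV hf)).
  rewrite lee_fin [X in _ <= D + X]splitr addrA lerD2l.
  apply: le_trans qV; rewrite ler_wpM2r// subKn ?leq_div//.
  rewrite ler_pdivrMr ?ltr0n ?(leq_trans n'0 le_n)//.
  by rewrite mulrC ler_pdivlMr// -natrM ler_nat leq_divM.
move=> f hf; exists f.
exact: limn_esup_le.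
Qed.

(* Donsker-Varadhan with the test function - s * dist: when the mutual information is small, the
   distortion of the coupling is at least nearly that of the product of its marginals. *)
Lemma second_moment_le (S : 'M[R[i]]_N) (nu : probability (cvec R N) R)
    (Q : probability (cvec R N * cvec R N)%type R) (k : R.-pker (cvec R N) ~> (cvec R N))
    (A B : finType) (qa : cvec R N -> A) (qb : cvec R N -> B) (rep : B -> cvec R N)
    (dist : A -> B -> R) (dmax eta v j s : R) (g : cvec R N -> R) :
  proper_gaussian S nu -> joint_law nu k Q ->
  measurable_fibers qa -> measurable_fibers qb ->
  (forall a b, 0 <= dist a b) -> (forall a b, dist a b <= dmax) ->
  measurable_fun setT g -> (forall v, 0 <= g v) ->
  (\int[nu]_v (g v)%:E <= (130 * eta)%:E)%E -> 0 <= eta ->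
  (forall v b, sqnorm (v - rep b) <= dist (qa v) b + eta + g v) ->
  (forall h y, dist (qa h) (qb y) <= (1 + eta) ^+ 2 * sqnorm (h - y) + eta) ->
  (\int[Q]_z (sqnorm (z.1 - z.2))%:E <= v%:E)%E ->
  (mutual_information Q <= j%:E)%E -> 0 < s ->
  fine (\int[nu]_v (sqnorm v)%:E)%E <=
    (1 + eta) ^+ 2 * v + 132 * eta + ln 2 * j / s + 2 * s * dmax ^+ 2.
Proof.
move=> hnu kQ mqa mqb dist0 hdmax mg g0 hg eta0 hd1 hd2 hv hj s0.
have ln2 : 0 < ln 2 :> R by rewrite ln_gt0// ltr1n.
set V := fine _.
have VE : (\int[nu]_v (sqnorm v)%:E = V%:E)%E.
  rewrite fineK// ge0_fin_numE; first exact: gaussian_second_moment hnu.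
  by apply: integral_ge0 => x _; rewrite lee_fin sqnorm_ge0.
pose m1 := cell_marginal1 Q qa qb; pose m2 := cell_marginal2 Q qa qb.
have m1E a : m1 a = fine (nu (qa @^-1` [set a])).
  by rewrite /m1 cell_marginal1E// (joint_law_marginal kQ).
have m10 a : 0 <= m1 a by rewrite m1E fine_ge0.
have m20 b : 0 <= m2 b by apply: sumr_ge0 => a _; exact: cell_prob_ge0.
have m11 : \sum_a m1 a = 1 by exact: sum_cell_marginal1.
have m21 : \sum_b m2 b = 1.
  by rewrite /m2 /cell_marginal2 exchange_big/= -m11.
(* A constant reproduction does not beat 0. The 131 [eta] here and one more from the coupling make
   up the 132 of the statement. *)
have Vb b : V <= \sum_a m1 a * dist a b + eta + 130 * eta.
  rewrite -lee_fin -VE; apply: (le_trans (gaussian_shift hnu (rep b))).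
  apply: (@le_trans _ _ (\int[nu]_x ((dist (qa x) b + eta)%:E + (g x)%:E))%E).
    apply: ge0_le_integralT => x; first by rewrite lee_fin sqnorm_ge0.
    by rewrite -EFinD lee_fin.
  have db0 a : 0 <= dist a b + eta by rewrite addr_ge0.
  rewrite ge0_integralD//; last 4 first.
  - by move=> x _; rewrite lee_fin.
  - by apply/measurable_EFinP; apply: (measurable_fun_fibers (fun a => dist a b + eta) mqa).
  - by move=> x _; rewrite lee_fin.
  - exact/measurable_EFinP.
  rewrite (integral_fibers mqa nu db0) EFinD; apply: leeD => //.
  rewrite lee_fin; under eq_bigr do rewrite -m1E mulrDr.
  by rewrite big_split/= -mulr_suml m11 mul1r.
have avg : V <= \sum_z m1 z.1 * m2 z.2 * dist z.1 z.2 + 131 * eta.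
  have : \sum_b m2 b * V <= \sum_b m2 b * (\sum_a m1 a * dist a b + eta + 130 * eta).
    by apply: ler_sum => b _; rewrite ler_wpM2l.
  rewrite -mulr_suml m21 mul1r.
  under eq_bigr do rewrite -addrA mulrDr.
  rewrite big_split/= -mulr_suml m21 mul1r.
  rewrite sum_pair exchange_big/=.
  rewrite (eq_bigr (fun b => \sum_a m1 a * m2 b * dist a b)); first by lra.
  by move=> b _; rewrite mulr_sumr; apply: eq_bigr => a _; ring.
have Wd := cell_distortion_le mqa mqb dist0 eta0 hd2 hv.
set D1 := \sum_z cell_prob Q qa qb z * _ in Wd.
set D2 := \sum_z _ in avg.
suff main : s * D2 <= s * D1 + ln 2 * j + 2 * s ^+ 2 * dmax ^+ 2.
  have : D2 <= D1 + ln 2 * j / s + 2 * s * dmax ^+ 2.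
    rewrite -(ler_pM2l s0) (le_trans main)// le_eqVlt; apply/orP; left; apply/eqP.
    by field; rewrite gt_eqF.
  by move: Wd avg; rewrite -/D1; lra.
have MI := le_trans (mutual_information_ge Q mqa mqb
  (w := fun z => expR (- (s * dist z.1 z.2))) (fun z => expR_gt0 _)) hj.
move: MI; rewrite lee_fin mulrC ler_pdivrMr// mulrC.
under eq_bigr do rewrite expRK mulrN mulrCA.
rewrite sumrN -mulr_sumr -/D1.
(* The quadratic bound holds for all negative exponents, so [s] need not be small. *)
have e2 : \sum_z m1 z.1 * m2 z.2 * expR (- (s * dist z.1 z.2)) <=
    1 - s * D2 + 2 * s ^+ 2 * dmax ^+ 2.
  have -> : 1 - s * D2 + 2 * s ^+ 2 * dmax ^+ 2 = \sum_z m1 z.1 * m2 z.2 *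
      (1 - s * dist z.1 z.2 + 2 * s ^+ 2 * dmax ^+ 2).
    have mm : \sum_z m1 z.1 * m2 z.2 = 1 by exact: sum_cell_marginals.
    rewrite (eq_bigr (fun z => m1 z.1 * m2 z.2 - s * (m1 z.1 * m2 z.2 * dist z.1 z.2) +
      m1 z.1 * m2 z.2 * (2 * s ^+ 2 * dmax ^+ 2))); last by move=> z _; ring.
    by rewrite !big_split/= sumrN -mulr_sumr -mulr_suml mm mul1r.
  apply: ler_sum => z _; rewrite ler_wpM2l ?mulr_ge0//.
  apply: le_trans (expR_le_quadratic _) _.
    apply: (@le_trans _ _ 0); last by rewrite invr_ge0.
    by rewrite oppr_le0 mulr_ge0// ltW.
  have hd : dist z.1 z.2 ^+ 2 <= dmax ^+ 2.
    by rewrite ler_sqr ?nnegrE// (le_trans (dist0 z.1 z.2)).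
  have s20 : 0 <= 2 * s ^+ 2 by rewrite mulr_ge0 ?sqr_ge0.
  by rewrite lerD2l sqrrN exprMn mulrA; exact: ler_wpM2l.
by move: e2; rewrite /m1 /m2; lra.
Qed.

End exact_rate.

(** * The case of rate zero *)

Section zero_rate.
Context {R : realType} {K N : nat} {d : measure_display} {Omega : measurableType d}.
Variables (tau : nat) (tau0 : (0 < tau)%N) (P : probability Omega R).
Variables (p : 'I_K -> R) (mu : 'I_K -> probability (cvec R N) R).
Variables (Sigma : 'I_K -> 'M[R[i]]_N).
Variables (C : nat -> Omega -> 'I_K) (h : nat -> Omega -> cvec R N).
Hypothesis N0 : (0 < N)%N.
Hypothesis p_gt0 : forall c, 0 < p c.
Hypothesis p1 : \sum_c p c = 1.
Hypothesis hmu : forall c, proper_gaussian (Sigma c) (mu c).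
Hypothesis hsource : mixture_source tau P p mu C h.

(** Since [rate_cond] vanishes, average mutual informations below any positive level are available.
    The order of choices matters: [eta] fixes the quantizer and hence [dmax], then [s] makes the
    second-order term [2 s dmax^2] small, and only then [x] makes the information term small
    relative to [s]. *)
Lemma zero_rate_second_moment (D : R) : (rate_cond p mu D = 0)%E ->
  \sum_c p c * fine (\int[mu c]_v (sqnorm v)%:E)%E <= N%:R * D.
Proof.
move=> R0; have D0 : 0 <= D.
  by apply: (rate_cond_distortion_ge0 (mu := mu) p_gt0); rewrite R0 ltry.
have ln2 : 0 < ln 2 :> R by rewrite ln_gt0// ltr1n.
have N0' : 0 < N%:R :> R by rewrite ltr0n.
have p0 c : 0 <= p c by exact: ltW.
have ND0 : 0 <= N%:R * D by rewrite mulr_ge0.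
apply/ler_addgt0Pr => e e0.
have B0 : 0 < 3 * (N%:R * D) + 132 by lra.
pose eta := Num.min 1 (e / 3 / (3 * (N%:R * D) + 132)).
have eta0 : 0 < eta by rewrite lt_min ltr01 !divr_gt0.
have eta1 : eta <= 1 by rewrite ge_min lexx.
have etae : eta * (3 * (N%:R * D) + 132) <= e / 3.
  by rewrite -ler_pdivlMr// ge_min lexx orbT.
have [A [B [qa [qb [rep [dist [dmax [g]]]]]]]] := gaussian_quantization hmu eta0.
case=> -[mqa mqb] [dist0 hdmax] [mg g0 hg] hd1 hd2.
have dm1 : 0 < 6 * (dmax ^+ 2 + 1) by rewrite mulr_gt0// ltr_wpDl ?sqr_ge0.
pose s := e / (6 * (dmax ^+ 2 + 1)).
have s0 : 0 < s by rewrite divr_gt0.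
have sdm : 2 * s * dmax ^+ 2 <= e / 3.
  have : s * (6 * (dmax ^+ 2 + 1)) = e by rewrite /s divfK// gt_eqF.
  by move: s0; clearbody s; lra.
(* Solves [ln 2 / s * (N x) = e / 3]. *)
pose x := e / 3 * s / (ln 2 * N%:R).
have x0 : 0 < x.
  by apply: divr_gt0; [apply: mulr_gt0 => //; exact: divr_gt0|exact: mulr_gt0].
have rx : (rate_cond p mu D < x%:E)%E by rewrite R0 lte_fin.
have [Q [j [Dc [kQ MIj pjx sqDc [Dc0 DcD]]]]] := rate_cond_near_optimal N0 p_gt0 p1 rx.
apply: (@le_trans _ _ (\sum_c p c * ((1 + eta) ^+ 2 * (N%:R * Dc c) + 132 * eta +
    ln 2 * j c / s + 2 * s * dmax ^+ 2))).
  apply: ler_sum => c _; rewrite ler_wpM2l//; have [k hk] := kQ c.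
  exact: (second_moment_le (hmu c) hk mqa mqb dist0 hdmax mg g0 (hg c) (ltW eta0)
    hd1 hd2 (sqDc c) (MIj c) s0).
rewrite (eq_bigr (fun c => (1 + eta) ^+ 2 * N%:R * (p c * Dc c) + ln 2 / s * (p c * j c) +
  p c * (132 * eta + 2 * s * dmax ^+ 2))); last by move=> c _; ring.
rewrite !big_split/= -!mulr_sumr -mulr_suml p1 mul1r.
have h1 : (1 + eta) ^+ 2 * N%:R * \sum_c p c * Dc c <= (1 + 3 * eta) * (N%:R * D).
  apply: (@le_trans _ _ ((1 + eta) ^+ 2 * N%:R * D)).
    by rewrite ler_wpM2l// mulr_ge0 ?sqr_ge0.
  rewrite -mulrA ler_wpM2r// sqrrD.
  have : eta ^+ 2 <= eta by rewrite expr2 ger_pMl.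
  by lra.
have h2 : ln 2 / s * \sum_c p c * j c <= e / 3.
  apply: (@le_trans _ _ (ln 2 / s * (N%:R * x))).
    by rewrite ler_wpM2l ?(ltW pjx)// divr_ge0// ltW.
  rewrite le_eqVlt; apply/orP; left; apply/eqP; rewrite /x; field.
  by rewrite !gt_eqF.
by move: h1 h2 sdm etae; lra.
Qed.

Lemma achievable_zero_rate (D r : R) : 0 <= r -> (rate_cond p mu D = 0)%E ->
  achievable P h r D.
Proof.
move=> r0 /zero_rate_second_moment hD.
have N0' : 0 < N%:R :> R by rewrite ltr0n.
have p0 c : 0 <= p c by exact: ltW.
exists (fun n => constant_code (N := N) n (Ordinal (index_count_gt0 n N r0))).
apply: limn_esup_le => e e0; exists 1%N => n n0.
have n0' : 0 < n%:R :> R by rewrite ltr0n.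
pose V := \sum_c p c * fine (\int[mu c]_v (sqnorm v)%:E)%E.
have msq t : measurable_fun setT (fun w => (sqnorm (h t w))%:E).
  apply/measurable_EFinP.
  exact: (measurableT_comp measurable_sqnorm (source_vector_measurable hsource t)).
have hV t : (\int[P]_w (sqnorm (h t w))%:E = V%:E)%E.
  rewrite (source_vector_integral tau0 p0 p1 hsource t (g := EFin \o @sqnorm R N)); last 2 first.
  - by apply/measurable_EFinP; exact: measurable_sqnorm.
  - by move=> v; rewrite lee_fin sqnorm_ge0.
  rewrite -sumEFin; apply: eq_bigr => c _; rewrite EFinM fineK// ge0_fin_numE.
    exact: gaussian_second_moment (hmu c).
  by apply: integral_ge0 => v _; rewrite lee_fin sqnorm_ge0.
pose k : R := (n%:R * N%:R)^-1.
have k0 : 0 <= k by rewrite invr_ge0 mulr_ge0// ltW.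
rewrite unlock.
rewrite (eq_integral (fun w => \sum_(t < n) k%:E * (sqnorm (h t w))%:E)%E); last first.
  move=> w _; under eq_bigr do rewrite -EFinM.
  rewrite sumEFin -mulr_sumr; congr (_ * _)%:E.
  by apply: eq_bigr => t _; rewrite !tnth_mktuple subr0.
rewrite ge0_integral_sum//; last 2 first.
- by move=> t; apply: emeasurable_funM.
- by move=> t w _; rewrite -EFinM lee_fin mulr_ge0 ?sqnorm_ge0.
rewrite (eq_bigr (fun=> (k * V)%:E)) => [|t _]; last first.
  rewrite ge0_integralZl_EFin//; first by rewrite hV.
  by move=> w _; rewrite lee_fin sqnorm_ge0.
rewrite sumEFin lee_fin sumr_const card_ord -[leLHS]mulr_natl.
have -> : n%:R * (k * V) = V / N%:R by rewrite /k; field; rewrite !gt_eqF.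
rewrite ler_pdivrMr// mulrDl [D * _]mulrC (le_trans hD)// lerDl.
by rewrite mulr_ge0// ltW.
Qed.

End zero_rate.

Theorem theorem3 (R : realType) (K N tau : nat)
    (hK : (1 <= K)%N) (hN : (1 <= N)%N) (htau : (1 <= tau)%N)
    (p : 'I_K -> R) (p_gt0 : forall c, 0 < p c) (p_sum : \sum_(c < K) p c = 1)
    (Sigma : 'I_K -> 'M[R[i]]_N)
    (hSigma : forall c, covariance_matrix (Sigma c))
    (mu : 'I_K -> probability (cvec R N) R)
    (hmu : forall c, proper_gaussian (Sigma c) (mu c))
    (d : measure_display) (Omega : measurableType d) (P : probability Omega R)
    (C : nat -> Omega -> 'I_K) (h : nat -> Omega -> cvec R N)
    (hsource : mixture_source tau P p mu C h)
    (D : R) (hfin : rate_gmtc tau p mu D \is a fin_num) :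
  achievable P h (fine (rate_gmtc tau p mu D)) D /\
  (forall r : R, fine (rate_gmtc tau p mu D) < r ->
     achievable_with_labels tau P C h r D).
Proof.
have rE : rate_gmtc tau p mu D = (fine (rate_gmtc tau p mu D))%:E by rewrite fineK.
split; last first.
  move=> r hr; apply: (achievable_with_labels_gt htau hN p_gt0 p_sum hmu hsource).
  by rewrite rE lte_fin.
have := rate_gmtc_ge0 tau mu p_gt0 p_sum D; rewrite rE lee_fin le_eqVlt.
move=> /orP[/eqP r0|r0]; last first.
  by apply: (achievable_pos_rate htau hN p_gt0 p_sum hmu hsource) => //; rewrite -rE.
apply: (achievable_zero_rate htau hN p_gt0 p_sum hmu hsource); first by rewrite -r0.
(* Both summands of the rate are nonnegative, so a zero total forces the conditional benchmark to
   vanish. *)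
have ent0 : (0 <= (entropy2 p / (tau%:R * N%:R))%:E)%E.
  by rewrite lee_fin divr_ge0 ?mulr_ge0//; exact: entropy2_ge0.
apply/eqP; rewrite eq_le rate_cond_ge0// andbT.
have -> : 0%E = rate_gmtc tau p mu D by rewrite rE -r0.
by rewrite leeDl.
Qed.
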